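(* Let $J\subseteq\mathbb{N}^*$ be nonempty, $m\geq 0$ an integer and $\alpha\in K\setminus\{0\}$. Consider the Dyson-Schwinger equation $$(E):\quad x=\sum_{j\in J,\ m\mid j}B_j(1+\alpha x)+\sum_{j\in J,\ m\nmid j}B_j(1).$$ Let $\mathcal{J}$ be the set of all positive integers of the form $a_1j_1+\cdots+a_kj_k$ with $k\geq 1$, $a_1,\ldots,a_{k-1}\in\mathbb{N}^*$, $a_k\in\{0,1\}$, $j_1,\ldots,j_k\in J$ and $m\mid j_1,\ldots,m\mid j_{k-1}$. Then the subalgebra generated by the homogeneous components of the solution of $(E)$ is a Hopf subalgebra of $\mathcal{H}_{CK}^J$, and its graded dual is isomorphic to the enveloping algebra of (the Lie algebra associated with) a pre-Lie algebra $\mathfrak{g}$ having a basis $(f_i)_{i\in\mathcal{J}}$ in which the pre-Lie product is, for all $i,j\in\mathcal{J}$, $$f_i\circ f_j=\begin{cases}0&\text{if } m\nmid j,\\ f_{i+j}&\text{if } m\mid j.\end{cases}$$ Moreover, the product $\circ$ is associative.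
   Context: $K$ is a field of characteristic zero and $\mathbb{N}^*=\{1,2,3,\ldots\}$. Let $J\subseteq\mathbb{N}^*$ be nonempty. A rooted tree decorated by $J$ is a finite (non-planar) rooted tree, up to isomorphism, each vertex of which carries an element of $J$. $\mathcal{H}_{CK}^J$ is the free commutative unital $K$-algebra generated by these trees; its basis consists of monomials in trees (decorated rooted forests), the empty forest being $1$. Its coproduct is the algebra morphism given on trees by $\Delta(t)=t\otimes 1+1\otimes t+\sum_c P^c(t)\otimes R^c(t)$, the sum being over admissible cuts $c$ of $t$, i.e. nonempty sets of edges such that every path from the root to a leaf meets at most one edge of $c$; deleting the edges of $c$, $R^c(t)$ is the component containing the root and $P^c(t)$ is the product of the other components. This is a Hopf algebra, graded by: degree of a forest $=$ sum of its decorations. $B_j$ is the linear map sending a forest $t_1\cdots t_n$ to the tree obtained by grafting $t_1,\ldots,t_n$ on a common new root decorated by $j$ ($B_j(1)$ is the single vertex decorated by $j$). The completion of $\mathcal{H}_{CK}^J$ is the space of formal series $\sum_F a_F F$ over decorated forests, and $B_j$ extends to it. The equation $(E)$ has a unique solution $x$ in this completion (with zero constant term); $x(n)$ is its homogeneous component of degree $n$. A (left) pre-Lie algebra is a vector space with a bilinear product $\circ$ satisfying $(x\circ y)\circ z-x\circ(y\circ z)=(y\circ x)\circ z-y\circ(x\circ z)$; the associated Lie bracket is $[x,y]=x\circ y-y\circ x$. The graded dual is taken with respect to the gradation induced on the subalgebra by the gradation of $\mathcal{H}_{CK}^J$ in which the degree of a decorated forest is the sum of its decorations. Convention: $0\mid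 j$ if and only if $j=0$. *)

(* Defs.v *)
From HB Require Import structures.
From mathcomp Require Import all_boot all_order all_algebra generic_quotient finmap.
From mathcomp.multinomials Require Import monalg.
From mathcomp.classical Require Import boolp classical_sets fsbigop.

Set Implicit Arguments.
Unset Strict Implicit.
Unset Printing Implicit Defensive.

Import GRing.Theory.
Local Open Scope ring_scope.

Inductive ptree (D : Type) : Type := PNode of D & seq (ptree D).

Section PTreeChoice.

Variable D : Type.

Definition ptree_rect_seq (P : ptree D -> Prop)
    (IH : forall d s, foldr (fun t Q => P t /\ Q) True s -> P (PNode d s)) :
  forall t, P t :=
  fix loop t := let: PNode d s := t in
    IH d s ((fix loops s : foldr (fun t Q => P t /\ Q) True s :=
      if s is t :: s' then conj (loop t) (loops s') else I) s).

Fixpoint ptree_encode (t : ptree D) : GenTree.tree D :=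
  let: PNode d s := t in
  GenTree.Node 0 (GenTree.Leaf d :: map ptree_encode s).

Fixpoint ptree_decode (u : GenTree.tree D) : option (ptree D) :=
  if u is GenTree.Node _ (GenTree.Leaf d :: us)
  then Some (PNode d (pmap id (map ptree_decode us))) else None.

Lemma ptree_encodeK : pcancel ptree_encode ptree_decode.
Proof.
elim/ptree_rect_seq => d s IH /=; congr (Some (PNode d _)).
by elim: s IH => //= t s IHs [-> /IHs /= ->].
Qed.

End PTreeChoice.

HB.instance Definition _ (D : choiceType) :=
  Choice.copy (ptree D) (pcan_type (@ptree_encodeK D)).

Section Trees.

Variable D : choiceType.

(* Isomorphism of decorated rooted trees, forgetting the planar structure: the
   roots carry the same decoration, and the branches at the two roots are
   matched bijectively with isomorphic ones. *)
Fixpoint piso (t u : ptree D) : bool :=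
  match t, u with PNode d s, PNode d' s' =>
    (d == d') && has (fun s'' => all2 piso s s'') (permutations s')
  end.

Lemma pisoP (d d' : D) (s s' : seq (ptree D)) :
  reflect (d = d' /\ exists2 s'', perm_eq s'' s' & all2 piso s s'')
          (piso (PNode d s) (PNode d' s')).
Proof.
apply: (iffP andP) => [[/eqP-> /hasP[s'']]|[-> [s'' ps'' ss'']]].
  by rewrite mem_permutations => ps'' ss''; split=> //; exists s''.
by split=> //; apply/hasP; exists s''; rewrite // mem_permutations.
Qed.

Lemma all2_perm (T : eqType) (r : rel T) (s1 s2 s1' : seq T) :
  all2 r s1 s2 -> perm_eq s1' s1 ->
  exists2 s2', perm_eq s2' s2 & all2 r s1' s2'.
Proof.
case: s1 => [|x0 s1] r12.
  by move=> /perm_nilP ->; exists [::]; case: s2 r12.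
move=> /(perm_iotaP x0)[js pjs ->]; move: r12; set s := x0 :: s1 => r12.
have /andP[/eqP sz /allP r12'] : (size s == size s2) &&
    all (fun p => r p.1 p.2) (zip s s2) by rewrite -all2E.
exists (map (nth x0 s2) js).
  by apply/(perm_iotaP x0); exists js => //; rewrite -sz.
rewrite all2E !size_map eqxx /= zip_map all_map; apply/allP => j.
rewrite (perm_mem pjs) mem_iota add0n /= => ltj.
by apply: (r12' (_, _)); rewrite -nth_zip // mem_nth // size_zip -sz minnn.
Qed.

Lemma piso_refl : reflexive piso.
Proof.
elim/ptree_rect_seq => d s IH; apply/pisoP; split=> //; exists s => //.
by elim: s IH => //= t s IHs [-> /IHs].
Qed.

Lemma piso_sym_imp t u : piso t u -> piso u t.
Proof.
elim/ptree_rect_seq: t u => d s IH [d' s'] /pisoP[<- [s'' ps'' ss'']].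
have s''s : all2 piso s'' s.
  elim: s s'' IH {ps''} ss'' => [|t s IHs] [|u s''] //= [IHt IH].
  by move=> /andP[/IHt-> /IHs->].
have [s2 ps2 s's2] : exists2 s2, perm_eq s2 s & all2 piso s' s2.
  by apply: all2_perm s''s _; rewrite perm_sym.
by apply/pisoP; split=> //; exists s2.
Qed.

Lemma piso_sym : symmetric piso.
Proof. by move=> t u; apply/idP/idP; apply: piso_sym_imp. Qed.

Lemma piso_trans : transitive piso.
Proof.
move=> u t v; elim/ptree_rect_seq: t u v => d s IH [d1 s1] [d2 s2].
move=> /pisoP[<- [s1' ps1' ss1']] /pisoP[<- [s2' ps2' s1s2']].
have [s3 ps3 s1's3] := all2_perm s1s2' ps1'.
apply/pisoP; split=> //; exists s3; first exact: perm_trans ps3 ps2'.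
elim: s s1' s3 IH ss1' s1's3 {ps1' ps3} => [|t s IHs] [|u s1'] [|v s3] //=.
move=> [IHt IH] /andP[tu ss1'] /andP[uv s1's3].
by rewrite (IHt _ _ tu uv) (IHs _ _ IH ss1' s1's3).
Qed.

Canonical piso_equiv := EquivRel piso piso_refl piso_sym piso_trans.

Definition tree : Type := {eq_quot piso}%qT.
HB.instance Definition _ := Choice.on tree.
HB.instance Definition _ := EqQuotient.on tree.

End Trees.

Notation forest D := {cmonom (tree D)}.

Section Cuts.

Variable D : choiceType.
Implicit Types (t : ptree D) (e : seq nat) (c : seq (seq nat)).

(* A vertex is the list of branch indices on the path to it from the root; an
   edge is denoted by its lower end, hence by a nonempty list. *)
Fixpoint edges t : seq (seq nat) :=
  let: PNode _ s := t in
  flatten [seq [:: q.1] :: map (cons q.1) q.2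
          | q <- zip (iota 0 (size s)) (map edges s)].

Fixpoint leaves t : seq (seq nat) :=
  let: PNode _ s := t in
  if s is [::] then [:: [::]]
  else flatten [seq map (cons q.1) q.2
               | q <- zip (iota 0 (size s)) (map leaves s)].

(* The edge e lies on the path from the root to the vertex l iff e is a prefix
   of l. *)
Definition admissible t c : bool :=
  (c != [::]) && all (fun l => count (fun e => prefix e l) c <= 1)%N (leaves t).

Definition cut_in (i : nat) c : seq (seq nat) :=
  [seq behead e | e <- c & (1 < size e)%N && (head 0%N e == i)].

(* The connected components left when the edges in c are deleted: the one
   containing the root, and the list of the others. *)
Fixpoint components t c : ptree D * seq (ptree D) :=
  let: PNode d s := t in
  let qs := [seq (q.1, q.2 (cut_in q.1 c))
            | q <- zip (iota 0 (size s)) (map components s)] in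
  (PNode d [seq q.2.1 | q <- qs & [:: q.1] \notin c],
   flatten [seq if [:: q.1] \in c then q.2.1 :: q.2.2 else q.2.2 | q <- qs]).

Definition tree_class t : tree D := \pi_(tree D)%qT t.

Definition forest_of (s : seq (ptree D)) : forest D :=
  (\big[mmul/mone]_(t <- s) ucm (tree_class t))%M.

Definition branches (F : forest D) : seq (ptree D) :=
  flatten [seq nseq (F u) (repr u) | u <- finsupp (cmonom_val F)].

(* The operator B_j on forests: graft returns a tree, graftF the same tree as a
   one-tree forest. *)
Definition graft (j : D) (F : forest D) : tree D :=
  tree_class (PNode j (branches F)).

Definition graftF (j : D) (F : forest D) : forest D := ucm (graft j F).

Variable wt : D -> nat.

Fixpoint ptree_deg t : nat :=
  let: PNode d s := t in (wt d + sumn (map ptree_deg s))%N.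

(* The sum of the decorations, the decoration d being counted as wt d. *)
Definition deg (F : forest D) : nat := sumn (map ptree_deg (branches F)).

End Cuts.

Section ForestPair.

Variable D : choiceType.
Implicit Types p q r : forest D * forest D.

Definition fpair_one : forest D * forest D := (mone, mone).
Definition fpair_mul p q : forest D * forest D := (mmul p.1 q.1, mmul p.2 q.2).

Lemma fpair_mulA : associative fpair_mul.
Proof. by move=> p q r; congr pair; apply: mulmA. Qed.
Lemma fpair_mul1 : left_id fpair_one fpair_mul.
Proof. by case=> F G; congr pair; apply: mul1m. Qed.
Lemma fpair_mulr1 : right_id fpair_one fpair_mul.
Proof. by case=> F G; congr pair; apply: mulm1. Qed.
Lemma fpair_unit p q :
  fpair_mul p q = fpair_one -> p = fpair_one /\ q = fpair_one.
Proof.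
by case: p q => F G [F' G'] [/unitm[-> ->] /unitm[-> ->]].
Qed.
Lemma fpair_mulC : commutative fpair_mul.
Proof. by move=> p q; congr pair; apply: mulmC. Qed.

HB.instance Definition _ := Choice_isMonomialDef.Build (forest D * forest D)%type
  fpair_mulA fpair_mul1 fpair_mulr1 fpair_unit.
HB.instance Definition _ :=
  MonomialDef_isConomialDef.Build (forest D * forest D)%type fpair_mulC.

End ForestPair.

Notation HCK K D := {malg K[forest D]}.
Notation HCK2 K D := {malg K[(forest D * forest D)%type]}.

Section HopfAlgebra.

Variables (K : fieldType) (D : choiceType).
Local Notation H := (HCK K D).
Local Notation HH := (HCK2 K D).

(* H (x) H is the algebra over K of the monoid of pairs of forests; (F, G)
   stands for F (x) G and tens a b for a (x) b. *)
Definition tens (a b : H) : HH :=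
  \sum_(F <- msupp a) \sum_(G <- msupp b) << a@_F * b@_G *g (F, G) >>.

(* An admissible cut is a nonempty subset of the edges of a planar
   representative, selected by a mask; P and R are the pruned part and the
   component of the root. *)
Definition comul_tree (t : tree D) : HH :=
  let p := repr t in
  << (ucm t, mone) >> + << (mone, ucm t) >>
  + \sum_(b : (size (edges p)).-tuple bool | admissible p (mask b (edges p)))
      let: (R, P) := components p (mask b (edges p)) in
      << (forest_of P, ucm (tree_class R)) >>.

Definition comul_forest (F : forest D) : HH :=
  \prod_(t <- finsupp (cmonom_val F)) comul_tree t ^+ F t.

Definition comul (a : H) : HH :=
  \sum_(F <- msupp a) a@_F *: comul_forest F.

Definition counit (a : H) : K := a@_mone.

Definition is_antipode (S : {linear H -> H}) : Prop :=
  forall a : H,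
    \sum_(p <- msupp (comul a)) (comul a)@_p *: (S << p.1 >> * << p.2 >>)
      = counit a *: 1 /\
    \sum_(p <- msupp (comul a)) (comul a)@_p *: (<< p.1 >> * S << p.2 >>)
      = counit a *: 1.

Definition hopf_subalgebra (A : {pred H}) : Prop :=
  [/\ GRing.subalg_closed A,
      forall a, a \in A -> exists s : seq (H * H),
        all (fun p => (p.1 \in A) && (p.2 \in A)) s /\
        comul a = \sum_(p <- s) tens p.1 p.2
    & exists S : {linear H -> H},
        is_antipode S /\ forall a, a \in A -> S a \in A].

(* The function y stands for the series sum_F (y F) F. *)
Definition series : Type := forest D -> K.

Definition series_one : series := fun F => (F == mone)%:R.

(* Linear extension of graftF j to series: at most one F contributes. *)
Definition series_graft (j : D) (y : series) : series :=
  fun G => \sum_(F \in [set F | graftF j F = G]%classic) y F.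

End HopfAlgebra.

Section Generated.

Variables (K : fieldType) (B : algType K) (X : B -> Prop).

Definition gen_pred : {pred B} := fun a =>
  `[< forall A : {pred B}, GRing.subalg_closed A ->
        (forall b, X b -> b \in A) -> a \in A >].

Lemma gen_pred_closed : GRing.subalg_closed gen_pred.
Proof.
split.
- by apply/asboolP => A [].
- move=> c u v /asboolP Au /asboolP Av; apply/asboolP => A clA XA.
  by have [_ + _] := clA; apply; [apply: Au|apply: Av].
- move=> u v /asboolP Au /asboolP Av; apply/asboolP => A clA XA.
  by have [_ _ +] := clA; apply; [apply: Au|apply: Av].
Qed.

HB.instance Definition _ := GRing.isSubalgClosed.Build K B gen_pred gen_pred_closed.

Definition gen_alg : Type := {a : B | a \in gen_pred}.
HB.instance Definition _ := SubChoice.on gen_alg.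
HB.instance Definition _ := [SubChoice_isSubAlgebra of gen_alg by <:].

End Generated.

Record preLieAlgebra (K : fieldType) := PreLieAlgebra {
  pl_sort :> lmodType K;
  pl_mul : pl_sort -> pl_sort -> pl_sort;
  pl_linearl : forall z, linear (pl_mul^~ z);
  pl_linearr : forall z, linear (pl_mul z);
  pl_identity : forall x y z,
    pl_mul (pl_mul x y) z - pl_mul x (pl_mul y z)
      = pl_mul (pl_mul y x) z - pl_mul y (pl_mul x z)
}.

Section Enveloping.

Variables (K : fieldType) (g : preLieAlgebra K).

Definition pl_bracket (x y : g) : g := pl_mul x y - pl_mul y x.

Definition lie_morphism (B : algType K) (phi : {linear g -> B}) : Prop :=
  forall x y, phi (pl_bracket x y) = phi x * phi y - phi y * phi x.

(* Universal property of the enveloping algebra of (g, pl_bracket). *)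
Definition is_enveloping (U : algType K) (iota : {linear g -> U}) : Prop :=
  lie_morphism iota /\
  forall (B : algType K) (phi : {linear g -> B}), lie_morphism phi ->
    (exists psi : {lrmorphism U -> B}, forall x, psi (iota x) = phi x) /\
    forall psi psi' : {lrmorphism U -> B},
      (forall x, psi (iota x) = phi x) -> (forall x, psi' (iota x) = phi x) ->
      forall u, psi u = psi' u.

(* The coproduct U -> U (x) U of the enveloping algebra, i.e. the algebra
   morphism sending iota x to iota x (x) 1 + 1 (x) iota x. A list s stands for
   the tensor sum_(p <- s) p.1 (x) p.2; env_comul u s says that s is an
   expression of the coproduct of u. *)
Inductive env_comul (U : algType K) (iota : {linear g -> U}) :
    U -> seq (U * U) -> Prop :=
| EnvComul1 : env_comul iota 1 [:: (1, 1)]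
| EnvComulI x : env_comul iota (iota x) [:: (iota x, 1); (1, iota x)]
| EnvComulZ (c : K) u s : env_comul iota u s ->
    env_comul iota (c *: u) [seq (c *: p.1, p.2) | p <- s]
| EnvComulD u v s r : env_comul iota u s -> env_comul iota v r ->
    env_comul iota (u + v) (s ++ r)
| EnvComulM u v s r : env_comul iota u s -> env_comul iota v r ->
    env_comul iota (u * v) [seq (p.1 * q.1, p.2 * q.2) | p <- s, q <- r].

(* The counit of the enveloping algebra: the algebra morphism killing g. *)
Definition is_env_counit (U : algType K) (iota : {linear g -> U})
    (eps : {lrmorphism U -> K^o}) : Prop :=
  forall x, eps (iota x) = 0.

(* The family (f_i), i in I, is a basis of g; f is irrelevant outside I. *)
Definition is_basis_on (I : nat -> Prop) (f : nat -> g) : Prop :=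
  (forall x : g, exists (s : seq nat) (c : nat -> K),
     (forall i, i \in s -> I i) /\ x = \sum_(i <- s) c i *: f i) /\
  (forall (s : seq nat) (c : nat -> K), uniq s -> (forall i, i \in s -> I i) ->
     \sum_(i <- s) c i *: f i = 0 -> forall i, i \in s -> c i = 0).

End Enveloping.

Section GradedDual.

Variables (K : fieldType) (D : choiceType) (wt : D -> nat).
Variable X : HCK K D -> Prop.
Local Notation H := (HCK K D).
Local Notation A := (gen_alg X).

Definition homogeneous (n : nat) (a : H) : Prop :=
  forall F, F \in msupp a -> deg wt F = n.

Definition in_graded_dual (f : {scalar A}) : Prop :=
  exists N : nat, forall (n : nat) (a : A), (N <= n)%N ->
    homogeneous n (val a) -> f a = 0.

(* h is the product f * g = (f (x) g) o Delta of the graded dual. *)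
Definition dual_product (f g h : {scalar A}) : Prop :=
  forall (a : A) (s : seq (A * A)),
    comul (val a) = \sum_(p <- s) tens (val p.1) (val p.2) ->
    h a = \sum_(p <- s) f p.1 * g p.2.

(* Phi is an isomorphism of Hopf algebras from U to the graded dual of A. The
   coproduct of f in the graded dual is (a (x) b |-> f (a * b)), its counit is
   f |-> f 1, and its unit is the counit of A. Compatibility with the antipodes
   is automatic for an isomorphism of bialgebras. *)
Definition is_hopf_iso_to_graded_dual (g : preLieAlgebra K) (U : algType K)
    (iota : {linear g -> U}) (Phi : U -> {scalar A}) : Prop :=
  [/\ forall c u v a, Phi (c *: u + v) a = c * Phi u a + Phi v a,
      [/\ forall u, in_graded_dual (Phi u),
          forall u v, (forall a, Phi u a = Phi v a) -> u = v
        & forall f, in_graded_dual f -> exists u, forall a, Phi u a = f a],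
      (forall a, Phi 1 a = counit (val a)) /\
      (forall u v, dual_product (Phi u) (Phi v) (Phi (u * v)))
    & (forall eps, is_env_counit iota eps -> forall u, Phi u 1 = eps u) /\
      (forall u s, env_comul iota u s -> forall a b,
         Phi u (a * b) = \sum_(p <- s) Phi p.1 a * Phi p.2 b)].

End GradedDual.

Section DysonSchwinger.

Variables (K : fieldType) (J : {pred nat}).

Definition deco : Type := {j : nat | j \in J}.
HB.instance Definition _ := Choice.on deco.

Definition deco_val (j : deco) : nat := val j.

(* Equality of formal series is coefficientwise; in each coefficient at most
   one j contributes to the sums. *)
Definition dyson_schwinger (m : nat) (alpha : K) (x : series K deco) : Prop :=
  forall G : forest deco,
    x G = \sum_(j \in [set j : deco | (m %| deco_val j)%N]%classic)
            series_graft j (fun F => series_one K F + alpha * x F) G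
        + \sum_(j \in [set j : deco | ~~ (m %| deco_val j)%N]%classic)
            series_graft j (series_one K (D := deco)) G.

Definition hom_component (x : series K deco) (n : nat) : HCK K deco :=
  \sum_(F \in [set F | deg deco_val F = n]%classic) << x F *g F >>.

Definition components_of (x : series K deco) (a : HCK K deco) : Prop :=
  exists n, a = hom_component x n.

Definition index_set (m n : nat) : Prop :=
  (0 < n)%N /\
  exists (k : nat) (a j : 'I_k.+1 -> nat),
    [/\ forall i, j i \in J,
        forall i, i != ord_max -> (0 < a i)%N /\ (m %| j i)%N,
        (a ord_max <= 1)%N
      & n = (\sum_i a i * j i)%N].

End DysonSchwinger.

(* Main.v *)
Require Import Defs.
From HB Require Import structures.
From mathcomp Require Import all_boot all_order all_algebra generic_quotient finmap.
From mathcomp.multinomials Require Import monalg.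
From mathcomp.classical Require Import boolp classical_sets fsbigop.

Set Implicit Arguments.
Unset Strict Implicit.
Unset Printing Implicit Defensive.

Import GRing.Theory.
Local Open Scope ring_scope.

(** Write Y_n for the component of degree n of the solution x, and put Z_0 = 1/alpha
    and Z_n = Y_n for n > 0, so that 1 + alpha x is alpha times the sum of all Z_n.

    The Hopf subalgebra. In degree n the equation reads
      Y_n = alpha * sum of B_j(Z_(n-j)), over j <= n in J such that m | j or j = n
    (Yrec). Since Delta (B_j a) = B_j a (x) 1 + (id (x) B_j) (Delta a) (Delta_bgraft),
    an induction on n gives
      Delta Z_n = 1 (x) Z_n + alpha * sum of Y_a (x) Z_(n-a), over 0 < a <= n, m | n - a
    (Delta_Z). So the algebra A generated by the Y_n is stable under the coproduct,
    and, by recursion on n, under the antipode (gen_pred_hopf_subalgebra). Moreover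
    Y_n <> 0 exactly when n lies in the index set (index_set_x, x_index_set).

    The pre-Lie algebra. The product f_i o f_j = f_(i+j) if m | j, and 0 otherwise, is
    associative: both ways of bracketing f_i, f_j, f_k give f_(i+j+k) when m divides j
    and k, and 0 otherwise (mulbA). It is therefore pre-Lie. Its enveloping algebra U
    is the quotient of the algebra of words in the index set by the two-sided ideal
    generated by the commutation relations (exists_enveloping).

    The duality. For i in the index set, choose in each nonzero Y_n one tree occurring
    in it; a derivation of the polynomial algebra of forests can be prescribed on trees,
    so there is a derivation D_i such that D_i Z_n = Z_(n-i) if i <= n and m | n - i,
    and D_i Z_n = 0 otherwise (lowering_Z). On A these derivations satisfy
      D_j D_i - D_i D_j = ([m | j] - [m | i]) D_(i+j)
    (lowering_commE), which is the bracket of f_i and f_j for operators composed from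
    left to right, and Delta D_i = (D_i (x) id) Delta (Delta_lowering). Hence U acts on
    A, and u |-> (a |-> counit (u . a)) turns the product of U into the convolution of
    functionals; as the generators act by derivations, it turns the coproduct of U into
    the transpose of the product of A (dual_hopf_iso).

    This map is bijective onto the graded dual because its pairing with the monomials
    Y_v = Y_v1 ... Y_vk is triangular: a word w pairs to 0 with Y_v if w is shorter than
    v, and if both have the same length, the pairing is nonzero exactly when w is a
    permutation of v (pairing_Yprod_small, pairing_Yprod_eq); characteristic zero
    enters through the multiplicities of the letters. Modulo the ideal every element of
    U is a combination of sorted words (ordered_all), so triangularity yields
    injectivity (pairingT_inj), and also surjectivity, because only finitely many sorted
    words have a sum below a given bound (pairingT_solve). *)

(** * Free modules and monoid algebras *)

(** Basis elements and linear extensions are locked, so that unification compares them by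
    their arguments and never by the finite maps underneath. *)
HB.lock Definition bas (K : fieldType) (M : choiceType) (k : M) : {malg K[M]} := << k >>.
Arguments bas {K M} k.

HB.lock Definition lext (K : fieldType) (M : choiceType) (V : lmodType K)
    (h : M -> V) (a : {malg K[M]}) : V :=
  \sum_(k <- msupp a) a@_k *: h k.

Section LinearExtension.

Variables (K : fieldType) (M : choiceType).

Lemma lextE (V : lmodType K) (h : M -> V) (a : {malg K[M]}) :
  lext h a = \sum_(k <- msupp a) a@_k *: h k.
Proof. by rewrite lext.unlock. Qed.

Lemma lextEw (V : lmodType K) (h : M -> V) (d : {fset M}) (a : {malg K[M]}) :
  (msupp a `<=` d)%fset -> lext h a = \sum_(k <- d) a@_k *: h k.
Proof.
move=> le; rewrite lextE [LHS](big_fset_incl _ le) // => k _ /mcoeff_outdom ->.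
by rewrite scale0r.
Qed.

Lemma lextU (V : lmodType K) (h : M -> V) c k : lext h << c *g k >> = c *: h k.
Proof. by rewrite (lextEw h msuppU_le) big_seq_fset1 mcoeffUU. Qed.

Lemma basE (k : M) : << k >> = bas k :> {malg K[M]}.
Proof. by rewrite bas.unlock. Qed.

Lemma lext1 (V : lmodType K) (h : M -> V) k : lext h (bas k) = h k.
Proof. by rewrite -basE lextU scale1r. Qed.

Fact lext_linear (V : lmodType K) (h : M -> V) : linear (lext h).
Proof.
move=> c a b; set d := (msupp a `|` msupp b)%fset.
have le : (msupp (c *: a + b) `<=` d)%fset.
  apply: fsubset_trans (msuppD_le _ _) _; apply: fsetSU; exact: msuppZ_le.
rewrite (lextEw h le) (lextEw h (fsubsetUl _ _ : (_ `<=` d)%fset)).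
rewrite (lextEw h (fsubsetUr _ _ : (_ `<=` d)%fset)) scaler_sumr -big_split /=.
by apply: eq_bigr => k _; rewrite mcoeffD mcoeffZ scalerDl scalerA.
Qed.

HB.instance Definition _ (V : lmodType K) (h : M -> V) :=
  GRing.isLinear.Build K {malg K[M]} V *:%R (lext h) (lext_linear h).

Lemma malgUZ (c : K) (k : M) : << c *g k >> = c *: (bas k) :> {malg K[M]}.
Proof. by rewrite -basE; apply/malgP => k'; rewrite mcoeffZ !mcoeffU mulrnAr mulr1. Qed.

Lemma malg_sumZ (a : {malg K[M]}) : a = \sum_(k <- msupp a) a@_k *: (bas k).
Proof. by rewrite {1}[a]monalgE; apply: eq_bigr => k _; rewrite malgUZ. Qed.

(** The induction principle behind most identities below: it reduces a linear statement
    to basis elements. *)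
Lemma malg_lin_ind (P : {malg K[M]} -> Prop) :
  P 0 -> (forall c k a, P a -> P (c *: (bas k) + a)) -> forall a, P a.
Proof.
move=> P0 PS a; rewrite [a]malg_sumZ.
elim/big_rec: _ => [|k x _ Px]; [exact: P0 | exact: PS].
Qed.

End LinearExtension.

Lemma malg_scaleAr (K : fieldType) (M : monomType) (c : K) (a b : {malg K[M]}) :
  c *: (a * b) = a * (c *: b).
Proof.
apply/malgP => k; rewrite mcoeffZ (mcoeffMlw k (fsubset_refl _) (msuppZ_le c b)).
rewrite mcoeffMl mulr_sumr; apply: eq_bigr => k1 _.
rewrite mulr_sumr; apply: eq_bigr => k2 _.
by rewrite mcoeffZ mulrnAr mulrCA.
Qed.

Lemma malgMU (K : fieldType) (M : monomType) (k k' : M) :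
  (bas k) * (bas k') = (bas (mmul k k')) :> {malg K[M]}.
Proof. by rewrite -!basE malgM_def fgmulUU mulr1. Qed.

Lemma lextM (K : fieldType) (M : monomType) (B : algType K) (h : M -> B) :
  mmorphism h -> {morph lext h : a b / a * b}.
Proof.
move=> [hM _] a b; elim/malg_lin_ind: a => [|c k a IHa].
  by rewrite linear0 !mul0r linear0.
rewrite mulrDl linearD /= IHa linearP /= mulrDl; congr (_ + _).
rewrite -!scalerAl linearZ /=; congr (_ *: _); rewrite lext1.
elim/malg_lin_ind: b {IHa} => [|d l b IHb]; first by rewrite linear0 !mulr0 linear0.
rewrite mulrDr linearD /= IHb linearP /= mulrDr; congr (_ + _).
rewrite -malg_scaleAr -scalerAr linearZ /=; congr (_ *: _).
by rewrite malgMU !lext1.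
Qed.

Lemma bas1 (K : fieldType) (M : monomType) : bas mone = 1 :> {malg K[M]}.
Proof. by rewrite -basE. Qed.

Lemma lextone (K : fieldType) (M : monomType) (B : algType K) (h : M -> B) :
  mmorphism h -> lext h 1 = 1.
Proof. by move=> [_ h1]; rewrite -bas1 lext1. Qed.

Section MultiplicativeExtension.

Variables (T : choiceType) (R : comNzRingType) (f : T -> R).

(** The extension of f to the monoid of forests, and with lext to their algebra. *)
Definition cmon (F : {cmonom T}) : R :=
  \prod_(t <- finsupp (cmonom_val F)) f t ^+ F t.

Lemma cmonEw (d : {fset T}) (F : {cmonom T}) :
  (finsupp F `<=` d)%fset -> cmon F = \prod_(t <- d) f t ^+ F t.
Proof.
move=> le; rewrite [LHS](big_fset_incl _ le) // => t _.
by rewrite -cmE_neq0 negbK => /eqP ->; rewrite expr0.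
Qed.

Lemma cmon_mmorphism : mmorphism cmon.
Proof.
split=> [F G|]; last by rewrite /cmon mdom1 big_seq_fset0.
rewrite {1}/cmon mdomD (cmonEw (fsubsetUl _ (finsupp G))).
rewrite (cmonEw (fsubsetUr (finsupp F) _)) -big_split /=.
by apply: eq_bigr => t _; rewrite cmM exprD.
Qed.

HB.instance Definition _ := isMultiplicative.Build _ _ cmon cmon_mmorphism.

Lemma cmonU t : cmon (ucm t) = f t.
Proof. by rewrite /cmon mdomU big_seq_fset1 cmUU expr1. Qed.

End MultiplicativeExtension.

Lemma lextP (K : fieldType) (M : choiceType) (V : lmodType K) (h : M -> V)
    c (a b : {malg K[M]}) : lext h (c *: a + b) = c *: lext h a + lext h b.
Proof. exact: lext_linear. Qed.

Lemma lext_sum (K : fieldType) (M : choiceType) (V : lmodType K) (h : M -> V)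
    (I : Type) (r : seq I) (P : pred I) (F : I -> {malg K[M]}) :
  lext h (\sum_(i <- r | P i) F i) = \sum_(i <- r | P i) lext h (F i).
Proof. exact: linear_sum. Qed.

Lemma lext0 (K : fieldType) (M : choiceType) (V : lmodType K) (h : M -> V) :
  lext h (0 : {malg K[M]}) = 0.
Proof. exact: linear0. Qed.

(** * Forests as lists of planar trees *)

Section ForestsOfTrees.

Variable D : choiceType.
Implicit Types (t u : ptree D) (s : seq (ptree D)) (F G : forest D).

(** A permutation of the image lists comes from one of the lists themselves; this turns
    equality of forests into a matching of branches. *)
Lemma perm_map_lift (S T : eqType) (f : S -> T) (s s' : seq S) :
  perm_eq (map f s) (map f s') ->
  exists2 s'', perm_eq s'' s' & map f s = map f s''.
Proof.
case: s' => [|x0 s'] /=; first by case: s => [|x s] => [_|/perm_size //]; exists [::].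
set r := x0 :: s' => /(perm_iotaP (f x0)) [js pjs sE].
exists (map (nth x0 r) js).
  apply/(perm_iotaP x0); exists js => //.
  by rewrite (perm_trans pjs) // -map_cons size_map.
rewrite sE -map_comp; apply/eq_in_map => j.
rewrite (perm_mem pjs) -map_cons size_map mem_iota add0n => ltj.
by rewrite (nth_map x0).
Qed.

Lemma tree_classE t u : tree_class t = tree_class u <-> piso t u.
Proof.
by rewrite /tree_class; split=> [/eqP|h]; [rewrite eqmodE|apply/eqP; rewrite eqmodE].
Qed.

Lemma repr_classK (T : tree D) : tree_class (repr T) = T.
Proof. exact: reprK. Qed.

Lemma all2_piso s s' : all2 (@piso D) s s' = (map (@tree_class D) s == map (@tree_class D) s').
Proof.
elim: s s' => [|t s IH] [|t' s'] //=; rewrite eqseq_cons -IH; congr (_ && _).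
by apply/idP/eqP => /tree_classE.
Qed.

Lemma forest_of_nil : forest_of [::] = mone :> forest D.
Proof. by rewrite /forest_of big_nil. Qed.

Lemma forest_of_cons t s :
  forest_of (t :: s) = mmul (ucm (tree_class t)) (forest_of s).
Proof. by rewrite /forest_of big_cons. Qed.

Lemma forest_of_cat s s' : forest_of (s ++ s') = mmul (forest_of s) (forest_of s').
Proof. by rewrite /forest_of big_cat. Qed.

Lemma forest_of1 t : forest_of [:: t] = ucm (tree_class t).
Proof. by rewrite forest_of_cons forest_of_nil mulm1. Qed.

Lemma forest_of_count s T : forest_of s T = count_mem T (map (@tree_class D) s).
Proof.
elim: s => [|t s IH]; first by rewrite forest_of_nil cm1.
by rewrite forest_of_cons cmM cmU IH.
Qed.

Lemma forest_of_eq s s' :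
  forest_of s = forest_of s' <->
  perm_eq (map (@tree_class D) s) (map (@tree_class D) s').
Proof.
split=> [ss'|/permP ss']; last first.
  by apply/eqP/cmP => T; rewrite !forest_of_count ss'.
by apply/allP => T _ /=; rewrite -!forest_of_count ss'.
Qed.

(** The recursive description of trees up to isomorphism: a planar tree is determined, up
    to isomorphism, by the decoration of its root and the forest of its branches. It makes
    B_j well defined and injective. *)
Lemma tree_class_node d d' s s' :
  tree_class (PNode d s) = tree_class (PNode d' s') <->
  d = d' /\ forest_of s = forest_of s'.
Proof.
rewrite tree_classE; split.
  case/pisoP => -> [s'' ps'']; rewrite all2_piso => /eqP ss''; split=> //.
  by apply/forest_of_eq; rewrite ss'' perm_map.
case=> -> /forest_of_eq /perm_map_lift [s'' ps'' ss''].
by apply/pisoP; split=> //; exists s''; rewrite // all2_piso ss''.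
Qed.

Lemma cmon_forest_of (R : comNzRingType) (f : tree D -> R) s :
  cmon f (forest_of s) = \prod_(t <- s) f (tree_class t).
Proof.
have [fM f1] := cmon_mmorphism f.
elim: s => [|t s IH]; first by rewrite forest_of_nil big_nil f1.
by rewrite forest_of_cons big_cons fM cmonU IH.
Qed.

Lemma branchesK F : forest_of (branches F) = F.
Proof.
apply/eqP/cmP => T; rewrite forest_of_count /branches map_flatten.
rewrite count_flatten -!map_comp.
transitivity (\sum_(u <- finsupp (cmonom_val F)) (u == T) * F u)%N.
  rewrite sumnE big_map; apply: eq_bigr => u _ /=.
  by rewrite map_nseq count_nseq /= repr_classK.
have [Ts|Ts] := boolP (T \in finsupp (cmonom_val F)).
  rewrite (big_fsetD1 T) //= eqxx mul1n big1_fset ?addn0 // => u.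
  by rewrite in_fsetD1 => /andP[/negPf-> _].
rewrite big1_fset; first by move: Ts; rewrite -cmE_neq0 negbK => /eqP.
by move=> u us _; case: eqP us Ts => // -> ->.
Qed.

Lemma graft_forest_of d s : graft d (forest_of s) = tree_class (PNode d s).
Proof. by apply/tree_class_node; rewrite branchesK. Qed.

Lemma graft_inj d d' F F' : graft d F = graft d' F' -> d = d' /\ F = F'.
Proof. by rewrite /graft => /tree_class_node; rewrite !branchesK. Qed.

Lemma ucm_inj (T : choiceType) : injective (@ucm T).
Proof.
move=> a b ab; have := cmUU a; rewrite ab cmU.
by case: eqP.
Qed.

Lemma ucm_neq1 (T : choiceType) (t : T) : ucm t <> mone.
Proof. by move/eqP; rewrite cm1_eq1. Qed.

Lemma graftF_inj d d' F F' : graftF d F = graftF d' F' -> d = d' /\ F = F'.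
Proof. by move=> /ucm_inj /graft_inj. Qed.

Variable wt : D -> nat.

Lemma ptree_deg_piso t u : piso t u -> ptree_deg wt t = ptree_deg wt u.
Proof.
elim/ptree_rect_seq: t u => d s IH [d' s'] /pisoP[<- [s'' ps'' ss'']] /=.
congr (_ + _)%N; transitivity (sumn (map (ptree_deg wt) s'')).
  elim: s s'' IH ss'' {ps''} => [|t s IHs] [|t' s''] //= [IHt IH].
  by case/andP => /IHt-> /IHs->.
by apply: perm_sumn; rewrite perm_map.
Qed.

Definition tdeg (T : tree D) : nat := ptree_deg wt (repr T).

Lemma tdeg_class t : tdeg (tree_class t) = ptree_deg wt t.
Proof. by apply: ptree_deg_piso; apply/tree_classE; rewrite repr_classK. Qed.

Lemma deg_forest_of s : deg wt (forest_of s) = sumn (map (ptree_deg wt) s).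
Proof.
have E r : map (ptree_deg wt) r = map tdeg (map (@tree_class D) r).
  by rewrite -map_comp; apply: eq_map => t /=; rewrite tdeg_class.
rewrite /deg !E; apply: perm_sumn; apply: perm_map.
by apply/forest_of_eq; rewrite branchesK.
Qed.

Lemma degM F G : deg wt (mmul F G) = (deg wt F + deg wt G)%N.
Proof.
rewrite -(branchesK F) -(branchesK G) -forest_of_cat !deg_forest_of.
by rewrite map_cat sumn_cat.
Qed.

Lemma deg1 : deg wt mone = 0%N.
Proof. by rewrite -forest_of_nil deg_forest_of. Qed.

Lemma deg_graftF d F : deg wt (graftF d F) = (wt d + deg wt F)%N.
Proof.
rewrite -(branchesK F) /graftF graft_forest_of -forest_of1 !deg_forest_of /=.
by rewrite addn0.
Qed.

Lemma deg_ucm T : deg wt (ucm T) = tdeg T.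
Proof. by rewrite -(repr_classK T) -forest_of1 deg_forest_of /= addn0 tdeg_class. Qed.

End ForestsOfTrees.

(** * The coproduct of planar forests and its coassociativity *)

Section Sublists.

Fixpoint sublists (A : Type) (l : seq A) : seq (seq A) :=
  if l is x :: l' then map (cons x) (sublists l') ++ sublists l' else [:: [::]].

Fixpoint masks (n : nat) : seq bitseq :=
  if n is n'.+1 then map (cons true) (masks n') ++ map (cons false) (masks n')
  else [:: [::]].

Lemma sublistsE (A : Type) (l : seq A) :
  sublists l = [seq mask b l | b <- masks (size l)].
Proof.
elim: l => //= x l IH; rewrite map_cat -!map_comp IH -map_comp.
by congr (_ ++ _); apply: eq_map.
Qed.

Lemma mem_masks n b : (b \in masks n) = (size b == n).
Proof.
elim: n b => [|n IH] [|[] b] //=; rewrite mem_cat.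
- by apply/negP => /orP[] /mapP[].
- rewrite eqSS -IH; apply/orP/idP => [[] /mapP[c cn] // [->//]|bn].
  by left; apply/mapP; exists b.
rewrite eqSS -IH; apply/orP/idP => [[] /mapP[c cn] // [->//]|bn].
by right; apply/mapP; exists b.
Qed.

Lemma masks_uniq n : uniq (masks n).
Proof.
elim: n => //= n IH; rewrite cat_uniq !map_inj_uniq ?IH ?andbT //=;
  try by move=> ? ? [].
by apply/hasP => -[b /mapP[c _ ->]] /mapP[d _].
Qed.

(** A cut is given in the definition of the coproduct by a mask; lists of edges are better
    suited to recursion on trees. *)
Lemma sum_masks (V : nmodType) (A : Type) (l : seq A) (P : pred (seq A))
    (F : seq A -> V) :
  \sum_(b : (size l).-tuple bool | P (mask b l)) F (mask b l)
    = \sum_(c <- sublists l | P c) F c.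
Proof.
rewrite sublistsE big_map -(big_map val (fun b => P (mask b l)) (fun b => F (mask b l))).
apply: perm_big; apply: uniq_perm.
- by rewrite map_inj_uniq ?index_enum_uniq //; apply: val_inj.
- exact: masks_uniq.
move=> b; rewrite mem_masks; apply/mapP/eqP => [[t _ ->]|sb]; first exact: size_tuple.
by exists (Tuple (introT eqP sb)); rewrite ?mem_index_enum.
Qed.

Lemma sum_sublists_cat (V : nmodType) (A : Type) (l l' : seq A) (F : seq A -> V) :
  \sum_(c <- sublists (l ++ l')) F c
    = \sum_(c <- sublists l) \sum_(c' <- sublists l') F (c ++ c').
Proof.
elim: l F => [|x l IH] F /=; first by rewrite big_seq1.
by rewrite !big_cat !big_map IH IH.
Qed.

Lemma sublists_map (A B : Type) (g : A -> B) (l : seq A) :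
  sublists (map g l) = map (map g) (sublists l).
Proof. by elim: l => //= x l ->; rewrite map_cat -!map_comp. Qed.

Lemma sublists_subset (A : eqType) (l c : seq A) : c \in sublists l -> {subset c <= l}.
Proof. by rewrite sublistsE => /mapP[b _ ->] x; apply: mem_mask. Qed.

(** Exactly one of the sublists is empty. *)
Lemma sum_sublists_nil (V : nmodType) (A : eqType) (l : seq A) (F : seq A -> V) :
  \sum_(c <- sublists l) (if c == [::] then F c else 0) = F [::].
Proof.
elim: l => [|x l IH] /=; first by rewrite big_seq1.
by rewrite big_cat big_map IH big1 /= ?add0r.
Qed.

End Sublists.

Section PlanarCoproduct.

Variable D : choiceType.
Implicit Types (t : ptree D) (s : seq (ptree D)) (c : seq (seq nat)).

(** The product of a list of formal sums of pairs of forests, each sum being given by the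
    list of its terms. *)
Definition pair_prod (l : seq (seq (seq (ptree D) * seq (ptree D)))) :=
  foldr (fun a b => [seq (p.1 ++ q.1, p.2 ++ q.2) | p <- a, q <- b])
        [:: ([::], [::])] l.

(** The terms of the coproduct of a planar tree, pruned part first, obtained by recursion on
    the tree: either everything is pruned, or the root remains with what is left of each of
    its branches. The empty cut gives the term in which each branch is left untouched. *)
Fixpoint cop t : seq (seq (ptree D) * seq (ptree D)) :=
  let: PNode d s := t in
  ([:: t], [::]) :: [seq (q.1, [:: PNode d q.2]) | q <- pair_prod (map cop s)].

Definition copF s := pair_prod (map cop s).

Lemma copE d s :
  cop (PNode d s)
    = ([:: PNode d s], [::]) :: [seq (q.1, [:: PNode d q.2]) | q <- copF s].
Proof. by []. Qed.

Variable V : nmodType.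
Implicit Type phi : seq (ptree D) -> seq (ptree D) -> V.

Lemma sum_copF_cons t s phi :
  \sum_(q <- copF (t :: s)) phi q.1 q.2
    = \sum_(p <- cop t) \sum_(q <- copF s) phi (p.1 ++ q.1) (p.2 ++ q.2).
Proof. by rewrite /copF /= big_allpairs_dep. Qed.

Lemma sum_cop d s phi :
  \sum_(q <- cop (PNode d s)) phi q.1 q.2
    = phi [:: PNode d s] [::] + \sum_(q <- copF s) phi q.1 [:: PNode d q.2].
Proof. by rewrite copE big_cons big_map. Qed.

Lemma sum_copF1 t phi :
  \sum_(q <- copF [:: t]) phi q.1 q.2 = \sum_(q <- cop t) phi q.1 q.2.
Proof.
rewrite sum_copF_cons; apply: eq_bigr => p _.
by rewrite big_seq1 /= !cats0.
Qed.

Lemma sum_copF_cat s s' phi :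
  \sum_(q <- copF (s ++ s')) phi q.1 q.2
    = \sum_(p <- copF s) \sum_(q <- copF s') phi (p.1 ++ q.1) (p.2 ++ q.2).
Proof.
elim: s phi => [|t s IH] phi; first by rewrite big_seq1.
rewrite cat_cons sum_copF_cons; under eq_bigr => p _.
  rewrite (IH (fun a b => phi (p.1 ++ a) (p.2 ++ b))); over.
rewrite (sum_copF_cons t s (fun a b => \sum_(q <- copF s') phi (a ++ q.1) (b ++ q.2))).
apply: eq_bigr => p _; apply: eq_bigr => q _; apply: eq_bigr => r _.
by rewrite !catA.
Qed.

(** The counit axiom: exactly one term has an empty pruned part. *)
Lemma sum_copF_counit s (psi : seq (ptree D) -> V) :
  \sum_(q <- copF s) (if q.1 == [::] then psi q.2 else 0) = psi s.
Proof.
have cop_ct t (psi' : seq (ptree D) -> V) :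
    (forall d s, t = PNode d s -> forall psi'' : seq (ptree D) -> V,
      \sum_(q <- copF s) (if q.1 == [::] then psi'' q.2 else 0) = psi'' s) ->
    \sum_(q <- cop t) (if q.1 == [::] then psi' q.2 else 0) = psi' [:: t].
  case: t => d r IH.
  rewrite (sum_cop d r (fun a b => if a == [::] then psi' b else 0)) add0r.
  exact: (IH d r erefl (fun b => psi' [:: PNode d b])).
have step t r : (forall psi', \sum_(q <- cop t)
      (if q.1 == [::] then psi' q.2 else 0) = psi' [:: t] :> V) ->
    (forall psi', \sum_(q <- copF r)
      (if q.1 == [::] then psi' q.2 else 0) = psi' r :> V) ->
    forall psi', \sum_(q <- copF (t :: r))
      (if q.1 == [::] then psi' q.2 else 0) = psi' (t :: r) :> V.
  move=> IHt IHr psi'.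
  rewrite (sum_copF_cons t r (fun a b => if a == [::] then psi' b else 0)).
  rewrite -[RHS](IHt (fun b => psi' (b ++ r))); apply: eq_bigr => -[a b] _ /=.
  case: a => [|u a] /=; last by rewrite big1.
  exact: (IHr (fun b' => psi' (b ++ b'))).
have all_t t : forall psi', \sum_(q <- cop t)
      (if q.1 == [::] then psi' q.2 else 0) = psi' [:: t] :> V.
  elim/ptree_rect_seq: t => d r IH psi'; apply: cop_ct => _ _ [_ <-].
  elim: r IH => [_ psi''|t r IHr /= [IHt /IHr IH]]; first by rewrite big_seq1.
  exact: step.
elim: s psi => [|t s IH] psi; first by rewrite big_seq1.
exact: step.
Qed.

End PlanarCoproduct.

Section Coassociativity.

Variables (D : choiceType) (V : nmodType).
Implicit Types (t : ptree D) (s : seq (ptree D)).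
Implicit Type phi : seq (ptree D) -> seq (ptree D) -> seq (ptree D) -> V.

(** Coassociativity is expressed by summing an arbitrary function phi over the triples of
    forests obtained by cutting twice, which avoids a triple tensor product. *)
Let coassF s := forall phi,
  \sum_(q <- copF s) \sum_(p <- copF q.1) phi p.1 p.2 q.2
    = \sum_(q <- copF s) \sum_(p <- copF q.2) phi q.1 p.1 p.2.

Let coass t := forall phi,
  \sum_(q <- cop t) \sum_(p <- copF q.1) phi p.1 p.2 q.2
    = \sum_(q <- cop t) \sum_(p <- copF q.2) phi q.1 p.1 p.2.

Let coassF_cons t s : coass t -> coassF s -> coassF (t :: s).
Proof.
move=> IHt IHs phi.
rewrite (sum_copF_cons t s (fun a b => \sum_(p <- copF a) phi p.1 p.2 b)).
rewrite (sum_copF_cons t s (fun a b => \sum_(p <- copF b) phi a p.1 p.2)) /=.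
under eq_bigr => p _ do under eq_bigr => q _ do
  rewrite (sum_copF_cat p.1 q.1 (fun a b => phi a b (p.2 ++ q.2))).
under [RHS]eq_bigr => p _ do under eq_bigr => q _ do
  rewrite (sum_copF_cat p.2 q.2 (fun a b => phi (p.1 ++ q.1) a b)).
under eq_bigr => p _ do rewrite exchange_big /=.
under [RHS]eq_bigr => p _ do rewrite exchange_big /=.
rewrite (IHt (fun a b c => \sum_(q <- copF s) \sum_(r <- copF q.1)
   phi (a ++ r.1) (b ++ r.2) (c ++ q.2))).
apply: eq_bigr => p _; apply: eq_bigr => q _.
exact: (IHs (fun a b c => phi (p.1 ++ a) (q.1 ++ b) (q.2 ++ c))).
Qed.

(** Besides the total cut, the two sides agree by coassociativity for the forest of
    branches, the root staying in the third component. *)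
Let coass_node d s : coassF s -> coass (PNode d s).
Proof.
move=> IH phi.
rewrite (sum_cop d s (fun a b => \sum_(p <- copF a) phi p.1 p.2 b)).
rewrite (sum_cop d s (fun a b => \sum_(p <- copF b) phi a p.1 p.2)) /=.
rewrite (sum_copF1 _ (fun a b => phi a b [::])).
rewrite (sum_cop d s (fun a b => phi a b [::])) big_seq1 -addrA; congr (_ + _).
under [RHS]eq_bigr => q _ do
  rewrite (sum_copF1 _ (fun a b => phi q.1 a b))
          (sum_cop d q.2 (fun a b => phi q.1 a b)).
rewrite big_split /=; congr (_ + _).
exact: (IH (fun a b c => phi a b [:: PNode d c])).
Qed.

Lemma cop_coassoc s : coassF s.
Proof.
have all_t t : coass t.
  elim/ptree_rect_seq: t => d r IH; apply: coass_node.
  elim: r IH => [_ phi|t r IHr /= [IHt /IHr IH]]; last exact: coassF_cons.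
  by rewrite !big_seq1.
elim: s => [phi|t s IH]; last exact: coassF_cons.
by rewrite !big_seq1.
Qed.

End Coassociativity.

(** * Admissible cuts and the planar coproduct *)

Section CutsOfBranches.

Variable D : choiceType.
Implicit Types (t : ptree D) (s : seq (ptree D)) (c : seq (seq nat)).

(** Admissibility, except that the empty cut is accepted: this is the form compatible with
    the decomposition of a tree into its branches. *)
Definition wadmissible t c : bool :=
  all (fun l => count (fun e => prefix e l) c <= 1)%N (leaves t).

(** The notions for forests number the trees from k on; removing the first tree replaces k
    by k + 1. *)
Definition edgesF k s : seq (seq nat) :=
  flatten [seq [:: q.1] :: map (cons q.1) q.2
          | q <- zip (iota k (size s)) (map (@edges D) s)].

Definition leavesF k s : seq (seq nat) :=
  flatten [seq map (cons q.1) q.2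
          | q <- zip (iota k (size s)) (map (@leaves D) s)].

Definition wadmissibleF k s c : bool :=
  all (fun l => count (fun e => prefix e l) c <= 1)%N (leavesF k s).

Definition componentsF k s c : seq (ptree D) * seq (ptree D) :=
  let qs := [seq (q.1, q.2 (cut_in q.1 c))
            | q <- zip (iota k (size s)) (map (@components D) s)] in
  ([seq q.2.1 | q <- qs & [:: q.1] \notin c],
   flatten [seq if [:: q.1] \in c then q.2.1 :: q.2.2 else q.2.2 | q <- qs]).

Lemma components_node d s c :
  components (PNode d s) c
    = (PNode d (componentsF 0 s c).1, (componentsF 0 s c).2).
Proof. by []. Qed.

Lemma edgesF_cons k t s :
  edgesF k (t :: s) = ([:: k] :: map (cons k) (edges t)) ++ edgesF k.+1 s.
Proof. by []. Qed.

Lemma leavesF_cons k t s :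
  leavesF k (t :: s) = map (cons k) (leaves t) ++ leavesF k.+1 s.
Proof. by []. Qed.

Lemma componentsF_cons k t s c :
  let r := components t (cut_in k c) in
  componentsF k (t :: s) c =
    ((if [:: k] \in c then [::] else [:: r.1]) ++ (componentsF k.+1 s c).1,
     (if [:: k] \in c then r.1 :: r.2 else r.2) ++ (componentsF k.+1 s c).2).
Proof.
rewrite /componentsF /=; case: ([:: k] \in c) => /=; reflexivity.
Qed.

Lemma edges_size t e : e \in edges t -> (0 < size e)%N.
Proof.
case: t => d s /= /flattenP[r /mapP[q _ ->]].
by rewrite inE => /orP[/eqP->|/mapP[e' _ ->]].
Qed.

Lemma edgesF_head k s e : e \in edgesF k s -> (0 < size e)%N /\ (k <= head 0 e)%N.
Proof.
elim: s k => [|t s IH] k //.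
rewrite edgesF_cons mem_cat inE => /orP[/orP[/eqP->|/mapP[e' _ ->]]|/IH[? ?]] //.
by split=> //; apply: ltnW.
Qed.

Lemma components0 t : components t [::] = (t, [::]).
Proof.
elim/ptree_rect_seq: t => d s IH; rewrite components_node.
suff -> : forall k, componentsF k s [::] = (s, [::]) by [].
elim: s IH => [_ k|t s IHs /= [IHt /IHs IH] k] //.
by rewrite componentsF_cons (_ : cut_in k [::] = [::]) // IHt IH.
Qed.

(** Each edge lies on the path to some leaf, so an admissible cut containing it contains no
    edge closer to the root on this path. *)
Lemma prefix_leaf t e : e \in edges t -> exists2 l, l \in leaves t & prefix e l.
Proof.
have ex_leaf (u : ptree D) : exists l, l \in leaves u.
  elim/ptree_rect_seq: u => d [|u s] /= IH; first by exists [::].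
  have [[l lu] _] := IH; exists (0 :: l).
  by rewrite mem_cat map_f.
elim/ptree_rect_seq: t e => d s IH e et.
have {et} : e \in edgesF 0 s by [].
suff H k : e \in edgesF k s -> exists2 l, l \in leavesF k s & prefix e l.
  by move=> /H; case: s {IH H} => [[l]|].
elim: s k IH => [|t s IHs] k // [IHt /IHs IH].
rewrite edgesF_cons mem_cat inE => /orP[/orP[/eqP->|/mapP[e' e't ->]]|/IH[l ls el]].
- have [l lt] := ex_leaf t; exists (k :: l); last by rewrite /= eqxx prefix0s.
  by rewrite leavesF_cons mem_cat map_f.
- have [l lt el] := IHt _ e't; exists (k :: l); last by rewrite /= eqxx.
  by rewrite leavesF_cons mem_cat map_f.
by exists l; rewrite // leavesF_cons mem_cat ls orbT.
Qed.

Lemma cut_in_cat i c c' : cut_in i (c ++ c') = cut_in i c ++ cut_in i c'.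
Proof. by rewrite /cut_in filter_cat map_cat. Qed.

Lemma cut_in_nil i c : (forall e, e \in c -> head 0%N e != i) -> cut_in i c = [::].
Proof.
move=> ci; rewrite /cut_in (eq_in_filter (a2 := pred0)) ?filter_pred0 // => e /ci.
by move=> /negPf->; rewrite andbF.
Qed.

Lemma cut_in_block k c : all (fun e => 0 < size e)%N c -> cut_in k (map (cons k) c) = c.
Proof.
elim: c => //= e c IH /andP[e0 /IH {2}<-].
by rewrite /cut_in /= ltnS e0 eqxx.
Qed.

(** Edges numbered below k lie in none of the trees at hand. *)
Lemma componentsF_skip k s c c' :
  (forall e, e \in c -> (0 < size e)%N /\ (head 0 e < k)%N) ->
  componentsF k s (c ++ c') = componentsF k s c'.
Proof.
elim: s k => [|t s IH] k ck //; rewrite !componentsF_cons IH; last first.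
  by move=> e /ck[? ?]; split=> //; apply: leqW.
rewrite cut_in_cat cut_in_nil /=; last by move=> e /ck[_ /ltn_eqF->].
rewrite mem_cat (_ : [:: k] \in c = false) //.
by apply/negP => /ck[_]; rewrite ltnn.
Qed.

Lemma leavesF_head k s l : l \in leavesF k s -> (0 < size l)%N /\ (k <= head 0 l)%N.
Proof.
elim: s k => [|t s IH] k //.
rewrite leavesF_cons mem_cat => /orP[/mapP[e' _ ->]|/IH[? ?]] //.
by split=> //; apply: ltnW.
Qed.

Lemma prefix_head (e l : seq nat) : (0 < size e)%N -> prefix e l -> head 0%N e = head 0%N l.
Proof. by case: e l => [|x e] [|y l] //= _ /andP[/eqP]. Qed.

Lemma wadmissibleF_skip k s c c' :
  (forall e, e \in c -> (0 < size e)%N /\ (head 0 e < k)%N) ->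
  wadmissibleF k s (c ++ c') = wadmissibleF k s c'.
Proof.
move=> ck; apply: eq_in_all => l /leavesF_head[_ kl].
rewrite count_cat (eq_in_count (a2 := pred0)) ?count_pred0 // => e /ck[e0 ek].
apply/negP => /(prefix_head e0) el.
by move: ek; rewrite el ltnNge kl.
Qed.

Lemma wadmissibleF_cons k t s c c' :
  (forall e, e \in c' -> (0 < size e)%N /\ (k < head 0 e)%N) ->
  (forall e, e \in c -> (0 < size e)%N /\ head 0%N e = k) ->
  wadmissibleF k (t :: s) (c ++ c')
   = all (fun l => count (fun e => prefix e (k :: l)) c <= 1)%N (leaves t)
     && wadmissibleF k.+1 s c'.
Proof.
move=> c'k ck; rewrite -(@wadmissibleF_skip k.+1 s c c'); last first.
  by move=> e /ck[e0 ->].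
rewrite {1}/wadmissibleF leavesF_cons all_cat all_map; congr (_ && _).
apply: eq_all => l /=; rewrite count_cat [X in (_ + X)%N](eq_in_count (a2 := pred0)).
  by rewrite count_pred0 addn0.
move=> e /c'k[e0 ek]; apply: negbTE; apply/negP => pe.
have /= el := @prefix_head e (k :: l) e0 pe.
by rewrite el ltnn in ek.
Qed.

Lemma count_block k l c :
  count (fun e => prefix e (k :: l)) (map (cons k) c) = count (fun e => prefix e l) c.
Proof. by rewrite count_map; apply: eq_count => e /=; rewrite eqxx. Qed.

(** An admissible cut through the edge above the root of a branch contains no edge of this
    branch. *)
Lemma wadmissible_root k t c : c \in sublists (edges t) ->
  all (fun l => count (fun e => prefix e (k :: l)) ([:: k] :: map (cons k) c) <= 1)%N
      (leaves t) = (c == [::]).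
Proof.
move=> ct; have sub := sublists_subset ct; apply/idP/eqP => [|-> /=]; last first.
  by apply/allP => l _; rewrite eqxx prefix0s.
case: c sub {ct} => // e c sub /allP al.
have [l lt el] := prefix_leaf (sub e (mem_head _ _)).
have := al l lt; rewrite -[X in count _ X]cat1s count_cat count_block.
by rewrite /= eqxx prefix0s el.
Qed.

Variable V : nmodType.
Implicit Type phi : seq (ptree D) -> seq (ptree D) -> V.

Let cutsF s := forall k phi,
  \sum_(c <- sublists (edgesF k s))
     (if wadmissibleF k s c then phi (componentsF k s c).2 (componentsF k s c).1
      else 0)
    = \sum_(q <- copF s) phi q.1 q.2.

Let cuts t := forall phi,
  \sum_(c <- sublists (edges t))
     (if wadmissible t c then phi (components t c).2 [:: (components t c).1] else 0)
    = \sum_(q <- behead (cop t)) phi q.1 q.2.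

(** The two admissibility conditions differ only when the root is a leaf; there are then
    no edges. *)
Let cuts_node d s : cutsF s -> cuts (PNode d s).
Proof.
move=> /(_ 0%N) cF phi; rewrite copE /= big_map /=.
rewrite -(cF (fun a b => phi a [:: PNode d b])) -/(edgesF 0 s).
rewrite big_seq_cond [RHS]big_seq_cond.
apply: eq_bigr => c /andP[cs _].
suff -> : wadmissible (PNode d s) c = wadmissibleF 0 s c by [].
case: s cs {cF} => // /[!inE] /eqP-> //.
Qed.

#[local] Opaque componentsF wadmissibleF.

(** The cuts of a forest t :: s either contain the edge above t, and no other edge of t, or
    consist of a cut of t and one of s. The first possibility is the head of cop t, the
    second one its tail. *)
Let cutsF_cons t s : cuts t -> cutsF s -> cutsF (t :: s).
Proof.
move=> ct cs k phi; rewrite edgesF_cons sum_sublists_cat /= big_cat !big_map /=.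
rewrite sublists_map !big_map /= sum_copF_cons.
have -> : cop t = ([:: t], [::]) :: behead (cop t) by case: (t).
rewrite big_cons; congr (_ + _).
- rewrite -(cs k.+1 (fun a b => phi (t :: a) b)).
  transitivity (\sum_(c <- sublists (edges t)) if c == [::] then
     \sum_(c' <- sublists (edgesF k.+1 s)) if wadmissibleF k.+1 s c' then
       phi (t :: (componentsF k.+1 s c').2) (componentsF k.+1 s c').1 else 0
     else 0); last exact: sum_sublists_nil.
  rewrite big_seq [RHS]big_seq; apply: eq_bigr => c ctin.
  have cpos e : e \in [:: k] :: map (cons k) c -> (0 < size e)%N /\ head 0%N e = k.
    by rewrite inE => /orP[/eqP->|/mapP[e' _ ->]].
  transitivity (\sum_(c' <- sublists (edgesF k.+1 s))
     if (c == [::]) && wadmissibleF k.+1 s c' then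
       phi (t :: (componentsF k.+1 s c').2) (componentsF k.+1 s c').1 else 0).
    rewrite big_seq [RHS]big_seq; apply: eq_bigr => c' c's.
    have c'pos e : e \in c' -> (0 < size e)%N /\ (k < head 0 e)%N.
      by move=> /(sublists_subset c's) /edgesF_head.
    rewrite -!cat_cons wadmissibleF_cons // wadmissible_root //.
    case: eqP => //= ->; case: ifP => // _.
    rewrite (_ : [:: k] :: _ ++ c' = [:: [:: k]] ++ c') // componentsF_cons mem_head.
    rewrite componentsF_skip; last by move=> e /[!inE] /eqP->.
    rewrite cut_in_cat [cut_in k c']cut_in_nil ?cats0; last first.
      by move=> e /c'pos[_ /gtn_eqF->].
    rewrite (_ : cut_in k [:: [:: k]] = [::]); last by rewrite /cut_in /= .
    by rewrite components0.
  by case: eqP => //= _; rewrite big1.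
rewrite -(ct (fun a b => \sum_(q <- copF s) phi (a ++ q.1) (b ++ q.2))).
rewrite big_seq [RHS]big_seq; apply: eq_bigr => c ctin.
transitivity (\sum_(c' <- sublists (edgesF k.+1 s))
   if wadmissible t c then if wadmissibleF k.+1 s c' then
     phi ((components t c).2 ++ (componentsF k.+1 s c').2)
         ((components t c).1 :: (componentsF k.+1 s c').1) else 0 else 0).
  rewrite big_seq [RHS]big_seq; apply: eq_bigr => c' c's.
  have c'pos e : e \in c' -> (0 < size e)%N /\ (k < head 0 e)%N.
    by move=> /(sublists_subset c's) /edgesF_head.
  have cpos e : e \in map (cons k) c -> (0 < size e)%N /\ head 0%N e = k.
    by case/mapP => e' _ ->.
  have kF : [:: k] \in map (cons k) c ++ c' = false.
    rewrite mem_cat; apply/negP => /orP[/mapP[e ec [e0]]|/c'pos[_]]; last by rewrite ltnn.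
    by have := edges_size (sublists_subset ctin ec); rewrite -e0.
  rewrite wadmissibleF_cons //.
  rewrite (_ : all _ (leaves t) = wadmissible t c); last first.
    by apply: eq_all => l; rewrite count_block.
  case: (wadmissible t c); rewrite ?andTb ?andFb //.
  case: ifP => // _.
  rewrite componentsF_cons kF /= componentsF_skip; last first.
    by move=> e /cpos[? ->].
  rewrite cut_in_cat [cut_in k c']cut_in_nil ?cats0; last first.
    by move=> e /c'pos[_ /gtn_eqF->].
  rewrite cut_in_block //; apply/allP => e /(sublists_subset ctin).
  exact: edges_size.
case: ifP => _; last by rewrite big1.
exact: (cs k.+1 (fun a b => phi ((components t c).2 ++ a) ((components t c).1 :: b))).
Qed.

(** The head of cop t is the total cut, which the sum over sets of edges does not produce:
    the definition of the coproduct adds it separately. *)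
Lemma sum_cuts t : cuts t.
Proof.
elim/ptree_rect_seq: t => d s IH; apply: cuts_node.
elim: s IH => [_ k phi|t s IHs [IHt /IHs IH]]; last exact: cutsF_cons.
by rewrite !big_seq1.
Qed.

End CutsOfBranches.

Section PlanarComul.

Variables (K : fieldType) (D : choiceType).
Local Notation H := (HCK K D).
Local Notation HH := (HCK2 K D).

(** The basis element of the tensor square given by two planar forests. *)
Definition fpair (q : seq (ptree D) * seq (ptree D)) : HH :=
  bas (forest_of q.1, forest_of q.2).

Lemma comul_tree_cop (T : tree D) :
  comul_tree K T = \sum_(q <- cop (repr T)) fpair q.
Proof.
rewrite /comul_tree; set p := repr T.
have Tp : tree_class p = T by exact: repr_classK.
have copp : cop p = ([:: p], [::]) :: behead (cop p) by case: (p).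
have addE (V : nmodType) (a b c X Y : V) : c = a -> b + X = Y -> a + b + X = c + Y.
  by move=> -> <-; rewrite addrA.
rewrite copp; apply: etrans (esym (big_cons _ _ _ _ _ _)); apply: addE.
  by rewrite basE /fpair /= forest_of1 Tp forest_of_nil.
pose phi a b := fpair (a, b).
transitivity (\sum_(q <- behead (cop p)) phi q.1 q.2); last first.
  by apply: eq_bigr => -[].
rewrite -(sum_cuts p phi) -big_mkcond.
rewrite -(sum_masks _ _ (fun c => phi (components p c).2 [:: (components p c).1])).
(* The empty cut, which is not admissible, accounts for the term 1 (x) T. *)
pose b0 : (size (edges p)).-tuple bool := nseq_tuple _ false.
have mb0 : mask b0 (edges p) = [::] by exact: mask_false.
apply: etrans (esym (bigD1 b0 _)) => /=; last first.
  by rewrite mb0; apply/allP.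
rewrite mb0 components0 /phi /fpair /= forest_of_nil forest_of1 Tp.
rewrite basE; apply: congr1; apply: eq_big => [b|b _]; last first.
  by case: (components _ _) => R P; rewrite basE forest_of1.
rewrite [RHS]andbC; congr (~~ _ && _).
apply/eqP/eqP => [mb|->]; last exact: mb0.
apply: val_inj => /=; have sb := size_tuple b.
rewrite -[in RHS]sb; apply/all_pred1P.
rewrite (_ : all _ _ = ~~ has id b); last by rewrite -all_predC; apply: eq_all; case.
by rewrite has_count -(size_mask sb) mb.
Qed.

End PlanarComul.

(** * The tensor square and the coproduct *)

Section TensorProduct.

Variables (K : fieldType) (D : choiceType).
Local Notation H := (HCK K D).
Local Notation HH := (HCK2 K D).
Implicit Types a b c : H.

Lemma mmul_pair (F F' G G' : forest D) :
  mmul (F, G) (F', G') = (mmul F F', mmul G G').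
Proof. by []. Qed.

(** The algebra morphisms a |-> a (x) 1 and b |-> 1 (x) b; the tensor product of a and b is
    the product of their images. *)
Definition tensl : H -> HH := lext (fun F => (bas (F, mone))).
Definition tensr : H -> HH := lext (fun G => (bas (mone, G))).

Lemma tenslU F : tensl (bas F) = (bas (F, mone)).
Proof. exact: lext1. Qed.
Lemma tensrU F : tensr (bas F) = (bas (mone, F)).
Proof. exact: lext1. Qed.

Lemma tenslM : {morph tensl : x y / x * y}.
Proof. by apply: lextM; split=> [F G|]; [rewrite malgMU mmul_pair mulm1|exact: bas1]. Qed.
Lemma tensrM : {morph tensr : x y / x * y}.
Proof. by apply: lextM; split=> [F G|]; [rewrite malgMU mmul_pair mulm1|exact: bas1]. Qed.

Lemma tens_mul a b : tens a b = tensl a * tensr b.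
Proof.
have sumM (A : algType K) (I J : Type) (r : seq I) (r' : seq J) (c : I -> K) (d : J -> K)
    (x : I -> A) (y : J -> A) :
    (\sum_(i <- r) c i *: x i) * (\sum_(j <- r') d j *: y j)
      = \sum_(i <- r) \sum_(j <- r') (c i * d j) *: (x i * y j).
  rewrite mulr_suml; apply: eq_bigr => i _; rewrite mulr_sumr.
  by apply: eq_bigr => j _; rewrite -scalerAl -scalerAr scalerA.
rewrite /tensl lextE /tensr lextE sumM; apply: eq_bigr => F _; apply: eq_bigr => G _.
by rewrite malgMU mmul_pair mul1m mulm1 malgUZ.
Qed.

End TensorProduct.

(** A locked form of the tensor product, for the same reason as for basis elements. *)
HB.lock Definition ten (K : fieldType) (D : choiceType) (a b : HCK K D) : HCK2 K D :=
  tensl a * tensr b.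

Section TensorTheory.

Variables (K : fieldType) (D : choiceType).
Local Notation H := (HCK K D).
Local Notation HH := (HCK2 K D).
Implicit Types a b c : H.

Lemma tensE a b : tens a b = ten a b.
Proof. by rewrite ten.unlock tens_mul. Qed.

Lemma tenPl k a b c : ten (k *: a + b) c = k *: ten a c + ten b c.
Proof. by rewrite ten.unlock /tensl lextP mulrDl scalerAl. Qed.
Lemma tenPr k a b c : ten c (k *: a + b) = k *: ten c a + ten c b.
Proof. by rewrite ten.unlock /tensr lextP mulrDr scalerAr. Qed.

Definition ten_flip b a : HH := ten a b.
HB.instance Definition _ b :=
  GRing.isLinear.Build K H HH *:%R (ten_flip b) (fun k x y => tenPl k x y b).
HB.instance Definition _ a :=
  GRing.isLinear.Build K H HH *:%R (ten a) (fun k x y => tenPr k x y a).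

Lemma tenDl a b c : ten (a + b) c = ten a c + ten b c.
Proof. exact: (linearD (ten_flip c)). Qed.
Lemma tenZl k a b : ten (k *: a) b = k *: ten a b.
Proof. exact: (linearZ_LR (ten_flip b)). Qed.
Lemma ten0l b : ten 0 b = 0.
Proof. exact: (linear0 (ten_flip b)). Qed.
Lemma tenDr a b c : ten c (a + b) = ten c a + ten c b.
Proof. exact: (linearD (ten c)). Qed.
Lemma tenZr k a b : ten b (k *: a) = k *: ten b a.
Proof. exact: (linearZ_LR (ten b)). Qed.
Lemma ten0r b : ten b 0 = 0.
Proof. exact: (linear0 (ten b)). Qed.

Lemma tenU (F G : forest D) : ten (bas F) (bas G) = (bas (F, G)) :> HH.
Proof. by rewrite ten.unlock tenslU tensrU malgMU mmul_pair mul1m mulm1. Qed.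

Lemma ten11 : ten 1 1 = 1 :> HH.
Proof. by rewrite -!bas1 tenU. Qed.

Lemma tenM a b c d : ten a b * ten c d = ten (a * c) (b * d).
Proof. by rewrite ten.unlock mulrACA tenslM tensrM. Qed.

Lemma ten_ind (P : HH -> Prop) :
  P 0 -> (forall (k : K) (F G : forest D) x, P x -> P (k *: ten (bas F) (bas G) + x)) ->
  forall x, P x.
Proof.
by move=> P0 PS; apply: malg_lin_ind => // c [F G] x; rewrite -tenU; apply: PS.
Qed.

End TensorTheory.

HB.lock Definition Delta (K : fieldType) (D : choiceType) : HCK K D -> HCK2 K D :=
  lext (cmon (@comul_tree K D)).

Section Comultiplication.

Variables (K : fieldType) (D : choiceType).
Local Notation H := (HCK K D).
Local Notation HH := (HCK2 K D).
Implicit Types (a b : H) (s : seq (ptree D)) (t : ptree D).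

Local Notation fpair := (@fpair K D).

(** The operators id (x) B_d and B_d. *)
Definition pgraft (d : D) : HH -> HH :=
  lext (fun p : forest D * forest D => (bas (p.1, graftF d p.2))).
Definition bgraft (d : D) : H -> H := lext (fun F => (bas (graftF d F))).

HB.instance Definition _ d := GRing.Linear.on (pgraft d).
HB.instance Definition _ d := GRing.Linear.on (bgraft d).

Lemma pgraftP d k x y : pgraft d (k *: x + y) = k *: pgraft d x + pgraft d y.
Proof. exact: linearP. Qed.

Lemma bgraftP d k a b : bgraft d (k *: a + b) = k *: bgraft d a + bgraft d b.
Proof. exact: linearP. Qed.

Lemma pgraft0 d : pgraft d 0 = 0. Proof. exact: linear0. Qed.
Lemma bgraft0 d : bgraft d 0 = 0. Proof. exact: linear0. Qed.

Lemma pgraftU d p : pgraft d (bas p) = (bas (p.1, graftF d p.2)).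
Proof. exact: lext1. Qed.

Lemma bgraftU d F : bgraft d (bas F) = (bas (graftF d F)).
Proof. exact: lext1. Qed.

Lemma pgraft_ten d a b : pgraft d (ten a b) = ten a (bgraft d b).
Proof.
have EU (F G : forest D) :
    pgraft d (ten (bas F) (bas G)) = ten (bas F) (bgraft d (bas G)).
  by rewrite bgraftU !tenU pgraftU.
have Er (F : forest D) : pgraft d (ten (bas F) b) = ten (bas F) (bgraft d b).
  elim/malg_lin_ind: b => [|k' G b IH]; first by rewrite ten0r bgraft0 ten0r pgraft0.
  by rewrite tenDr tenZr pgraftP IH bgraftP tenDr tenZr EU.
elim/malg_lin_ind: a => [|k F a IH]; first by rewrite !ten0l pgraft0.
by rewrite tenDl tenZl pgraftP IH Er tenDl tenZl.
Qed.

Lemma fpairM p q : fpair p * fpair q = fpair (p.1 ++ q.1, p.2 ++ q.2).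
Proof. by rewrite /fpair malgMU /= !forest_of_cat. Qed.

Definition comul_planar t : HH := \sum_(q <- cop t) fpair q.

Lemma sum_copF_prod s : \sum_(q <- copF s) fpair q = \prod_(t <- s) comul_planar t.
Proof.
elim: s => [|t s IH]; first by rewrite big_seq1 big_nil /fpair /= forest_of_nil; exact: bas1.
pose phi (r r' : seq (ptree D)) := fpair (r, r').
have phiE (q : seq (ptree D) * seq (ptree D)) : fpair q = phi q.1 q.2.
  by rewrite /phi -surjective_pairing.
rewrite big_cons -IH; under eq_bigr => q _ do rewrite phiE.
rewrite sum_copF_cons mulr_suml; apply: eq_bigr => p _.
by rewrite mulr_sumr; apply: eq_bigr => q _; rewrite fpairM.
Qed.

(** The cocycle property of B_d on planar forests, read off from the recursion for cop. *)
Lemma comul_planar_node d s :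
  comul_planar (PNode d s)
    = fpair ([:: PNode d s], [::]) + pgraft d (\prod_(t <- s) comul_planar t).
Proof.
rewrite /comul_planar copE [LHS]big_cons big_map -sum_copF_prod linear_sum.
congr (_ + _); apply: eq_bigr => q _; rewrite [RHS]/=.
by rewrite pgraftU /= /fpair /= /graftF graft_forest_of forest_of1.
Qed.

(** The coproduct is computed on a representative of the isomorphism class; by the
    cocycle property and commutativity, the choice is immaterial. *)
Lemma comul_planar_piso t u : piso t u -> comul_planar t = comul_planar u.
Proof.
elim/ptree_rect_seq: t u => d s IH [d' s'] iso.
have cl := proj2 (tree_classE _ _) iso.
have /pisoP[_ [s'' ps'' ss'']] := iso; have [dd _] := proj1 (tree_class_node _ _ _ _) cl.
rewrite !comul_planar_node /fpair /= !forest_of1 cl -dd.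
suff -> : \prod_(t <- s) comul_planar t = \prod_(t <- s') comul_planar t by [].
transitivity (\prod_(t <- s'') comul_planar t); last exact: perm_big.
elim: s s'' IH ss'' {iso cl ps''} => [|t s IHs] [|t' s''] // [IHt IH] /= /andP[tt ss].
by rewrite !big_cons (IHt _ tt) (IHs _ IH ss).
Qed.

Lemma comul_tree_class t : comul_tree K (tree_class t) = comul_planar t.
Proof.
rewrite comul_tree_cop; apply: comul_planar_piso.
by apply/tree_classE; rewrite repr_classK.
Qed.

Lemma comulE a : comul a = Delta a.
Proof. by rewrite Delta.unlock lextE. Qed.

Lemma DeltaP k a b : Delta (k *: a + b) = k *: Delta a + Delta b.
Proof. by rewrite Delta.unlock lextP. Qed.

HB.instance Definition _ :=
  GRing.isLinear.Build K H HH *:%R (@Delta K D) DeltaP.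

Lemma Delta0 : Delta 0 = 0 :> HH. Proof. exact: linear0. Qed.

Lemma DeltaZ k a : Delta (k *: a) = k *: Delta a. Proof. exact: linearZ_LR. Qed.

Lemma DeltaD a b : Delta (a + b) = Delta a + Delta b. Proof. exact: linearD. Qed.

Lemma DeltaM a b : Delta (a * b) = Delta a * Delta b.
Proof. by rewrite Delta.unlock (lextM (cmon_mmorphism _)). Qed.

Lemma Delta1 : Delta 1 = 1 :> HH.
Proof. by rewrite Delta.unlock (lextone (cmon_mmorphism _)). Qed.

Lemma Delta_forest_of s : Delta (bas (forest_of s)) = \sum_(q <- copF s) fpair q.
Proof.
rewrite Delta.unlock lext1 cmon_forest_of sum_copF_prod.
by apply: eq_bigr => t _; rewrite comul_tree_class.
Qed.

(** The cocycle property, by which the equation determines the coproduct of its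
    solution. *)
Lemma Delta_bgraft d a : Delta (bgraft d a) = ten (bgraft d a) 1 + pgraft d (Delta a).
Proof.
have EU (F : forest D) : Delta (bgraft d (bas F) : H)
    = ten (bgraft d (bas F)) 1 + pgraft d (Delta (bas F)).
  rewrite bgraftU -(branchesK F); set s := branches F.
  rewrite /graftF graft_forest_of -forest_of1 Delta_forest_of sum_copF_prod big_seq1.
  rewrite comul_planar_node Delta_forest_of sum_copF_prod.
  by rewrite /fpair /= forest_of_nil -[X in ten _ X]bas1 tenU.
elim/malg_lin_ind: a => [|k F a IH].
  by rewrite bgraft0 Delta0 ten0l pgraft0 addr0.
rewrite bgraftP !DeltaP IH EU tenDl tenZl pgraftP.
have rearrange (V : lmodType K) (x y z t : V) :
  k *: (x + y) + (z + t) = (k *: x + z) + (k *: y + t) by rewrite scalerDr addrACA.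
exact: rearrange.
Qed.

End Comultiplication.

(** * The antipode *)

Section Antipode.

Variables (K : fieldType) (D : choiceType).
Local Notation H := (HCK K D).
Local Notation HH := (HCK2 K D).
Implicit Types (a b : H) (s : seq (ptree D)) (t : ptree D) (T : tree D).

Local Notation fpair := (@fpair K D).
Local Notation vertices := (tdeg (fun _ : D => 1%N)).
Local Notation pvertices := (ptree_deg (fun _ : D => 1%N)).

(** The number of vertices serves as the measure for the recursion: it is positive on trees
    whatever the weights of the decorations. *)
Lemma sum_copF_vertices s q : q \in copF s ->
  (sumn (map pvertices q.1) + sumn (map pvertices q.2) = sumn (map pvertices s))%N.
Proof.
have step t r : (forall q, q \in cop t ->
      (sumn (map pvertices q.1) + sumn (map pvertices q.2) = pvertices t)%N) ->
    (forall q, q \in copF r ->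
      (sumn (map pvertices q.1) + sumn (map pvertices q.2) = sumn (map pvertices r))%N) ->
    forall q, q \in copF (t :: r) ->
      (sumn (map pvertices q.1) + sumn (map pvertices q.2)
         = sumn (map pvertices (t :: r)))%N.
  move=> IHt IHr _ /allpairsP[[p p'] [/= /IHt <- /IHr <- ->]] /=.
  by rewrite !map_cat !sumn_cat addnACA.
have all_t t p : p \in cop t ->
    (sumn (map pvertices p.1) + sumn (map pvertices p.2) = pvertices t)%N.
  elim/ptree_rect_seq: t p => d r IH p; rewrite copE inE => /predU1P[->|].
    by rewrite /= !addn0.
  case/mapP => {}p pr ->; rewrite /= addn0 addnCA; congr (_ + _)%N.
  elim: r IH p pr => [_ p|t r IHr [IHt /IHr IH] p]; last exact: step.
  by rewrite inE => /eqP->.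
elim: s q => [|t s IH] q; last by apply: step => //; apply: all_t.
by rewrite inE => /eqP->.
Qed.

Lemma vertices_pruned t q u : q \in behead (cop t) -> u \in q.1 ->
  (vertices (tree_class u) < pvertices t)%N.
Proof.
case: t => d s; rewrite tdeg_class => /mapP[p /sum_copF_vertices /= e ->] /= up.
rewrite add1n ltnS -e; apply: leq_trans (leq_addr _ _).
rewrite sumnE big_map (big_rem _ up) /=; exact: leq_addr.
Qed.

(** The left inverse of the identity for convolution, computed tree by tree by
    S(t) = - sum of S(P) R over the cuts other than the total one; n bounds the number
    of recursive calls. *)
Fixpoint antipode_upto n T : H :=
  if n is n'.+1 then
    - \sum_(q <- behead (cop (repr T)))
        cmon (antipode_upto n') (forest_of q.1) * (bas (forest_of q.2))
  else 0.

Lemma antipode_uptoS n T :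
  antipode_upto n.+1 T = - \sum_(q <- behead (cop (repr T)))
        cmon (antipode_upto n) (forest_of q.1) * (bas (forest_of q.2)).
Proof. by []. Qed.

Lemma antipode_upto_stable n n' T : (vertices T < n)%N -> (vertices T < n')%N ->
  antipode_upto n T = antipode_upto n' T.
Proof.
elim: n n' T => [|n IH] n' T; first by rewrite ltn0.
case: n' => [|n'] Tn; first by rewrite ltn0.
move=> Tn'; rewrite !antipode_uptoS; apply: congr1.
apply: eq_big_seq => q qT; apply: (congr1 (fun z => z * _)).
rewrite !cmon_forest_of; apply: eq_big_seq => u uq.
have := vertices_pruned qT uq; rewrite -/(vertices T) => lt.
by apply: IH; apply: leq_trans lt _.
Qed.

Definition antipode_tree T : H := antipode_upto (vertices T).+1 T.

Definition antipode : H -> H := lext (cmon antipode_tree).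
HB.instance Definition _ := GRing.Linear.on antipode.

Lemma antipodeM a b : antipode (a * b) = antipode a * antipode b.
Proof. exact: (lextM (cmon_mmorphism _)). Qed.

Lemma antipode1 : antipode 1 = 1.
Proof. exact: (lextone (cmon_mmorphism _)). Qed.

Lemma antipode_treeE T :
  antipode_tree T = - \sum_(q <- behead (cop (repr T)))
        cmon antipode_tree (forest_of q.1) * (bas (forest_of q.2)).
Proof.
rewrite {1}/antipode_tree antipode_uptoS; apply: congr1.
apply: eq_big_seq => q qT; apply: (congr1 (fun z => z * _)).
rewrite !cmon_forest_of; apply: eq_big_seq => u uq.
have := vertices_pruned qT uq; rewrite -/(vertices T) => lt.
exact: antipode_upto_stable.
Qed.

(** The two convolution products of the antipode S with the identity, on F (x) G. *)
Definition conv_l (p : forest D * forest D) : H :=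
  antipode << p.1 >> * << p.2 >>.
Definition conv_r (p : forest D * forest D) : H :=
  << p.1 >> * antipode << p.2 >>.

Lemma conv_l_mmorphism : mmorphism conv_l.
Proof.
split=> [p q|]; last by rewrite /conv_l !basE !bas1 antipode1 mul1r.
case: p q => F G [F' G']; rewrite mmul_pair /conv_l !basE -[bas (mmul F F')]malgMU.
rewrite -[bas (mmul G G')]malgMU antipodeM; exact: mulrACA.
Qed.

Lemma conv_r_mmorphism : mmorphism conv_r.
Proof.
split=> [p q|]; last by rewrite /conv_r !basE !bas1 antipode1 mulr1.
case: p q => F G [F' G']; rewrite mmul_pair /conv_r !basE -[bas (mmul F F')]malgMU.
rewrite -[bas (mmul G G')]malgMU antipodeM; exact: mulrACA.
Qed.

Lemma lext_conv_l p : lext conv_l (fpair p)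
  = cmon antipode_tree (forest_of p.1) * (bas (forest_of p.2)).
Proof. by rewrite lext1 /conv_l !basE /antipode lext1. Qed.

Lemma lext_conv_r p : lext conv_r (fpair p)
  = (bas (forest_of p.1)) * cmon antipode_tree (forest_of p.2).
Proof. by rewrite lext1 /conv_r !basE /antipode lext1. Qed.

(** The recursive formula for S is precisely this identity. *)
Lemma conv_l_tree T : lext conv_l (comul_tree K T) = 0.
Proof.
rewrite comul_tree_cop lext_sum; under eq_bigr => q _ do rewrite lext_conv_l.
have -> : cop (repr T) = ([:: repr T], [::]) :: behead (cop (repr T)).
  by case: (repr T).
rewrite big_cons /= forest_of1 repr_classK cmonU forest_of_nil bas1 mulr1.
by rewrite {1}antipode_treeE addNr.
Qed.

Lemma conv_l_planar t : lext conv_l (comul_planar K t) = 0.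
Proof. by rewrite -comul_tree_class conv_l_tree. Qed.

Lemma antipode_planar d s :
  antipode_tree (tree_class (PNode d s))
    = - \sum_(q <- copF s) cmon antipode_tree (forest_of q.1)
                             * (bas (forest_of [:: PNode d q.2])).
Proof.
apply/eqP; rewrite -addr_eq0; apply/eqP.
have := conv_l_planar (PNode d s).
rewrite lext_sum copE [LHS]big_cons big_map lext_conv_l /= forest_of1 cmonU.
rewrite forest_of_nil bas1 mulr1 => {2}<-; congr (_ + _).
by apply: eq_bigr => q _; rewrite lext_conv_l.
Qed.

Lemma conv_r_forest s :
  \sum_(q <- copF s) (bas (forest_of q.1)) * cmon antipode_tree (forest_of q.2)
    = \prod_(t <- s) lext conv_r (comul_tree K (tree_class t)).
Proof.
transitivity (lext conv_r (\sum_(q <- copF s) fpair q)).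
  by rewrite lext_sum; apply: eq_bigr => q _; rewrite lext_conv_r.
rewrite sum_copF_prod (big_morph _ (lextM conv_r_mmorphism) (lextone conv_r_mmorphism)).
by apply: eq_bigr => t _; rewrite comul_tree_class.
Qed.

(** Replacing S by its recursive formula and using coassociativity, the sum becomes
    the product of id * S with B_d, where id * S acts on the pruned forest: it vanishes
    there by induction, except when nothing is pruned, and this term cancels the one of
    the total cut. *)
Lemma conv_r_tree T : lext conv_r (comul_tree K T) = 0.
Proof.
have [n] := ubnP (vertices T); elim: n T => // n IH T.
rewrite -(repr_classK T); move: (repr T) => t; rewrite ltnS tdeg_class.
case: t => d s tn.
rewrite comul_tree_class lext_sum; under eq_bigr => q _ do rewrite lext_conv_r.
rewrite copE big_cons big_map /= forest_of_nil (cmon_mmorphism _).2 mulr1.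
under eq_bigr => q _ do rewrite forest_of1 cmonU antipode_planar mulrN mulr_sumr.
rewrite sumrN; under eq_bigr => q _ do under eq_bigr => r _ do rewrite mulrA.
(* Cutting the remaining part again becomes cutting the pruned part again. *)
rewrite -(cop_coassoc s (fun r1 r2 r3 =>
   (bas (forest_of r1)) * cmon antipode_tree (forest_of r2) * (bas (forest_of [:: PNode d r3])))).
rewrite big_seq; under eq_bigr => q qs.
  rewrite -mulr_suml conv_r_forest.
  rewrite (_ : \prod_(_ <- _) _ = if q.1 == [::] then 1 else 0); last first.
    case q1: q.1 => [|u r]; first by rewrite big_nil.
    rewrite big_cons IH ?mul0r //.
    apply: leq_trans tn; apply: (@vertices_pruned _ (q.1, [:: PNode d q.2])).
      by apply/mapP; exists q.
    by rewrite /= q1 mem_head.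
  rewrite (_ : _ * _ = if q.1 == [::] then (bas (forest_of [:: PNode d q.2])) else 0).
  over.
  by case: eqP; rewrite ?mul1r ?mul0r.
rewrite -big_seq (sum_copF_counit s (fun r => bas (forest_of [:: PNode d r]) : H)).
exact: subrr.
Qed.

Lemma counitU (F : forest D) : counit ((bas F) : H) = (F == mone)%:R.
Proof. by rewrite /counit -basE mcoeffU eq_sym. Qed.

Lemma counitP (c : K) a b : counit (c *: a + b) = c * counit a + counit b.
Proof. by rewrite /counit mcoeffD mcoeffZ. Qed.

Lemma counit0 : counit (0 : H) = 0.
Proof. exact: mcoeff0. Qed.

(** An algebra morphism vanishing on the coproducts of trees coincides with the counit,
    since both are determined by their values on trees. *)
Lemma conv_comul (h : forest D * forest D -> H) : mmorphism h ->
  (forall T, lext h (comul_tree K T) = 0) ->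
  forall a, lext h (Delta a) = counit a *: 1.
Proof.
move=> hM h0.
have EU (F : forest D) : lext h (Delta (bas F)) = counit (bas F : H) *: 1.
  rewrite -(branchesK F) Delta_forest_of sum_copF_prod.
  rewrite (big_morph _ (lextM hM) (lextone hM)) counitU.
  case: (branches F) => [|t s]; first by rewrite big_nil forest_of_nil eqxx scale1r.
  rewrite big_cons -comul_tree_class h0 mul0r forest_of_cons.
  by rewrite cmM_eq1 cm1_eq1 scale0r.
elim/malg_lin_ind => [|c F a IH].
  by rewrite Delta0 lext0 counit0 scale0r.
have lin (V : lmodType K) k x y (v : V) : k *: (x *: v) + y *: v = (k * x + y) *: v.
  by rewrite scalerDl scalerA.
rewrite DeltaP lextP IH EU counitP; exact: lin.
Qed.

Lemma antipode_is_antipode : is_antipode antipode.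
Proof.
move=> a; have hl := conv_comul conv_l_mmorphism conv_l_tree a.
have hr := conv_comul conv_r_mmorphism conv_r_tree a.
by split; [move: hl | move: hr]; rewrite lextE -comulE; apply.
Qed.

End Antipode.

(** * The components of the solution and their coproduct *)

(** Both sides run over the pairs of positive a, j such that a + j <= n, m | j and
    m | n - a: once m | j, the conditions m | n - a and m | n - j - a agree. This exchange
    of sums is the combinatorial heart of the formula for the coproduct of the components. *)
Lemma sum_reorder (V : nmodType) (m n : nat) (t : nat -> nat -> V) :
  \sum_(1 <= j < n.+1 | (m %| j)%N || (j == n))
     \sum_(1 <= a < (n - j).+1 | (m %| n - j - a)%N) t a j
  = \sum_(1 <= a < n | (m %| n - a)%N)
      \sum_(1 <= j < (n - a).+1 | (m %| j)%N || (j == n - a)%N) t a j.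
Proof.
have [n0|n0] := posnP n; first by rewrite n0 !big_geq.
pose c a j := [&& (a + j <= n)%N, (m %| j)%N & (m %| n - a)%N].
have dvd_shift a j : (a + j <= n)%N -> (m %| j)%N -> (m %| n - j - a)%N = (m %| n - a)%N.
  by move=> ajn mj; rewrite -subnDA addnC subnDA -(dvdn_addl _ mj) subnK // leq_subRL
    ?(leq_trans _ ajn) ?leq_addr.
transitivity (\sum_(1 <= j < n.+1) \sum_(1 <= a < n.+1) if c a j then t a j else 0).
  rewrite big_mkcond; apply: eq_big_nat => j /andP[j1 jn].
  transitivity (\sum_(1 <= a < n.+1 | c a j) t a j); last by rewrite big_mkcond.
  rewrite (@big_nat_widen _ _ _ 1 (n - j).+1 n.+1); last by rewrite ltnS leq_subr.
  case: ifP => [mj|mj]; last first.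
    rewrite big1 // => a; rewrite /c; case: (m %| j)%N mj => //=.
    by rewrite andbF.
  rewrite big_nat_cond [RHS]big_nat_cond; apply: eq_bigl => a.
  case: (1 <= a < n.+1)%N /andP => //= -[a1 an]; rewrite /c ltnS leq_subRL // addnC.
  case: leqP => ajn /=; rewrite ?andbF // andbT addnC in ajn *.
  have jn' : j != n.
    by apply: contraTneq ajn => ->; rewrite -ltnNge ?[(a + n)%N]addnC -{1}[n]addn0 ltn_add2l.
  move: mj; rewrite (negPf jn') orbF => mj. by rewrite mj dvd_shift 1?addnC.
rewrite exchange_big_nat big_nat_recr //= [X in _ + X]big1_seq ?addr0; last first.
  move=> j /andP[_]; rewrite mem_index_iota => /andP[j1 _].
  by rewrite /c leqNgt -[X in (X < _)%N]addn0 ltn_add2l j1.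
rewrite [RHS]big_mkcond; apply: eq_big_nat => a /andP[a1 an].
transitivity (\sum_(1 <= j < n.+1 | c a j) t a j); first by rewrite [RHS]big_mkcond.
case: ifP => [mna|mna]; last by rewrite big1 // => j; rewrite /c mna !andbF.
rewrite (@big_nat_widen _ _ _ 1 (n - a).+1 n.+1); last by rewrite ltnS leq_subr.
apply: eq_bigl => j; rewrite /c mna andbT ltnS leq_subRL ?(ltnW an) // andbC.
by case: eqP => [->|_]; rewrite ?mna ?orbF ?orbT /=. 
Qed.

(** The formal sums in the equation have at most one nonzero term. *)
Lemma fsum_single (T : choiceType) (V : zmodType) (A : set T) (f : T -> V) (j : T) :
  (forall i, A i -> i <> j -> f i = 0) ->
  \sum_(i \in A) f i = if `[< A j >] then f j else 0.
Proof.
move=> f0; case: asboolP => Aj; last first.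
  by apply: fsbig1 => i Ai; apply: f0 => // ij; apply: Aj; rewrite -ij.
rewrite (@fsbigE _ _ _ _ _ [:: j]) //=.
- by rewrite big_cons big_nil /= ifT ?addr0 //; apply/mem_set.
- by move=> i /=; rewrite inE => /eqP->.
by move=> i Ai; rewrite inE => /eqP ij; apply: f0.
Qed.

Section Solution.

Variables (K : fieldType) (J : {pred nat}).
Hypothesis J_pos : forall j, j \in J -> (0 < j)%N.
Variables (m : nat) (alpha : K).
Hypothesis alpha_neq0 : alpha != 0.
Variable x : series K (deco J).
Hypothesis x_sol : dyson_schwinger m alpha x.

Local Notation D := (deco J).
Local Notation H := (HCK K D).
Local Notation HH := (HCK2 K D).
Local Notation fdeg := (deg (@deco_val J)).

Lemma deco_pos (j : D) : (0 < deco_val j)%N.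
Proof. exact: J_pos (valP j). Qed.

Lemma fdeg_eq0 F : (fdeg F == 0%N) = (F == mone).
Proof.
apply/eqP/eqP => [|->]; last exact: deg1.
rewrite -(branchesK F) deg_forest_of; case: (branches F) => [|[j s] r] /=.
  by rewrite forest_of_nil.
by move/eqP; rewrite !addn_eq0 -!andbA eqn0Ngt deco_pos.
Qed.

Lemma series_graft_graftF (j : D) (y : series K D) F :
  series_graft j y (graftF j F) = y F.
Proof.
rewrite /series_graft (@fsum_single _ _ _ _ F); last first.
  by move=> F' /= /graftF_inj[_ ->].
by rewrite asboolT.
Qed.

Lemma series_graft_ne (j : D) (y : series K D) G :
  (forall F, graftF j F <> G) -> series_graft j y G = 0.
Proof. by move=> ne; apply: fsbig1 => F /= /ne. Qed.

Lemma sum_series_graft (A : set D) (y : series K D) j F :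
  \sum_(i \in A) series_graft i y (graftF j F) = if `[< A j >] then y F else 0.
Proof.
rewrite (@fsum_single _ _ _ _ j) ?series_graft_graftF // => i _ ij.
by apply: series_graft_ne => F' /graftF_inj[].
Qed.

(** The equation read on the coefficient of B_j(F); together with the next lemma it
    determines all coefficients. *)
Lemma x_graftF (j : D) F :
  x (graftF j F)
    = (F == mone)%:R + (if (m %| deco_val j)%N then alpha * x F else 0).
Proof.
rewrite x_sol !sum_series_graft /series_one !asboolb.
by case: ifP => _ /=; rewrite ?addr0 ?add0r.
Qed.

Lemma x_ngraftF G : (forall (j : D) F, graftF j F <> G) -> x G = 0.
Proof.
by move=> ne; rewrite x_sol !fsbig1 ?addr0 // => j _; apply: series_graft_ne.
Qed.

Lemma x1 : x mone = 0.
Proof. by apply: x_ngraftF => j F; apply: ucm_neq1. Qed.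

Lemma x_support G : x G != 0 -> exists (j : D) F, G = graftF j F.
Proof.
move=> xG; have [//|ne] := pselect (exists (j : D) F, G = graftF j F).
by move: xG; rewrite x_ngraftF ?eqxx // => j F GE; apply: ne; exists j, F.
Qed.

(** B_j for an integer j, zero when j is not a decoration, so that the sums below can run
    over intervals of integers. *)
Definition bnat (j : nat) (a : H) : H :=
  if insub j is Some d then bgraft (d : D) a else 0.
Definition pbnat (j : nat) (a : HH) : HH :=
  if insub j is Some d then pgraft (d : D) a else 0.

Lemma bnatP j k a b : bnat j (k *: a + b) = k *: bnat j a + bnat j b.
Proof.
by rewrite /bnat; case: insubP => [d _ _|_]; rewrite ?bgraftP // scaler0 addr0.
Qed.
HB.instance Definition _ j :=
  GRing.isLinear.Build K H H *:%R (bnat j) (bnatP j).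

Lemma pbnatP j k a b : pbnat j (k *: a + b) = k *: pbnat j a + pbnat j b.
Proof.
by rewrite /pbnat; case: insubP => [d _ _|_]; rewrite ?pgraftP // scaler0 addr0.
Qed.
HB.instance Definition _ j :=
  GRing.isLinear.Build K HH HH *:%R (pbnat j) (pbnatP j).

Lemma pbnat_ten j a b : pbnat j (ten a b) = ten a (bnat j b).
Proof. by rewrite /pbnat /bnat; case: insubP => [d _ _|_]; rewrite ?pgraft_ten ?ten0r. Qed.

Lemma Delta_bnat j a : Delta (bnat j a) = ten (bnat j a) 1 + pbnat j (Delta a).
Proof.
rewrite /bnat /pbnat; case: insubP => [d _ _|_]; first exact: Delta_bgraft.
by rewrite Delta0 ten0l addr0.
Qed.

Lemma bgraft_coef (j j' : D) (a : H) F :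
  (bgraft j a)@_(graftF j' F) = if j == j' then a@_F else 0 :> K.
Proof.
elim/malg_lin_ind: a => [|k G a IH].
  by rewrite bgraft0 !mcoeff0 if_same.
rewrite bgraftP !mcoeffD !mcoeffZ IH bgraftU -!basE !mcoeffU.
have [<-|jj'] := eqVneq j j'.
  by rewrite (_ : (_ == _) = (G == F)) //; apply/eqP/eqP => [/graftF_inj[]//|-> //].
case: eqP => [/graftF_inj[jE]|_]; first by rewrite jE eqxx in jj'.
by rewrite mulr0 addr0.
Qed.

Lemma bgraft_coef0 (j : D) (a : H) G : (forall F, graftF j F <> G) -> (bgraft j a)@_G = 0 :> K.
Proof.
move=> ne; elim/malg_lin_ind: a => [|k F a IH]; first by rewrite bgraft0 mcoeff0.
rewrite bgraftP mcoeffD mcoeffZ IH bgraftU -basE mcoeffU.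
by case: eqP => [/ne//|_]; rewrite mulr0 addr0.
Qed.

(** The recursion for the components, with a bound k on its depth. Working with these
    finite sums instead of the formal series keeps everything inside the algebra. *)
Fixpoint Yfuel (k n : nat) : H :=
  if k is k'.+1 then
    alpha *: \sum_(1 <= j < n.+1 | (m %| j)%N || (j == n))
       bnat j (if (n - j == 0)%N then alpha^-1 *: 1 else Yfuel k' (n - j))
  else 0.

Lemma YfuelS k n : Yfuel k.+1 n =
    alpha *: \sum_(1 <= j < n.+1 | (m %| j)%N || (j == n))
       bnat j (if (n - j == 0)%N then alpha^-1 *: 1 else Yfuel k (n - j)).
Proof. by []. Qed.

Lemma mcoeff_sum (I : Type) (r : seq I) (P : pred I) (f : I -> H) G :
  (\sum_(i <- r | P i) f i)@_G = \sum_(i <- r | P i) (f i)@_G.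
Proof. exact: raddf_sum. Qed.

(** In the sum over j only the decoration of the root of G contributes to the coefficient
    of G, and what remains is the equation for this coefficient. *)
Lemma Yfuel_coef k n G : (n < k)%N -> (Yfuel k n)@_G = if fdeg G == n then x G else 0.
Proof.
elim: k n G => // k IH n G nk; rewrite YfuelS mcoeffZ mcoeff_sum.
have [[j [F ->]]|ne] := pselect (exists (j : D) F, G = graftF j F); last first.
  have ne' (j : D) F : graftF j F <> G by move=> E; apply: ne; exists j, F.
  rewrite (x_ngraftF ne') if_same big1 ?mulr0 // => i _.
  rewrite /bnat; case: insubP => [d _ _|_]; last exact: mcoeff0.
  exact: bgraft_coef0.
set j0 := deco_val j.
have termE i (a : H) : (bnat i a)@_(graftF j F) = if i == j0 then a@_F else 0.
  rewrite /bnat; case: insubP => [d dJ di|iJ]; last first.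
    by rewrite mcoeff0; case: eqP => // ij; rewrite ij (valP j) in iJ.
  by rewrite bgraft_coef -di -val_eqE.
under eq_bigr => i _ do rewrite termE.
rewrite -big_mkcondr /= deg_graftF -/j0.
have -> (f : nat -> K) : \sum_(1 <= i < n.+1 | ((m %| i)%N || (i == n)) && (i == j0)) f i
    = if (j0 <= n)%N && ((m %| j0)%N || (j0 == n)) then f j0 else 0.
  rewrite big_mkcond (eq_bigr (fun i => if i == j0 then
    if (m %| i)%N || (i == n) then f i else 0 else 0)); last first.
    by move=> i _; case: (i == j0); rewrite ?andbT ?andbF.
  have j0_pos : (0 < j0)%N by apply: deco_pos.
  rewrite -big_mkcond big_nat1_eq j0_pos /= ltnS.
  by case: (j0 <= n)%N => //=.
rewrite x_graftF -/j0; have j0_pos : (0 < j0)%N by apply: deco_pos.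
have [j0n|nj0] := leqP j0 n; last first.
  by rewrite /= mulr0 gtn_eqF // ltn_addr.
rewrite andTb; have [jn|jn] := eqVneq j0 n.
  rewrite orbT jn subnn eqxx -bas1 mcoeffZ -basE mcoeffU.
  rewrite mulrA divff // mul1r (_ : (n + fdeg F == n)%N = (F == mone)); last first.
    by rewrite -[X in _ == X]addn0 eqn_add2l fdeg_eq0.
  rewrite [mone == F]eq_sym.
  by have [->|F1] := eqVneq F mone; rewrite // x1 mulr0 if_same addr0.
have jn' : (j0 < n)%N by rewrite ltn_neqAle jn.
rewrite orbF subn_eq0 leqNgt jn' /= IH; last first.
  rewrite ltnS in nk; apply: leq_trans nk.
  by rewrite ltn_subrL j0_pos (leq_ltn_trans _ jn').
rewrite -(eqn_add2l j0) subnKC //; have [degF|degF] := eqVneq (j0 + fdeg F)%N n.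
  suff /negPf-> : F != mone by rewrite add0r; case: ifP; rewrite ?mulr0.
  by rewrite -fdeg_eq0; apply: contraNneq jn => F0; rewrite -degF F0 addn0.
by case: ifP => _; rewrite ?mulr0.
Qed.

Definition Y : nat -> H := locked (fun n => Yfuel n.+1 n).

Lemma YE n : Y n = Yfuel n.+1 n.
Proof. by rewrite /Y -lock. Qed.

(** Z 0 = 1 / alpha makes 1 + alpha x equal to alpha times the sum of the Z n, so that the
    coproduct formula has the same shape in all degrees. *)
Definition Z (n : nat) : H := if (n == 0)%N then alpha^-1 *: 1 else Y n.

Lemma Y_coef n G : (Y n)@_G = if fdeg G == n then x G else 0.
Proof. by rewrite YE Yfuel_coef. Qed.

Lemma hom_componentE n : hom_component x n = Y n.
Proof.
rewrite /hom_component (@fsbigE _ _ _ _ _ (msupp (Y n))).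
- transitivity (\sum_(F <- msupp (Y n)) << (Y n)@_F *g F >>); last exact: esym (monalgE (Y n)).
  rewrite [LHS]big_mkcond; apply: eq_big_seq => F FY.
  have Fn : fdeg F == n by move: FY; rewrite -mcoeff_neq0 Y_coef; case: ifP; rewrite ?eqxx.
  by rewrite ifT; [rewrite Y_coef Fn|apply/mem_set/eqP].
- exact: fset_uniq.
- by move=> F /=; rewrite -mcoeff_neq0 Y_coef; case: (eqVneq (fdeg F) n) => //; rewrite eqxx.
move=> F /= Fn; rewrite -mcoeff_eq0 Y_coef Fn eqxx => /eqP->.
exact: monalgU0.
Qed.

Lemma Y0 : Y 0 = 0.
Proof. by rewrite YE YfuelS big_geq // scaler0. Qed.

Lemma Yrec n : Y n = alpha *: \sum_(1 <= j < n.+1 | (m %| j)%N || (j == n)) bnat j (Z (n - j)).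
Proof.
rewrite {1}YE YfuelS; congr (_ *: _); rewrite big_nat_cond [RHS]big_nat_cond.
apply: eq_bigr => j /andP[/andP[j0 jn] _]; congr (bnat j _).
rewrite /Z; case: eqP => // /eqP nj; apply/malgP => G.
rewrite Y_coef Yfuel_coef // ltn_subrL j0.
by move: nj; case: (n) => //; rewrite sub0n.
Qed.

Lemma index_set_deco i : i \in J -> index_set J m i.
Proof.
move=> iJ; split; first exact: J_pos.
exists 0%N, (fun=> 1%N), (fun=> i); split=> //.
  by move=> u; rewrite (ord1 u) (ord1 ord_max) eqxx.
by rewrite big_ord1 mul1n.
Qed.

Lemma index_set_step i n :
  i \in J -> (m %| i)%N -> index_set J m n -> index_set J m (i + n)%N.
Proof.
move=> iJ mi [n0 [k [a [j [jJ aj a_last nE]]]]]; split; first by rewrite ltn_addl.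
exists k.+1, (fun u => if unlift ord0 u is Some v then a v else 1%N),
  (fun u => if unlift ord0 u is Some v then j v else i); split.
- by move=> u; case: unliftP.
- move=> u; case: unliftP => [v ->|-> _]; last by split.
  move=> /eqP vm; apply: aj; apply/eqP => vE; apply: vm; rewrite vE.
  by apply: val_inj.
- have -> : (ord_max : 'I_k.+2) = lift ord0 ord_max by apply: val_inj.
  by rewrite liftK.
rewrite big_ord_recl unlift_none mul1n nE; congr (_ + _)%N.
by apply: eq_bigr => v _; rewrite liftK.
Qed.

(** The index set is the smallest set containing J and stable under the addition of
    the elements of J divisible by m: the recursion that governs the coefficients of x. *)
Lemma index_set_ind (P : nat -> Prop) :
  (forall i, i \in J -> P i) ->
  (forall i n, i \in J -> (m %| i)%N -> P n -> P (i + n)%N) ->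
  forall n, index_set J m n -> P n.
Proof.
move=> single step n [n0 [k [a [j [jJ aj a_last nE]]]]].
have iter_step c i n' : i \in J -> (m %| i)%N ->
    (n' = 0)%N \/ P n' -> (c * i + n' = 0)%N \/ P (c * i + n')%N.
  move=> iJ mi n'P; elim: c => [|c [IH|IH]]; first exact: n'P.
    by right; rewrite mulSn -addnA IH addn0; apply: single.
  by right; rewrite mulSn -addnA; apply: step.
have sum_step (r : seq 'I_k.+1) n' : ord_max \notin r ->
    (n' = 0)%N \/ P n' ->
    (\sum_(i <- r) a i * j i + n' = 0)%N \/ P (\sum_(i <- r) a i * j i + n')%N.
  move=> + n'P; elim: r => [_|i r IH]; first by rewrite big_nil.
  rewrite inE negb_or eq_sym => /andP[/aj[_ mi] /IH ?].
  by rewrite big_cons -addnA; apply: iter_step.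
have last_ok : (a ord_max * j ord_max = 0)%N \/ P (a ord_max * j ord_max)%N.
  case: (a ord_max) a_last => [|[|//]] _; first by left.
  by right; rewrite mul1n; apply: single.
have := sum_step (filter (predC1 ord_max) (index_enum 'I_k.+1)) _ _ last_ok.
rewrite mem_filter /= eqxx => /(_ isT); rewrite big_filter.
rewrite (_ : (_ + _)%N = n); last by rewrite nE [RHS](bigD1 ord_max) //= addnC.
by case=> // n0'; rewrite n0' in n0.
Qed.

Lemma index_set_add i j : index_set J m i -> index_set J m j -> (m %| j)%N ->
  index_set J m (i + j)%N.
Proof.
move=> iI; move: j; apply: (index_set_ind (P := fun j => (m %| j)%N -> index_set J m (i + j)%N)).
  by move=> j jJ mj; rewrite addnC; apply: index_set_step.
move=> k n kJ mk IH mkn; rewrite addnCA; apply: index_set_step => //.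
by apply: IH; rewrite -(dvdn_addr _ mk).
Qed.

Lemma index_set_x n : index_set J m n -> exists2 G, x G != 0 & fdeg G = n.
Proof.
move: n; apply: index_set_ind => [i iJ|i n iJ mi [G xG <-]].
  pose d : D := exist _ i iJ.
  exists (graftF d mone); last by rewrite deg_graftF deg1 addn0.
  by rewrite x_graftF eqxx x1 mulr0 if_same addr0 oner_eq0.
pose d : D := exist _ i iJ.
exists (graftF d G); last by rewrite deg_graftF.
rewrite x_graftF [deco_val d]/= mi (_ : (G == mone) = false) ?add0r ?mulf_neq0 //.
by apply/negP => /eqP GE; rewrite GE x1 eqxx in xG.
Qed.

Lemma x_index_set G : x G != 0 -> index_set J m (fdeg G).
Proof.
have [n] := ubnP (fdeg G); elim: n G => // n IH G Gn xG.
have [d [F GE]] := x_support xG; move: xG Gn; rewrite GE x_graftF deg_graftF.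
set i := deco_val d; have iJ : i \in J by exact: (valP d).
have [->|F1] := eqVneq F mone; first by rewrite deg1 addn0 => _ _; apply: index_set_deco.
rewrite add0r; case: ifP => [mi|_]; last by rewrite eqxx.
rewrite mulf_eq0 (negPf alpha_neq0) /= => xF Fn; apply: index_set_step => //.
apply: IH xF; rewrite ltnS in Fn; apply: leq_trans Fn.
by rewrite -add1n leq_add2r J_pos.
Qed.

Lemma Y_eq0 n : ~ index_set J m n -> Y n = 0.
Proof.
move=> nn; apply/malgP => G; rewrite Y_coef mcoeff0; case: eqP => // Gn.
by have [//|xG] := eqVneq (x G) 0; case: nn; rewrite -Gn; apply: x_index_set.
Qed.

Lemma Y_tree n : index_set J m n ->
  exists T : tree D, (Y n)@_(ucm T) != 0.
Proof.
case/index_set_x => G xG Gn; have [d [F GE]] := x_support xG.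
by exists (graft d F); rewrite -/(graftF d F) -GE Y_coef Gn eqxx.
Qed.

Lemma Y_homog n F : F \in msupp (Y n) -> fdeg F = n.
Proof. by rewrite -mcoeff_neq0 Y_coef; case: (eqVneq (fdeg F) n) => //; rewrite eqxx. Qed.

Lemma Y_support n F : F \in msupp (Y n) -> exists T, F = ucm T.
Proof.
rewrite -mcoeff_neq0 Y_coef; case: ifP => [_ xF|]; last by rewrite eqxx.
by have [d [G ->]] := x_support xF; exists (graft d G).
Qed.

Lemma Zpos n : (0 < n)%N -> Z n = Y n.
Proof. by rewrite /Z lt0n => /negPf->. Qed.

(** By induction on n, through the cocycle property. With a and j as in the exchange of
    sums, the terms Y_a (x) B_j(Z_(n-j-a)) regroup by the recursion for the components into
    Y_a (x) Z_(n-a); the terms B_j(Z_(n-j)) (x) 1 give Y_n (x) 1, which is the summand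
    a = n. *)
Lemma Delta_Z n :
  Delta (Z n) = ten 1 (Z n)
    + alpha *: \sum_(1 <= a < n.+1 | (m %| n - a)%N) ten (Y a) (Z (n - a)).
Proof.
have [k] := ubnP n; elim: k n => // k IH n; rewrite ltnS => nk.
have [->|n0] := posnP n.
  rewrite big_geq // scaler0 addr0 /Z eqxx DeltaZ Delta1.
  by rewrite tenZr ten11.
have last_term (V : nmodType) (f : nat -> V) :
    \sum_(1 <= a < n.+1 | (m %| n - a)%N) f a
      = \sum_(1 <= a < n | (m %| n - a)%N) f a + f n.
  by rewrite big_mkcond big_nat_recr //= subnn dvdn0 -big_mkcond.
(* The summand a = n is Y_n (x) Z_0 = Y_n (x) 1 / alpha. *)
rewrite last_term subnn [Z 0]/Z eqxx Zpos // {1}Yrec.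
set S := \sum_(1 <= j < n.+1 | _) bnat j _.
rewrite DeltaZ.
have -> : Delta S = ten S 1 + ten 1 S + alpha *:
    \sum_(1 <= j < n.+1 | (m %| j)%N || (j == n))
      \sum_(1 <= a < (n - j).+1 | (m %| n - j - a)%N) ten (Y a) (bnat j (Z (n - j - a))).
  have -> : ten S 1 = \sum_(1 <= j < n.+1 | (m %| j)%N || (j == n))
      ten (bnat j (Z (n - j))) 1 by exact: (linear_sum (ten_flip 1)).
  have -> : ten 1 S = \sum_(1 <= j < n.+1 | (m %| j)%N || (j == n))
      ten 1 (bnat j (Z (n - j))) by exact: (linear_sum (ten 1)).
  rewrite scaler_sumr -!big_split /=.
  have -> : Delta S = \sum_(1 <= j < n.+1 | (m %| j)%N || (j == n))
      Delta (bnat j (Z (n - j))) by exact: linear_sum.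
  rewrite [LHS]big_nat_cond [RHS]big_nat_cond; apply: eq_bigr => j /andP[/andP[j1 jn] _].
  rewrite Delta_bnat IH; last by rewrite (leq_trans _ nk) // ltn_subrL j1.
  rewrite -addrA; congr (_ + _).
  have -> (u v : HH) : pbnat j (u + alpha *: v) = pbnat j u + alpha *: pbnat j v.
    by rewrite addrC pbnatP addrC.
  rewrite pbnat_ten; congr (_ + _ *: _).
  rewrite (linear_sum (pbnat j)); apply: eq_bigr => a _; exact: pbnat_ten.
rewrite (sum_reorder m n (fun a j => ten (Y a) (bnat j (Z (n - j - a))))).
have combine (V : lmodType K) (u v w u' v' w' : V) :
    alpha *: v = v' -> alpha *: w = w' -> u = u' ->
    alpha *: (u + v + alpha *: w) = v' + alpha *: (w' + u').
  by move=> <- <- ->; rewrite !scalerDr [alpha *: u' + _]addrC -addrA [alpha *: u' + _]addrC.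
apply: combine.
- by rewrite -tenZr -Yrec.
- rewrite scaler_sumr [LHS]big_nat_cond [RHS]big_nat_cond.
  apply: eq_bigr => a /andP[/andP[a1 an] _].
  rewrite Zpos ?subn_gt0 // (Yrec (n - a)) tenZr; apply: congr1.
  rewrite (linear_sum (ten (Y a))); apply: eq_bigr => j _.
  by rewrite /= subnAC.
by rewrite tenZr Yrec tenZl scalerA mulVf // scale1r.
Qed.

End Solution.

(** * The Hopf subalgebra generated by the components *)

Lemma gen_pred_ind (K : fieldType) (B : algType K) (X : B -> Prop) (P : B -> Prop) :
  P 1 -> (forall c u v, P u -> P v -> P (c *: u + v)) ->
  (forall u v, P u -> P v -> P (u * v)) -> (forall b, X b -> P b) ->
  forall a, a \in gen_pred X -> P a.
Proof.
move=> P1 PP PM PX a /asboolP aX; apply/asboolP.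
apply: (aX (fun b => `[< P b >])) => [|b /PX /asboolP//].
split; first exact/asboolP.
- by move=> c u v /asboolP Pu /asboolP Pv; apply/asboolP; apply: PP.
by move=> u v /asboolP Pu /asboolP Pv; apply/asboolP; apply: PM.
Qed.

Lemma gen_pred_gen (K : fieldType) (B : algType K) (X : B -> Prop) b :
  X b -> b \in gen_pred X.
Proof. by move=> Xb; apply/asboolP => A _; apply. Qed.

Section TensorSums.

Variables (K : fieldType) (D : choiceType).
Local Notation H := (HCK K D).
Implicit Types (s r : seq (H * H)).

Definition sum_ten s : HCK2 K D := \sum_(p <- s) ten p.1 p.2.

Lemma sum_tens s : \sum_(p <- s) tens p.1 p.2 = sum_ten s.
Proof. by apply: eq_bigr => p _; rewrite tensE. Qed.

Lemma sum_ten_cat s r : sum_ten (s ++ r) = sum_ten s + sum_ten r.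
Proof. exact: big_cat. Qed.

Lemma sum_ten_scale c s : sum_ten [seq (c *: p.1, p.2) | p <- s] = c *: sum_ten s.
Proof.
rewrite /sum_ten big_map scaler_sumr; apply: eq_bigr => p _; exact: tenZl.
Qed.

Lemma sum_ten_mul s r :
  sum_ten [seq (p.1 * q.1, p.2 * q.2) | p <- s, q <- r] = sum_ten s * sum_ten r.
Proof.
rewrite /sum_ten big_allpairs_dep mulr_suml; apply: eq_bigr => p _.
by rewrite mulr_sumr; apply: eq_bigr => q _; rewrite tenM.
Qed.

End TensorSums.

Section HopfSubalgebra.

Variables (K : fieldType) (D : choiceType) (m : nat) (alpha : K).
Hypothesis alpha_neq0 : alpha != 0.
Local Notation H := (HCK K D).
Variable Y : nat -> H.
Local Notation Z := (fun n => if (n == 0)%N then alpha^-1 *: 1 else Y n).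
Hypothesis Y_trees : forall n F, F \in msupp (Y n) -> exists T, F = ucm T.
Hypothesis Delta_Y : forall n, (0 < n)%N -> Delta (Y n) = ten 1 (Y n)
    + alpha *: \sum_(1 <= a < n.+1 | (m %| n - a)%N) ten (Y a) (Z (n - a)%N).
Hypothesis Y0 : Y 0 = 0.
Variable X : H -> Prop.
Hypothesis XY : forall a, X a <-> exists n, a = Y n.

Lemma counit_Y n : counit (Y n) = 0.
Proof.
apply: contrapT => /eqP; rewrite /counit mcoeff_neq0 => /Y_trees[T] /esym.
exact: ucm_neq1.
Qed.

Lemma Y_in n : Y n \in gen_pred X.
Proof. by apply: gen_pred_gen; apply/XY; exists n. Qed.

Lemma Z_in n : Z n \in gen_pred X.
Proof. by rewrite /=; case: ifP => _; [rewrite rpredZ ?rpred1 | exact: Y_in]. Qed.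

Let split_in a := exists s : seq (H * H),
  all (fun p => (p.1 \in gen_pred X) && (p.2 \in gen_pred X)) s /\ Delta a = sum_ten s.

Lemma Delta_in a : a \in gen_pred X -> split_in a.
Proof.
move: a; apply: (@gen_pred_ind _ _ X split_in) => [|c u v [s [sA us]] [r [rA vr]]|u v [s [sA us]] [r [rA vr]]|b].
- exists [:: (1, 1)]; rewrite /= rpred1; split=> //.
  by rewrite Delta1 /sum_ten big_seq1 ten11.
- exists ([seq (c *: p.1, p.2) | p <- s] ++ r); split.
    rewrite all_cat rA andbT all_map; apply: sub_all sA => p /= /andP[p1 p2].
    by rewrite p2 rpredZ.
  by rewrite DeltaP us vr sum_ten_cat sum_ten_scale.
- exists [seq (p.1 * q.1, p.2 * q.2) | p <- s, q <- r]; split.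
    apply/allP => _ /allpairsP[[p q] [/(allP sA)/andP[p1 p2] /(allP rA)/andP[q1 q2] ->]].
    by apply/andP; split; apply: rpredM.
  by rewrite DeltaM us vr sum_ten_mul.
case/XY => n ->; have [->|n0] := posnP n.
  by exists [::]; rewrite Y0 Delta0 /sum_ten big_nil.
(* The formula for the coproduct, the factor alpha being put on the left. *)
exists ((1, Y n) :: [seq (alpha *: Y a, Z (n - a)%N) | a <- index_iota 1 n.+1 & (m %| n - a)%N]).
split.
  rewrite /= rpred1 Y_in all_map; apply/allP => a _ /=.
  by rewrite rpredZ ?Y_in //; apply: Z_in.
rewrite Delta_Y // /sum_ten big_cons big_map big_filter scaler_sumr; apply: congr1.
by apply: eq_bigr => a _; rewrite tenZl.
Qed.

Lemma lext_conv_ten (a b : H) : lext (@conv_l K D) (ten a b) = antipode a * b.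
Proof.
have mulrPl (A : algType K) k (x y z : A) : (k *: x + y) * z = k *: (x * z) + y * z.
  by rewrite mulrDl scalerAl.
have mulrPr (A : algType K) k (x y z : A) : z * (k *: x + y) = k *: (z * x) + z * y.
  by rewrite mulrDr scalerAr.
have aP k (x y : H) : antipode (k *: x + y) = k *: antipode x + antipode y.
  exact: linearP.
have a0 : antipode (0 : H) = 0 by exact: linear0.
have Er (F : forest D) : lext (@conv_l K D) (ten (bas F) b) = antipode (bas F) * b.
  elim/malg_lin_ind: b => [|k' G b IH].
    by rewrite ten0r lext0 mulr0.
  by rewrite tenPr lextP IH mulrPr tenU lext1 /conv_l !basE.
elim/malg_lin_ind: a => [|k F a IH].
  by rewrite ten0l lext0 a0 mul0r.
by rewrite tenPl lextP IH Er aP mulrPl.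
Qed.

(** The identity (S * id) Y_n = 0 solved for S(Y_n), since the summand a = n is
    Y_n (x) 1. It shows by recursion that S(Y_n) stays in the subalgebra. *)
Lemma antipode_Y n : (0 < n)%N ->
  antipode (Y n) = - (Y n + alpha *:
    \sum_(1 <= a < n | (m %| n - a)%N) antipode (Y a) * Z (n - a)%N).
Proof.
move=> n0; apply/eqP; rewrite -addr_eq0; apply/eqP.
have := conv_comul (@conv_l_mmorphism K D) (@conv_l_tree K D) (Y n).
rewrite counit_Y scale0r => {2}<-.
have last_term (V : nmodType) (f : nat -> V) :
    \sum_(1 <= a < n.+1 | (m %| n - a)%N) f a
      = \sum_(1 <= a < n | (m %| n - a)%N) f a + f n.
  by rewrite big_mkcond big_nat_recr //= subnn dvdn0 -big_mkcond.
have lextZ k x : lext (@conv_l K D) (k *: x) = k *: lext (@conv_l K D) x.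
  exact: linearZ_LR.
have lextD x y : lext (@conv_l K D) (x + y) = lext (@conv_l K D) x + lext (@conv_l K D) y.
  exact: linearD.
rewrite Delta_Y // last_term subnn eqxx lextD lextZ lextD lext_sum.
rewrite !lext_conv_ten antipode1 mul1r.
have rearr (V : lmodType K) (u v w w' : V) : alpha *: w' = w ->
    w + (u + alpha *: v) = u + alpha *: (v + w').
  by move=> <-; rewrite scalerDr addrCA [alpha *: v + _]addrC.
have -> : \sum_(1 <= a < n | (m %| n - a)%N) lext (@conv_l K D) (ten (Y a) (Z (n - a)%N))
    = \sum_(1 <= a < n | (m %| n - a)%N) antipode (Y a) * Z (n - a)%N.
  by apply: eq_bigr => a _; rewrite lext_conv_ten.
apply: rearr.
by rewrite -scalerAr mulr1 scalerA divff // scale1r.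
Qed.

Lemma antipode_in a : a \in gen_pred X -> antipode a \in gen_pred X.
Proof.
move: a; apply: (@gen_pred_ind _ _ X (fun a => antipode a \in gen_pred X)) => [|c u v uA vA|u v uA vA|b].
- by rewrite antipode1 rpred1.
- have -> : antipode (c *: u + v) = c *: antipode u + antipode v by exact: linearP.
  by rewrite rpredD ?rpredZ.
- by rewrite antipodeM rpredM.
case/XY => n ->; have [k] := ubnP n; elim: k n => // k IH n; rewrite ltnS => nk.
have [->|n0] := posnP n.
  by rewrite Y0 (_ : antipode 0 = 0) ?rpred0 //; exact: linear0.
rewrite antipode_Y // rpredN rpredD ?Y_in // rpredZ //.
rewrite big_nat_cond; apply: rpred_sum => a /andP[/andP[_ an] _].
by rewrite rpredM ?Z_in // IH // (leq_trans an).
Qed.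

Lemma gen_pred_hopf_subalgebra : hopf_subalgebra (gen_pred X).
Proof.
split; first exact: gen_pred_closed.
- move=> a /Delta_in[s [sA as_]]; exists s; split=> //.
  by rewrite sum_tens comulE.
exists (@antipode K D); split; [exact: antipode_is_antipode | exact: antipode_in].
Qed.

End HopfSubalgebra.

(** * Derivations of the algebra of forests *)

(** The algebra morphism T |-> T + d(T) X modulo X^2, whose coefficient of X is the
    derivation extending d. Its multiplicativity is the Leibniz rule. *)
HB.lock Definition deform (K : fieldType) (D : choiceType) (d : tree D -> HCK K D)
    (a : HCK K D) : {poly HCK K D} :=
  mmap (polyC \o @malgC _ K)
    (cmon (fun T => (bas (ucm T))%:P + 'X * (d T)%:P : {poly HCK K D})) a.

Lemma coef1M (R : comNzRingType) (p q : {poly R}) :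
  (p * q)`_1 = p`_1 * q`_0 + p`_0 * q`_1.
Proof. by rewrite coefM big_ord_recl big_ord1 addrC. Qed.

Section Derivation.

Variables (K : fieldType) (D : choiceType).
Local Notation H := (HCK K D).
Implicit Types (a b : H) (d : tree D -> H).

Definition der_def d (a : H) : H := (deform d a)`_1.

Lemma deformM d : {morph deform d : a b / a * b}.
Proof. by rewrite deform.unlock => a b; exact: rmorphM. Qed.

Lemma deformP d c a b : deform d (c *: a + b) = c%:MP%:P * deform d a + deform d b.
Proof. by rewrite deform.unlock raddfD /= mmapZ. Qed.

Lemma deform0 d : deform d 0 = 0.
Proof. by rewrite deform.unlock; exact: raddf0. Qed.

Lemma deform_bas d F : deform d (bas F) = cmon (fun T => (bas (ucm T))%:P + 'X * (d T)%:P : {poly H}) F.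
Proof. by rewrite -basE deform.unlock mmapU [X in X * _](_ : _ = 1) ?mul1r. Qed.

Lemma coef0_deform d a : (deform d a)`_0 = a.
Proof.
have EU F : (deform d (bas F))`_0 = bas F.
  rewrite deform_bas -(branchesK F); elim: (branches F) => [|t s IH].
    by rewrite forest_of_nil (cmon_mmorphism _).2 coef1 bas1.
  rewrite forest_of_cons (cmon_mmorphism _).1 coef0M IH cmonU.
  by rewrite coefD coefC eqxx coefXM addr0 malgMU.
elim/malg_lin_ind: a => [|c F a IH]; first by rewrite deform0 coef0.
by rewrite deformP coefD IH coefCM EU mul_malgC.
Qed.

Lemma der_defP d c a b : der_def d (c *: a + b) = c *: der_def d a + der_def d b.
Proof. by rewrite /der_def deformP coefD coefCM mul_malgC. Qed.

Lemma der_defM d a b : der_def d (a * b) = der_def d a * b + a * der_def d b.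
Proof.
by rewrite /der_def deformM coef1M !coef0_deform.
Qed.

Lemma der_defU d T : der_def d (bas (ucm T)) = d T.
Proof. by rewrite /der_def deform_bas cmonU coefD coefC add0r coefXM coefC. Qed.

End Derivation.

HB.lock Definition der (K : fieldType) (D : choiceType) (d : tree D -> HCK K D)
  (a : HCK K D) : HCK K D := der_def d a.

Section DerivationTheory.

Variables (K : fieldType) (D : choiceType).
Local Notation H := (HCK K D).
Local Notation HH := (HCK2 K D).
Implicit Types (a b : H).
Variable d : tree D -> H.

Lemma derP c a b : der d (c *: a + b) = c *: der d a + der d b.
Proof. by rewrite der.unlock der_defP. Qed.
Lemma derM a b : der d (a * b) = der d a * b + a * der d b.
Proof. by rewrite der.unlock der_defM. Qed.
Lemma derU T : der d (bas (ucm T)) = d T.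
Proof. by rewrite der.unlock der_defU. Qed.

HB.instance Definition _ := GRing.isLinear.Build K H H *:%R (der d) derP.

Lemma der0 : der d 0 = 0. Proof. exact: linear0. Qed.
Lemma derZ c a : der d (c *: a) = c *: der d a. Proof. exact: linearZ_LR. Qed.
Lemma derD a b : der d (a + b) = der d a + der d b. Proof. exact: linearD. Qed.

Lemma der1 : der d 1 = 0.
Proof.
have /eqP := derM 1 1; rewrite !mul1r mulr1 -subr_eq0 opprD addrA subrr add0r.
by rewrite oppr_eq0 => /eqP.
Qed.

(** The operator D (x) id on the tensor square. *)
Definition derl : HH -> HH :=
  lext (fun p : forest D * forest D => ten (der d (bas p.1)) (bas p.2)).
HB.instance Definition _ := GRing.Linear.on derl.

Lemma derlP c x y : derl (c *: x + y) = c *: derl x + derl y.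
Proof. exact: lextP. Qed.
Lemma derl0 : derl 0 = 0. Proof. exact: linear0. Qed.

Lemma derl_ten a b : derl (ten a b) = ten (der d a) b.
Proof.
have EU (F G : forest D) : derl (ten (bas F) (bas G)) = ten (der d (bas F)) (bas G).
  by rewrite tenU /derl lext1.
have Er (F : forest D) : derl (ten (bas F) b) = ten (der d (bas F)) b.
  elim/malg_lin_ind: b => [|k' G b IH]; first by rewrite !ten0r derl0.
  by rewrite tenPr derlP IH EU tenPr.
elim/malg_lin_ind: a => [|k F a IH]; first by rewrite der0 !ten0l derl0.
by rewrite tenPl derlP IH Er derP tenPl.
Qed.

Let leibniz (A : algType K) (f : A -> A) (x y : A) := f (x * y) = f x * y + x * f y.

Let leibnizPl (A : algType K) (f : A -> A) k x y z :
  (forall c u v, f (c *: u + v) = c *: f u + f v) ->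
  leibniz f x z -> leibniz f y z -> leibniz f (k *: x + y) z.
Proof.
rewrite /leibniz => fP ex ey.
rewrite mulrDl -scalerAl !fP ex ey !mulrDl -!scalerAl scalerDr.
exact: addrACA.
Qed.

Let leibnizPr (A : algType K) (f : A -> A) k x y z :
  (forall c u v, f (c *: u + v) = c *: f u + f v) ->
  leibniz f z x -> leibniz f z y -> leibniz f z (k *: x + y).
Proof.
rewrite /leibniz => fP ex ey.
rewrite mulrDr -scalerAr !fP ex ey !mulrDr -!scalerAr scalerDr.
exact: addrACA.
Qed.

Lemma derlM x y : derl (x * y) = derl x * y + x * derl y.
Proof.
have EU (F G F' G' : forest D) : leibniz derl (ten (bas F) (bas G)) (ten (bas F') (bas G')).
  by rewrite /leibniz !derl_ten tenM derl_ten derM tenDl !tenM.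
have Er (F G : forest D) : leibniz derl (ten (bas F) (bas G)) y.
  elim/ten_ind: y => [|k F' G' y IH].
    by rewrite /leibniz derl0 !mulr0 derl0 addr0.
  by apply: leibnizPr IH; [exact: derlP | exact: EU].
rewrite -/(leibniz derl x y); elim/ten_ind: x => [|k F G x IH]; last first.
  by apply: leibnizPl IH; [exact: derlP | exact: Er].
by rewrite /leibniz derl0 !mul0r derl0 addr0.
Qed.

End DerivationTheory.

(** * Quotients of algebras *)

Section QuotientAlgebra.

Variables (K : fieldType) (T : lalgType K) (I : zmodClosed T).

(** Centrality of the scalars is part of the conditions because T is only a left
    algebra. *)
Record proper_two_sided : Prop := ProperTwoSided {
  central_scalars : forall (c : K) (a b : T), c *: (a * b) = a * (c *: b);
  ideal_l : forall a u, u \in I -> a * u \in I;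
  ideal_r : forall a u, u \in I -> u * a \in I;
  ideal_proper : 1 \notin I }.

(** The proof of properness is a parameter of the type, since rings are nonzero. *)
Definition quot_alg (h : proper_two_sided) : Type := (Quotient.quot I).

Variable h : proper_two_sided.
Local Notation U := (quot_alg h).

HB.instance Definition _ := GRing.Zmodule.on U.

Definition quot_pi (t : T) : U := \pi_(Quotient.quot I)%qT t.
Definition quot_repr (u : U) : T := repr (u : (Quotient.quot I)).

Lemma quot_reprK u : quot_pi (quot_repr u) = u. Proof. exact: reprK. Qed.

Lemma quot_piE t t' : quot_pi t = quot_pi t' <-> t - t' \in I.
Proof.
by split=> [/eqP|tt']; [|apply/eqP]; rewrite eqmodE.
Qed.

Lemma quot_piB t t' : quot_pi (t - t') = quot_pi t - quot_pi t'.
Proof. exact: (raddfB (\pi_(Quotient.quot I)%qT)). Qed.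
Lemma quot_piD t t' : quot_pi (t + t') = quot_pi t + quot_pi t'.
Proof. exact: (raddfD (\pi_(Quotient.quot I)%qT)). Qed.

Lemma quot_repr_pi t : quot_repr (quot_pi t) - t \in I.
Proof. by apply/quot_piE; rewrite quot_reprK. Qed.

Lemma quot_ind (P : U -> Prop) : (forall t, P (quot_pi t)) -> forall u, P u.
Proof. by move=> Pt u; rewrite -(quot_reprK u). Qed.

Definition quot_mul (u v : U) : U := quot_pi (quot_repr u * quot_repr v).
Definition quot_scale (c : K) (u : U) : U := quot_pi (c *: quot_repr u).

Lemma quot_pi_mul t t' : quot_mul (quot_pi t) (quot_pi t') = quot_pi (t * t').
Proof.
apply/quot_piE; set r := quot_repr _; set r' := quot_repr _.
have -> : r * r' - t * t' = r * (r' - t') + (r - t) * t'.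
  by rewrite mulrBr mulrBl addrA subrK.
by apply: rpredD; [apply: (ideal_l h) | apply: (ideal_r h)]; apply: quot_repr_pi.
Qed.

Lemma quot_pi_scale c t : quot_scale c (quot_pi t) = quot_pi (c *: t).
Proof.
apply/quot_piE; rewrite -scalerBr -[_ - _]mul1r (central_scalars h) -[c *: _]mulr1.
rewrite mulrA; apply: (ideal_r h); apply: (ideal_l h).
by rewrite -[_ - _]mul1r scalerAl; apply: (ideal_l h); apply: quot_repr_pi.
Qed.

Lemma quot_mulA : associative quot_mul.
Proof.
by elim/quot_ind=> x; elim/quot_ind=> y; elim/quot_ind=> z; rewrite !quot_pi_mul mulrA.
Qed.
Lemma quot_mul1 : left_id (quot_pi 1) quot_mul.
Proof. by elim/quot_ind=> x; rewrite quot_pi_mul mul1r. Qed.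
Lemma quot_mulr1 : right_id (quot_pi 1) quot_mul.
Proof. by elim/quot_ind=> x; rewrite quot_pi_mul mulr1. Qed.
Lemma quot_mulDl : left_distributive quot_mul +%R.
Proof.
elim/quot_ind=> x; elim/quot_ind=> y; elim/quot_ind=> z.
by rewrite -quot_piD !quot_pi_mul -quot_piD mulrDl.
Qed.
Lemma quot_mulDr : right_distributive quot_mul +%R.
Proof.
elim/quot_ind=> x; elim/quot_ind=> y; elim/quot_ind=> z.
by rewrite -quot_piD !quot_pi_mul -quot_piD mulrDr.
Qed.
Lemma quot_one_neq0 : quot_pi 1 != 0.
Proof.
apply: contra (ideal_proper h) => /eqP; rewrite -(subrr (quot_pi 0)) -quot_piB.
by move/quot_piE; rewrite !subr0.
Qed.

HB.instance Definition _ := GRing.Zmodule_isNzRing.Build U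
  quot_mulA quot_mul1 quot_mulr1 quot_mulDl quot_mulDr quot_one_neq0.

Lemma quot_scaleA a b v : quot_scale a (quot_scale b v) = quot_scale (a * b) v.
Proof. by elim/quot_ind: v => x; rewrite !quot_pi_scale scalerA. Qed.
Lemma quot_scale1 : left_id 1 quot_scale.
Proof. by elim/quot_ind=> x; rewrite quot_pi_scale scale1r. Qed.
Lemma quot_scaleDr : right_distributive quot_scale +%R.
Proof.
move=> c; elim/quot_ind=> x; elim/quot_ind=> y.
by rewrite -quot_piD !quot_pi_scale -quot_piD scalerDr.
Qed.
Lemma quot_scaleDl v : {morph quot_scale^~ v : a b / a + b}.
Proof. by elim/quot_ind: v => x a b; rewrite !quot_pi_scale -quot_piD scalerDl. Qed.

HB.instance Definition _ := GRing.Zmodule_isLmodule.Build K U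
  quot_scaleA quot_scale1 quot_scaleDr quot_scaleDl.

Lemma quot_scaleAl (a : K) (u v : U) : a *: (u * v) = (a *: u) * v.
Proof.
rewrite -(quot_reprK u) -(quot_reprK v).
rewrite [_ * _]quot_pi_mul [LHS]quot_pi_scale [a *: quot_pi _]quot_pi_scale.
by rewrite [RHS]quot_pi_mul scalerAl.
Qed.
HB.instance Definition _ := GRing.Lmodule_isLalgebra.Build K U quot_scaleAl.

Lemma quot_scaleAr (a : K) (u v : U) : a *: (u * v) = u * (a *: v).
Proof.
rewrite -(quot_reprK u) -(quot_reprK v).
rewrite [_ * _]quot_pi_mul [LHS]quot_pi_scale [a *: quot_pi _]quot_pi_scale.
by rewrite [RHS]quot_pi_mul (central_scalars h).
Qed.
HB.instance Definition _ := GRing.Lalgebra_isAlgebra.Build K U quot_scaleAr.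

(** The quotient is used only through a projection, a section of it and its kernel. *)
Lemma exists_quotient_algebra :
  exists (B : algType K) (p : T -> B) (r : B -> T),
    [/\ [/\ forall c t t', p (c *: t + t') = c *: p t + p t',
            forall t t', p (t * t') = p t * p t' & p 1 = 1],
        cancel r p & forall t, p t = 0 <-> t \in I].
Proof.
exists U, quot_pi, quot_repr; split; [split|exact: quot_reprK|].
- by move=> c t t'; rewrite quot_piD; congr (_ + _); rewrite [RHS]quot_pi_scale.
- by move=> t t'; rewrite [RHS]quot_pi_mul.
- by [].
move=> t; rewrite -(subrr (quot_pi 0)) -quot_piB subrr.
by rewrite quot_piE subr0.
Qed.

End QuotientAlgebra.

(** * Associative products on a basis, and words modulo the commutation relations *)

Section Bundling.

Variable K : fieldType.

(** These identity functions carry a proof of linearity or multiplicativity, from which a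
    bundled map is built. *)
Definition linear_of (V W : lmodType K) (f : V -> W) (_ : linear f) : V -> W := f.
HB.instance Definition _ (V W : lmodType K) (f : V -> W) (fP : linear f) :=
  GRing.isLinear.Build K V W *:%R (linear_of fP) fP.

Definition scalar_of (V : lmodType K) (f : V -> K) (_ : scalar f) : V -> K := f.
HB.instance Definition _ (V : lmodType K) (f : V -> K) (fP : scalar f) :=
  GRing.isLinear.Build K V K *%R (scalar_of fP) fP.

Definition lrmorphism_of (V W : algType K) (f : V -> W) (_ : linear f)
  (_ : monoid_morphism f) : V -> W := f.
HB.instance Definition _ (V W : algType K) (f : V -> W) (fP : linear f)
    (fM : monoid_morphism f) :=
  GRing.isLinear.Build K V W *:%R (lrmorphism_of fP fM) fP.
HB.instance Definition _ (V W : algType K) (f : V -> W) (fP : linear f)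
    (fM : monoid_morphism f) :=
  GRing.isMonoidMorphism.Build V W (lrmorphism_of fP fM) fM.

End Bundling.

Section BasisPreLie.

Variables (K : fieldType) (I : choiceType) (mulb : I -> I -> {malg K[I]}).
Local Notation V := {malg K[I]}.

(** The bilinear product with structure constants mulb. *)
Definition gmul (x y : V) : V := lext (fun i => lext (mulb i) y) x.

Fact gmul_linearl y : linear (gmul^~ y).
Proof. by move=> c x x'; rewrite /gmul lextP. Qed.

Fact gmul_linearr x : linear (gmul x).
Proof.
move=> c y y'; rewrite /gmul.
elim/malg_lin_ind: x => [|k i x IH]; first by rewrite !lext0 scaler0 addr0.
rewrite !lextP IH !lext1 lextP !scalerDr !scalerA [k * c]mulrC.
exact: addrACA.
Qed.

Lemma gmulU i j : gmul (bas i) (bas j) = mulb i j.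
Proof. by rewrite /gmul !lext1. Qed.

Lemma bilinear_basis_eq (W : lmodType K) (f f' : V -> V -> W) :
  (forall y, linear (f^~ y)) -> (forall x, linear (f x)) ->
  (forall y, linear (f'^~ y)) -> (forall x, linear (f' x)) ->
  (forall i j, f (bas i) (bas j) = f' (bas i) (bas j)) -> forall x y, f x y = f' x y.
Proof.
move=> fl fr fl' fr' E x y.
have lin0 (h : V -> W) : linear h -> h 0 = 0.
  by move=> hP; have := hP (-1) 0 0; rewrite scaler0 addr0 scaleN1r addNr.
elim/malg_lin_ind: x => [|c i x IH].
  by rewrite (lin0 _ (fl y)) (lin0 _ (fl' y)).
rewrite (fl y c (bas i) x) (fl' y c (bas i) x) /= IH; congr (_ *: _ + _).
elim/malg_lin_ind: y {IH} => [|k j y IH]; first by rewrite !lin0.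
by rewrite (fr (bas i)) (fr' (bas i)) IH E.
Qed.

Hypothesis mulbA : forall i j k, gmul (mulb i j) (bas k) = gmul (bas i) (mulb j k).

Lemma gmulA : associative gmul.
Proof.
move=> x y z; move: x y; apply: bilinear_basis_eq.
- by move=> y c x x'; rewrite [LHS]gmul_linearl.
- by move=> x c y y'; rewrite [gmul _ z]gmul_linearl [LHS]gmul_linearr.
- by move=> y c x x'; rewrite [gmul _ y]gmul_linearl [LHS]gmul_linearl.
- by move=> x c y y'; rewrite [gmul x _]gmul_linearr [LHS]gmul_linearl.
move=> i j; elim/malg_lin_ind: z => [|c k z IH].
  have g0 x : gmul x 0 = 0 by have := gmul_linearr x (-1) 0 0; rewrite scaler0 addr0 scaleN1r addNr.
  by rewrite !g0.
by rewrite !gmul_linearr IH !gmulU mulbA.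
Qed.

Fact gmul_prelie x y z :
  gmul (gmul x y) z - gmul x (gmul y z) = gmul (gmul y x) z - gmul y (gmul x z).
Proof. by rewrite !gmulA !subrr. Qed.

Definition basis_prelie : preLieAlgebra K :=
  PreLieAlgebra gmul_linearl gmul_linearr gmul_prelie.

End BasisPreLie.

Section Words.

Variables (K : fieldType) (I : choiceType).
Local Notation T := {malg K[{fmonom I}]}.

Definition word (w : seq I) : T := bas (FMonom w).

Lemma wordM w w' : word w * word w' = word (w ++ w').
Proof. by rewrite /word malgMU /mmul /= fmmulE. Qed.

Lemma word_nil : word [::] = 1.
Proof. by rewrite -bas1 /word /mone /= fmoneE. Qed.

Lemma word_cons i w : word (i :: w) = word [:: i] * word w.
Proof. by rewrite wordM. Qed.

Lemma word_lin_ind (P : T -> Prop) :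
  P 0 -> (forall c w t, P t -> P (c *: word w + t)) -> forall t, P t.
Proof. by move=> P0 PS; apply: malg_lin_ind => // c [w] t; apply: PS. Qed.

(** The inclusion of the free module on I into the algebra of words, as words of length 1. *)
Definition lin_word : {malg K[I]} -> T := lext (fun i => word [:: i]).
HB.instance Definition _ := GRing.Linear.on lin_word.

Lemma lin_wordU i : lin_word (bas i) = word [:: i].
Proof. exact: lext1. Qed.

End Words.

Section LieIdeal.

Variables (K : fieldType) (I : choiceType) (mulb : I -> I -> {malg K[I]}).
Local Notation V := {malg K[I]}.
Local Notation T := {malg K[{fmonom I}]}.

(** The relation i j - j i = [i, j] imposed in the enveloping algebra. *)
Definition relator i j : T :=
  word K [:: i; j] - word K [:: j; i] - lin_word (mulb i j - mulb j i).

(** The two-sided ideal generated by the relators, as the intersection of all predicates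
    with the closure properties. *)
Definition lie_ideal : {pred T} := fun t => `[< forall P : T -> Prop,
  P 0 -> (forall x y, P x -> P y -> P (x - y)) ->
  (forall a x, P x -> P (a * x)) -> (forall a x, P x -> P (x * a)) ->
  (forall i j, P (relator i j)) -> P t >].

Lemma lie_ideal_ind (P : T -> Prop) :
  P 0 -> (forall x y, P x -> P y -> P (x - y)) ->
  (forall a x, P x -> P (a * x)) -> (forall a x, P x -> P (x * a)) ->
  (forall i j, P (relator i j)) -> forall t, t \in lie_ideal -> P t.
Proof. by move=> P0 PB Pl Pr PR t /asboolP; apply. Qed.

Fact lie_ideal_zmod : zmod_closed lie_ideal.
Proof.
split; first by apply/asboolP.
move=> x y /asboolP xI /asboolP yI; apply/asboolP => P P0 PB Pl Pr PR.
by apply: (PB); [apply: xI | apply: yI].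
Qed.
HB.instance Definition _ := GRing.isZmodClosed.Build T lie_ideal lie_ideal_zmod.

Lemma lie_ideal_l a u : u \in lie_ideal -> a * u \in lie_ideal.
Proof.
move=> /asboolP uI; apply/asboolP => P P0 PB Pl Pr PR.
by apply: (Pl); apply: uI.
Qed.

Lemma lie_ideal_r a u : u \in lie_ideal -> u * a \in lie_ideal.
Proof.
move=> /asboolP uI; apply/asboolP => P P0 PB Pl Pr PR.
by apply: (Pr); apply: uI.
Qed.

Lemma relator_in i j : relator i j \in lie_ideal.
Proof. by apply/asboolP => P P0 PB Pl Pr PR; apply: PR. Qed.

Lemma lie_ideal_Z c u : u \in lie_ideal -> c *: u \in lie_ideal.
Proof. by move=> uI; rewrite -[u]mul1r scalerAl; apply: lie_ideal_l. Qed.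

(** Membership in the filtration of the quotient by the length of words. The commutator
    of two letters of a word has strictly smaller length, so the associated graded
    algebra is commutative. *)
Definition shorter n t := exists2 t' : T, t - t' \in lie_ideal
  & forall w : {fmonom I}, w \in msupp t' -> (size w < n)%N.

Lemma shorter_ideal n t : t \in lie_ideal -> shorter n t.
Proof. by exists 0; rewrite ?subr0 // => w; rewrite msupp0. Qed.

Lemma shorterD n t u : shorter n t -> shorter n u -> shorter n (t + u).
Proof.
move=> [t' tI t'n] [u' uI u'n]; exists (t' + u'); first by rewrite opprD addrACA rpredD.
by move=> w /(fsubsetP (msuppD_le _ _)); rewrite in_fsetU => /orP[/t'n|/u'n].
Qed.

Lemma shorterZ n c t : shorter n t -> shorter n (c *: t).
Proof.
move=> [t' tI t'n]; exists (c *: t'); first by rewrite -scalerBr lie_ideal_Z.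
by move=> w /(fsubsetP (msuppZ_le _ _)) /t'n.
Qed.

Lemma shorterM n k t u : shorter n.+1 t -> shorter k u -> shorter (n + k) (t * u).
Proof.
move=> [t' tI t'n] [u' uI u'k]; exists (t' * u').
  have -> : t * u - t' * u' = t * (u - u') + (t - t') * u'.
    by rewrite mulrBr mulrBl addrA subrK.
  by apply: rpredD; [apply: lie_ideal_l | apply: lie_ideal_r].
move=> _ /msuppM_le[w1 [w2 [/t'n w1n /u'k w2k ->]]].
by rewrite fmM size_cat -addnS leq_add.
Qed.

Lemma shorter_word n w : (size w < n)%N -> shorter n (word K w).
Proof.
move=> wn; exists (word K w); first by rewrite subrr rpred0.
by move=> w'; rewrite /word -basE msuppU1 in_fset1 => /eqP->.
Qed.

Lemma shorter_lin x : shorter 2 (lin_word x).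
Proof.
elim/malg_lin_ind: x => [|c i x IH].
  by apply: shorter_ideal; rewrite linear0 rpred0.
rewrite [lin_word _]linearP /= lin_wordU; apply: shorterD => //; apply: shorterZ.
exact: shorter_word.
Qed.

(** The relator replaces the commutator of i and j by a combination of single letters. *)
Lemma shorter_swap i j w :
  shorter (size w).+2 (word K (i :: j :: w) - word K (j :: i :: w)).
Proof.
have -> : word K (i :: j :: w) - word K (j :: i :: w)
    = relator i j * word K w + lin_word (mulb i j - mulb j i) * word K w.
  by rewrite -mulrDl subrK mulrBl !wordM.
apply: shorterD; first by apply/shorter_ideal/lie_ideal_r/relator_in.
by rewrite -[(size w).+2]/(1 + (size w).+1)%N; apply: shorterM; [exact: shorter_lin | apply: shorter_word].
Qed.

Let splice (a b c : T) : a - c = (a - b) + (b - c).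
Proof. by rewrite addrA subrK. Qed.

Lemma shorter_cons n i t : shorter n t -> shorter n.+1 (word K [:: i] * t).
Proof. by rewrite -add1n; apply: shorterM; apply: shorter_word. Qed.

(** Moves the letter i to the front by successive exchanges. *)
Lemma shorter_front u i v :
  shorter (size (u ++ i :: v)) (word K (u ++ i :: v) - word K (i :: u ++ v)).
Proof.
elim: u => [|j u IH] /=; first by rewrite subrr; apply: shorter_ideal; apply: rpred0.
rewrite (splice _ (word K (j :: i :: u ++ v))); apply: shorterD.
  by rewrite word_cons [X in _ - X]word_cons -mulrBr; apply: shorter_cons.
have -> : (size (u ++ i :: v)).+1 = (size (u ++ v)).+2 by rewrite !size_cat addnS.
exact: shorter_swap.
Qed.

Lemma shorter_perm w w' : perm_eq w w' -> shorter (size w) (word K w - word K w').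
Proof.
elim: w w' => [|i w IH] w'.
  by rewrite perm_sym => /perm_nilP->; rewrite subrr; apply: shorter_ideal; apply: rpred0.
move=> pw; have iw' : i \in w' by rewrite -(perm_mem pw) mem_head.
case/splitPr: iw' pw => u v pw.
have pw' : perm_eq w (u ++ v).
  by rewrite -(perm_cons i) (permPl pw) -cat1s perm_catCA.
rewrite (splice _ (word K (i :: u ++ v))); apply: shorterD.
  by rewrite word_cons [X in _ - X]word_cons -mulrBr; apply: shorter_cons; apply: IH.
have -> : size (i :: w) = size (u ++ i :: v) by apply: perm_size.
rewrite -opprB -scaleN1r; apply: shorterZ; exact: shorter_front.
Qed.

Variable leT : rel I.
Hypothesis leT_total : total leT.

Definition ordered t := exists2 t' : T, t - t' \in lie_ideal
  & forall w : {fmonom I}, w \in msupp t' -> sorted leT w.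

Lemma ordered0 t : t \in lie_ideal -> ordered t.
Proof. by exists 0; rewrite ?subr0 // => w; rewrite msupp0. Qed.

Lemma orderedD t u : ordered t -> ordered u -> ordered (t + u).
Proof.
move=> [t' tI t'n] [u' uI u'n]; exists (t' + u'); first by rewrite opprD addrACA rpredD.
by move=> w /(fsubsetP (msuppD_le _ _)); rewrite in_fsetU => /orP[/t'n|/u'n].
Qed.

Lemma orderedZ c t : ordered t -> ordered (c *: t).
Proof.
move=> [t' tI t'n]; exists (c *: t'); first by rewrite -scalerBr lie_ideal_Z.
by move=> w /(fsubsetP (msuppZ_le _ _)) /t'n.
Qed.

(** The spanning half of the Poincare-Birkhoff-Witt theorem: sorting a word changes it by
    shorter words, which are dealt with by induction on the length. *)
Lemma ordered_all t : ordered t.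
Proof.
have combine (P : {fmonom I} -> Prop) (t' : T) : (forall w, P w -> ordered (bas w)) ->
    (forall w, w \in msupp t' -> P w) -> ordered t'.
  move=> Pord tP; rewrite [t']malg_sumZ big_seq; elim/big_ind: _ => [|a b|w /tP /Pord].
  - by apply: ordered0; rewrite rpred0.
  - exact: orderedD.
  exact: orderedZ.
have ordw n (w : {fmonom I}) : (size w < n)%N -> ordered (bas w).
  elim: n w => // n IH w; rewrite ltnS => wn.
  have pw : perm_eq w (sort leT w) by rewrite perm_sym perm_sort.
  have [t' tI t'n] := shorter_perm pw.
  have -> : bas w = (word K w - word K (sort leT w) - t') + (t' + word K (sort leT w)).
    by rewrite addrA !subrK; case: (w).
  apply: orderedD; first exact: ordered0; apply: orderedD.
    apply: (combine (fun w => size w < n)%N) => // w' /t'n.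
    by move=> lt; apply: leq_trans lt wn.
  exists (word K (sort leT w)); first by rewrite subrr rpred0.
  move=> w'; rewrite /word -basE msuppU1 in_fset1 => /eqP-> /=.
  exact: sort_sorted.
by apply: (combine (fun _ => True)) => // w _; apply: (ordw (size w).+1).
Qed.

End LieIdeal.

(** * The enveloping algebra *)

Section EnvelopingAlgebra.

Variables (K : fieldType) (I : choiceType) (mulb : I -> I -> {malg K[I]}).
Hypothesis mulbA : forall i j k, gmul mulb (mulb i j) (bas k) = gmul mulb (bas i) (mulb j k).
Hypothesis proper : 1 \notin lie_ideal mulb.
Local Notation T := {malg K[{fmonom I}]}.
Local Notation V := {malg K[I]}.
Local Notation g := (basis_prelie mulbA).

(** Bilinearity of both sides reduces the compatibility of a linear map with brackets to
    basis elements. *)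
Let commutator_linl (B : algType K) (f : V -> B) : linear f ->
  forall y, linear ((fun x y => f x * f y - f y * f x)^~ y).
Proof.
move=> fP y c x x' /=; rewrite fP mulrDl mulrDr -scalerAl -scalerAr opprD addrACA.
by rewrite -scalerBr.
Qed.

Let commutator_linr (B : algType K) (f : V -> B) : linear f ->
  forall x, linear ((fun x y => f x * f y - f y * f x) x).
Proof.
move=> fP x c y y' /=; rewrite fP mulrDl mulrDr -scalerAl -scalerAr opprD addrACA.
by rewrite -scalerBr.
Qed.

Let bracket_linl (B : algType K) (f : V -> B) : linear f ->
  forall y, linear ((fun x y => f (gmul mulb x y - gmul mulb y x))^~ y).
Proof.
move=> fP y c x x' /=; rewrite [gmul mulb (_ + _) y]gmul_linearl [gmul mulb y _]gmul_linearr.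
by rewrite opprD addrACA -scalerBr fP.
Qed.

Let bracket_linr (B : algType K) (f : V -> B) : linear f ->
  forall x, linear ((fun x y => f (gmul mulb x y - gmul mulb y x)) x).
Proof.
move=> fP x c y y' /=; rewrite [gmul mulb (_ + _) x]gmul_linearl [gmul mulb x _]gmul_linearr.
by rewrite opprD addrACA -scalerBr fP.
Qed.

Lemma lie_morphism_basis (B : algType K) (f : {linear g -> B}) :
  (forall i j, f (mulb i j - mulb j i) = f (bas i) * f (bas j) - f (bas j) * f (bas i)) ->
  lie_morphism f.
Proof.
move=> fE; have fP : linear (f : V -> B) by exact: (linearP f).
apply: (bilinear_basis_eq (bracket_linl fP) (bracket_linr fP)
  (commutator_linl fP) (commutator_linr fP)) => i j.
by rewrite !gmulU fE.
Qed.

Section WordMap.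

Variables (B : algType K) (phi : {linear g -> B}).

(** The algebra morphism on words extending phi. *)
Definition word_map : T -> B :=
  lext (fun w : {fmonom I} => \prod_(i <- (w : seq I)) phi (bas i)).

Lemma word_map_mmorphism :
  mmorphism (fun w : {fmonom I} => \prod_(i <- (w : seq I)) phi (bas i)).
Proof. by split=> [w w'|]; rewrite ?fmM ?big_cat ?fm1 ?big_nil. Qed.

Lemma word_mapP c t t' : word_map (c *: t + t') = c *: word_map t + word_map t'.
Proof. exact: lextP. Qed.

Lemma word_map0 : word_map 0 = 0. Proof. exact: lext0. Qed.

Lemma word_mapB t t' : word_map (t - t') = word_map t - word_map t'.
Proof. by rewrite -scaleN1r addrC word_mapP scaleN1r addrC. Qed.

Lemma word_mapM t t' : word_map (t * t') = word_map t * word_map t'.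
Proof. exact: (lextM word_map_mmorphism). Qed.

Lemma word_map1 : word_map 1 = 1.
Proof. exact: (lextone word_map_mmorphism). Qed.

Lemma word_map_word w : word_map (word K w) = \prod_(i <- w) phi (bas i).
Proof. exact: lext1. Qed.

Lemma word_map_lin x : word_map (lin_word x) = phi x.
Proof.
elim/malg_lin_ind: x => [|c i x IH]; first by rewrite [lin_word 0]linear0 word_map0 linear0.
rewrite [lin_word _]linearP word_mapP IH [RHS](linearP phi) /=.
by rewrite lin_wordU word_map_word big_seq1.
Qed.

Lemma word_map_ideal t : lie_morphism phi -> t \in lie_ideal mulb -> word_map t = 0.
Proof.
move=> phiL; move: t; apply: lie_ideal_ind.
- exact: word_map0.
- by move=> x y x0 y0; rewrite word_mapB x0 y0 subrr.
- by move=> a x x0; rewrite word_mapM x0 mulr0.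
- by move=> a x x0; rewrite word_mapM x0 mul0r.
move=> i j; rewrite /relator !word_mapB word_map_lin !word_map_word.
rewrite !big_cons !big_nil !mulr1.
have := phiL (bas i) (bas j); rewrite /pl_bracket /= !gmulU => ->.
exact: subrr.
Qed.

End WordMap.

(** The quotient of the algebra of words by the ideal has the universal property: a
    morphism of Lie algebras extends uniquely to words and kills the relators. The
    projection p and a section r of it are kept for the computations in the quotient. *)
Lemma exists_enveloping :
  exists (U : algType K) (iota : {linear g -> U}) (p : T -> U) (r : U -> T),
    [/\ [/\ forall c t t', p (c *: t + t') = c *: p t + p t',
            forall t t', p (t * t') = p t * p t' & p 1 = 1],
        cancel r p, forall t, p t = 0 <-> t \in lie_ideal mulb,
        forall x, iota x = p (lin_word x) & is_enveloping iota].
Proof.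
have prop : proper_two_sided (lie_ideal mulb : zmodClosed T).
  split; [exact: malg_scaleAr | exact: lie_ideal_l | exact: lie_ideal_r | exact: proper].
have [U [p [r [[pP pM p1] rK pI]]]] := exists_quotient_algebra prop.
have p0 : p 0 = 0 by apply/pI; apply: rpred0.
have pB t t' : p (t - t') = p t - p t'.
  by rewrite -scaleN1r addrC pP scaleN1r addrC.
have iotaP : linear (fun x : g => p (lin_word x) : U).
  by move=> c x y; rewrite [lin_word _](linearP (@lin_word K I)) pP.
pose iota : {linear g -> U} := linear_of iotaP.
exists U, iota, p, r; split=> //; split.
  apply: lie_morphism_basis => i j.
  have rel0 : p (relator mulb i j) = 0 by apply/pI; apply: relator_in.
  move: rel0; rewrite /relator !pB => /eqP; rewrite subr_eq0 => /eqP relE.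
  rewrite /iota /= /linear_of -relE -!pM !lin_wordU !wordM.
  by [].
move=> B phi phiL; split; last first.
  move=> psi psi' e e' u; rewrite -(rK u).
  have gen i : psi (p (word K [:: i])) = psi' (p (word K [:: i])).
    by have := etrans (e (bas i)) (esym (e' (bas i))); rewrite /iota /= /linear_of lin_wordU.
  elim/word_lin_ind: (r u) => [|c w t IH]; first by rewrite p0 !linear0.
  have lin (f : {lrmorphism U -> B}) k a b : f (k *: a + b) = k *: f a + f b.
    exact: linearP.
  have mul (f : {lrmorphism U -> B}) a b : f (a * b) = f a * f b by exact: rmorphM.
  rewrite pP !lin IH; congr (_ *: _ + _); elim: w {IH} => [|i w IH].
    by rewrite word_nil p1 !rmorph1.
  by rewrite word_cons pM !mul gen IH.
pose psi (u : U) := word_map phi (r u).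
have psi_p t : psi (p t) = word_map phi t.
  apply/eqP; rewrite -subr_eq0 -word_mapB; apply/eqP; apply: word_map_ideal => //.
  by apply/pI; rewrite pB rK subrr.
have psiP : linear psi.
  by move=> c u v; rewrite -(rK u) -(rK v) -pP !psi_p word_mapP.
have psiM : monoid_morphism psi.
  split=> [|u v]; first by rewrite -p1 psi_p word_map1.
  by rewrite -(rK u) -(rK v) -pM !psi_p word_mapM.
exists (lrmorphism_of psiP psiM) => x.
by rewrite /= /lrmorphism_of /iota /= /linear_of psi_p word_map_lin.
Qed.

End EnvelopingAlgebra.

(** * The lowering derivations and the duality pairing *)

Section Homogeneous.

Variables (K : fieldType) (D : choiceType) (wt : D -> nat).
Local Notation H := (HCK K D).
Implicit Types (a b : H).
Local Notation homog := (homogeneous wt).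

Lemma homog0 n : homog n (0 : H).
Proof. by move=> F; rewrite msupp0. Qed.

Lemma homogP n c a b : homog n a -> homog n b -> homog n (c *: a + b).
Proof.
move=> ha hb F /(fsubsetP (msuppD_le _ _)); rewrite in_fsetU => /orP[|/hb//].
by move=> /(fsubsetP (msuppZ_le _ _)) /ha.
Qed.

Lemma homogZ n c a : homog n a -> homog n (c *: a).
Proof. by move=> ha; rewrite -[c *: a]addr0; apply: homogP; last apply: homog0. Qed.

Lemma homogD n a b : homog n a -> homog n b -> homog n (a + b).
Proof. by move=> ha hb; rewrite -[a]scale1r; apply: homogP. Qed.

Lemma homogM n k a b : homog n a -> homog k b -> homog (n + k) (a * b).
Proof. by move=> ha hb F /msuppM_le[F1 [F2 [/ha <- /hb <- ->]]]; rewrite degM. Qed.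

Lemma homog_bas F : homog (deg wt F) (bas F : H).
Proof. by move=> G; rewrite -basE msuppU1 in_fset1 => /eqP->. Qed.

Lemma homog1 : homog 0 (1 : H).
Proof. by rewrite -bas1 -(deg1 wt); apply: homog_bas. Qed.

Lemma homog_counit n a : homog n a -> (0 < n)%N -> counit a = 0.
Proof.
move=> ha n0; have [//|] := eqVneq (counit a) 0.
by rewrite /counit mcoeff_neq0 => /ha; rewrite deg1 => n0'; rewrite -n0' in n0.
Qed.

(** What a homogeneous operator of degree -i does to an element of degree n. The second
    clause is there because the subtraction is truncated. *)
Definition lowered i n a := homog (n - i) a /\ ((n < i)%N -> a = 0).

Lemma der_lowered (d : tree D -> H) i :
  (forall T, lowered i (tdeg wt T) (d T)) ->
  forall n a, homog n a -> lowered i n (der d a).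
Proof.
move=> dl.
have basl F : lowered i (deg wt F) (der d (bas F)).
  rewrite -(branchesK F); elim: (branches F) => [|t s [IHh IH0]].
    rewrite forest_of_nil bas1 der1 deg1; split=> //; exact: homog0.
  rewrite forest_of_cons -malgMU derM derU degM deg_ucm.
  set T := tree_class t; have [dh d0] := dl T; split.
    apply: homogD.
      have [le|lt] := leqP i (tdeg wt T).
        by rewrite -addnBAC //; apply: homogM => //; apply: homog_bas.
      by rewrite d0 // mul0r; apply: homog0.
    have [le|lt] := leqP i (deg wt (forest_of s)).
      by rewrite -addnBA // -deg_ucm; apply: homogM => //; apply: homog_bas.
    by rewrite IH0 // mulr0; apply: homog0.
  move=> lt; rewrite d0 ?IH0 ?mul0r ?mulr0 ?addr0 //; apply: leq_ltn_trans lt.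
    exact: leq_addl.
  exact: leq_addr.
move=> n a ha; have -> : der d a = \sum_(F <- msupp a) a@_F *: der d (bas F).
  rewrite {1}[a]malg_sumZ linear_sum; apply: eq_bigr => F _; exact: derZ.
split.
  rewrite big_seq; elim/big_ind: _ => [|u v|F /ha <-]; first exact: homog0.
    exact: homogD.
  by apply: homogZ; have [] := basl F.
move=> ni; rewrite big_seq big1 // => F /ha FE.
by have [_ ->] := basl F; rewrite ?scaler0 // FE.
Qed.

End Homogeneous.

Section Pairing.

Variables (K : fieldType) (D : choiceType) (wt : D -> nat) (m : nat) (alpha : K).
Hypothesis charK : [pchar K] =i pred0.
Hypothesis alpha_neq0 : alpha != 0.
Local Notation H := (HCK K D).
Local Notation HH := (HCK2 K D).
Local Notation homog := (homogeneous wt).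
Variables (Y Z : nat -> H) (Idx : pred nat) (ell : nat -> tree D).
Hypothesis ZE : forall n, Z n = if (n == 0)%N then alpha^-1 *: 1 else Y n.
Hypothesis Idx_pos : forall i, Idx i -> (0 < i)%N.
Hypothesis Idx_add : forall i j, Idx i -> Idx j -> (m %| j)%N -> Idx (i + j)%N.
Hypothesis Y_Idx : forall n, ~~ Idx n -> Y n = 0.
Hypothesis Y_trees : forall n F, F \in msupp (Y n) -> exists T, F = ucm T.
Hypothesis Y_homog : forall n, homog n (Y n).
Hypothesis ell_coef : forall n, Idx n -> (Y n)@_(ucm (ell n)) != 0.
Hypothesis Delta_Z : forall n, Delta (Z n) = ten 1 (Z n)
    + alpha *: \sum_(1 <= a < n.+1 | (m %| n - a)%N) ten (Y a) (Z (n - a)%N).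
Variable X : H -> Prop.
Hypothesis XY : forall a, X a <-> exists n, a = Y n.

Local Notation A := (gen_pred X).

Lemma YA n : Y n \in A.
Proof. by apply: gen_pred_gen; apply/XY; exists n. Qed.

Lemma ZA n : Z n \in A.
Proof. by rewrite ZE; case: ifP => _; [rewrite rpredZ ?rpred1 | exact: YA]. Qed.

Lemma Z_pos n : (0 < n)%N -> Z n = Y n.
Proof. by rewrite ZE lt0n => /negPf->. Qed.

Lemma Z0 : Z 0 = alpha^-1 *: 1.
Proof. by rewrite ZE. Qed.

Lemma Z_homog n : homog n (Z n).
Proof.
rewrite ZE; case: eqP => [->|_]; last exact: Y_homog.
by apply: homogZ; apply: homog1.
Qed.

(** On the chosen tree ell n of Y n, of degree n, the derivation takes the value that makes
    its effect on Y n equal to Z (n - i); it vanishes on all other trees. *)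
Definition lowering_tree (i : nat) (T : tree D) : H :=
  let n := tdeg wt T in
  if [&& Idx n, T == ell n, (i <= n)%N & (m %| n - i)%N]
  then ((Y n)@_(ucm T))^-1 *: Z (n - i)%N else 0.

(** The derivation D_i. It acts on Y n as the functional dual to Y i acts on the left
    factors of the coproduct of Y n, up to the factor alpha. *)
Definition lowering (i : nat) : H -> H := der (lowering_tree i).
HB.instance Definition _ i := GRing.Linear.on (lowering i).

Lemma loweringP i c a b : lowering i (c *: a + b) = c *: lowering i a + lowering i b. Proof. exact: derP. Qed.
Lemma loweringM i a b : lowering i (a * b) = lowering i a * b + a * lowering i b. Proof. exact: derM. Qed.
Lemma lowering1 i : lowering i 1 = 0. Proof. exact: der1. Qed.
Lemma lowering0 i : lowering i 0 = 0. Proof. exact: der0. Qed.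
Lemma loweringZ i c a : lowering i (c *: a) = c *: lowering i a. Proof. exact: derZ. Qed.
Lemma loweringD i a b : lowering i (a + b) = lowering i a + lowering i b. Proof. exact: derD. Qed.

Lemma lowering_homog i n a : homog n a -> lowered wt i n (lowering i a).
Proof.
apply: der_lowered => T; rewrite /lowering_tree; case: ifP => [/and4P[_ _ le _]|_].
  split=> [|lt]; first by apply: homogZ; apply: Z_homog.
  by rewrite leqNgt lt in le.
by split=> //; apply: homog0.
Qed.

(** Only the tree ell n contributes. If n is not in the index set, then n <> i, and neither
    is n - i when m divides n - i, so both sides vanish. *)
Lemma lowering_Z i n : Idx i ->
  lowering i (Z n) = if (i <= n)%N && (m %| n - i)%N then Z (n - i)%N else 0.
Proof.
move=> Ii; have i0 := Idx_pos Ii; have [->|n0] := posnP n.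
  by rewrite Z0 loweringZ lowering1 scaler0 leqNgt i0.
rewrite Z_pos //; have [In|nIn] := boolP (Idx n); last first.
  rewrite (Y_Idx nIn) lowering0; case: ifP => // /andP[le mn].
  have [n_i|lt] := posnP (n - i)%N.
    have ni : n = i by apply/eqP; rewrite eqn_leq le andbT -subn_eq0 n_i.
    by rewrite ni Ii in nIn.
  rewrite Z_pos // Y_Idx //; apply: contra nIn => I'.
  by rewrite -(subnKC le); apply: Idx_add.
have YnE : lowering i (Y n) = \sum_(F <- msupp (Y n)) (Y n)@_F *: lowering i (bas F).
  rewrite {1}[Y n]malg_sumZ /lowering linear_sum; apply: eq_bigr => F _; exact: derZ.
have ellY : ucm (ell n) \in msupp (Y n) by rewrite -mcoeff_neq0 ell_coef.
have degn T : ucm T \in msupp (Y n) -> tdeg wt T = n by rewrite -deg_ucm => /Y_homog.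
rewrite YnE (big_fsetD1 _ ellY) /= big_seq big1 ?addr0 => [|F]; last first.
  rewrite in_fsetD1 => /andP[Fell FY]; have [T FT] := Y_trees FY.
  rewrite FT /lowering derU /lowering_tree degn -?FT // (_ : (T == _) = false) ?andbF ?scaler0 //.
  by apply: contraNF Fell => /eqP TE; rewrite FT TE.
rewrite /lowering derU /lowering_tree degn // In eqxx /=; case: ifP => _; last by rewrite scaler0.
by rewrite scalerA divff ?scale1r // ell_coef.
Qed.

Lemma lowering_A i a : Idx i -> a \in A -> lowering i a \in A.
Proof.
move=> Ii; move: a.
suff H0 a : a \in A -> a \in A /\ lowering i a \in A by move=> a /H0[].
move: a; apply: (@gen_pred_ind _ _ X (fun a => a \in A /\ lowering i a \in A)).
- by rewrite lowering1 rpred1 rpred0.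
- move=> c u v [uA du] [vA dv]; rewrite loweringP; split; apply: rpredD => //; exact: rpredZ.
- move=> u v [uA du] [vA dv]; rewrite loweringM; split; first exact: rpredM.
  by apply: rpredD; apply: rpredM.
move=> b /XY[n ->]; split; first exact: YA.
have [nI|/Y_Idx ->] := boolP (Idx n); last by rewrite lowering0 rpred0.
rewrite -Z_pos ?Idx_pos // lowering_Z //; case: ifP => _; [exact: ZA | exact: rpred0].
Qed.

Let comm_rearrange (V : zmodType) (a b c d a' d' : V) :
  (a + b) + (c + d) - ((a' + c) + (b + d')) = (a - a') + (d - d').
Proof.
rewrite [a' + c + _]addrACA [- (_ + (c + d'))]opprD [LHS]addrACA; congr (_ + _).
  by rewrite opprD addrACA subrr addr0.
by rewrite opprD addrACA subrr add0r.
Qed.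

(** The commutator of two derivations is a derivation; this reduces identities between
    commutators to generators. *)
Lemma derivation_comm (B : nzRingType) (f g : B -> B) (u v : B) :
  (forall u v, f (u * v) = f u * v + u * f v) ->
  (forall u v, g (u * v) = g u * v + u * g v) ->
  (forall u v, f (u + v) = f u + f v) -> (forall u v, g (u + v) = g u + g v) ->
  f (g (u * v)) - g (f (u * v))
    = (f (g u) - g (f u)) * v + u * (f (g v) - g (f v)).
Proof.
move=> fM gM fD gD; rewrite gM fM fD gD !fM !gM mulrBl mulrBr.
exact: comm_rearrange.
Qed.

Definition lowering_comm i j a : H := lowering j (lowering i a) - lowering i (lowering j a).
(** The coefficient of f_(i+j) in the bracket of f_i and f_j. *)
Definition bracket_coef i j : K := (m %| j)%N%:R - (m %| i)%N%:R.
Definition lowering_bracket i j a : H := bracket_coef i j *: lowering (i + j)%N a.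

Let subP (V : lmodType K) c (x y x' y' : V) :
  (c *: x + x') - (c *: y + y') = c *: (x - y) + (x' - y').
Proof. by rewrite opprD addrACA scalerBr. Qed.

Lemma lowering_commP i j c a b : lowering_comm i j (c *: a + b) = c *: lowering_comm i j a + lowering_comm i j b.
Proof. by rewrite /lowering_comm !loweringP subP. Qed.

Lemma lowering_commM i j a b : lowering_comm i j (a * b) = lowering_comm i j a * b + a * lowering_comm i j b.
Proof. by apply: derivation_comm => u v; rewrite ?loweringM ?loweringD. Qed.

Let scale_scale (V : lmodType K) k c (x y : V) :
  k *: (c *: x + y) = c *: (k *: x) + k *: y.
Proof. by rewrite scalerDr !scalerA mulrC. Qed.

Let scale_leibniz (B : algType K) k (x x' y y' : B) :
  k *: (x' * y + x * y') = (k *: x') * y + x * (k *: y').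
Proof. by rewrite scalerDr -scalerAl -scalerAr. Qed.

Lemma lowering_bracketP i j c a b :
  lowering_bracket i j (c *: a + b) = c *: lowering_bracket i j a + lowering_bracket i j b.
Proof. by rewrite /lowering_bracket loweringP scale_scale. Qed.

Lemma lowering_bracketM i j a b :
  lowering_bracket i j (a * b) = lowering_bracket i j a * b + a * lowering_bracket i j b.
Proof. by rewrite /lowering_bracket loweringM scale_leibniz. Qed.

(** Both D_j (D_i Z_n) and D_i (D_j Z_n) are Z_(n-i-j) or 0. When the degrees permit, the
    first is nonzero iff m divides n - i - j and j, the second iff m divides n - i - j and
    i. *)
Lemma lowering_commE i j a : Idx i -> Idx j -> a \in A -> lowering_comm i j a = lowering_bracket i j a.
Proof.
move=> Ii Ij; move: a; apply: (@gen_pred_ind _ _ X (fun a => lowering_comm i j a = lowering_bracket i j a)).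
- by rewrite /lowering_comm /lowering_bracket !lowering1 !lowering0 subrr scaler0.
- by move=> c u v eu ev; rewrite lowering_commP lowering_bracketP eu ev.
- by move=> u v eu ev; rewrite lowering_commM lowering_bracketM eu ev.
move=> _ /XY[n ->]; have [nI|/Y_Idx ->] := boolP (Idx n); last first.
  by rewrite /lowering_comm /lowering_bracket !lowering0 subrr scaler0.
have loweringZ2 k l : Idx k -> Idx l -> lowering l (lowering k (Z n))
    = if (k + l <= n)%N && (m %| n - k - l)%N && (m %| l)%N then Z (n - k - l)%N else 0.
  move=> Ik Il; rewrite lowering_Z //; have l0 := Idx_pos Il.
  have [kn|nk] := leqP k n; last first.
    by rewrite lowering0 leqNgt ltn_addr.
  rewrite -leq_subRL // andTb; have [lnk|nkl] := leqP l (n - k); last first.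
    by rewrite (fun_if (lowering l)) lowering0 lowering_Z // leqNgt nkl if_same.
  rewrite andTb; case mkl: (m %| n - k - l)%N; last first.
    by rewrite (fun_if (lowering l)) lowering0 lowering_Z // mkl andbF if_same.
  rewrite andTb -{1}(subnK lnk) dvdn_addr //.
  by case: ifP => _; rewrite ?lowering0 // lowering_Z // lnk mkl.
rewrite /lowering_comm /lowering_bracket -Z_pos ?Idx_pos // !loweringZ2 // [(j + i)%N]addnC.
rewrite [(n - j - i)%N]subnAC -subnDA.
rewrite /bracket_coef.
case mi: (m %| i)%N; case mj: (m %| j)%N; rewrite ?andbT ?andbF.
- by rewrite !subrr scale0r.
- by rewrite !sub0r scaleN1r lowering_Z // addnC; apply: Idx_add.
- by rewrite !subr0 scale1r lowering_Z //; apply: Idx_add.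
by rewrite !subrr scale0r.
Qed.

(** Reindexing by b = a - i; the summand a = i is set apart since it corresponds to Z_0. *)
Lemma sum_shift (V : nmodType) i n (f : nat -> V) : (0 < i)%N ->
  \sum_(1 <= a < n.+1 | (m %| n - a)%N && ((i <= a)%N && (m %| a - i)%N)) f a
   = if (i <= n)%N && (m %| n - i)%N
     then f i + \sum_(1 <= b < (n - i).+1 | (m %| n - i - b)%N) f (b + i)%N else 0.
Proof.
move=> i0; have [le|lt] := leqP i n; last first.
  rewrite andFb big_nat_cond big1 // => a /andP[/andP[_ an] /and3P[_ ia _]].
  by move: an; rewrite ltnS leqNgt (leq_trans lt).
have arith b : (b + i <= n)%N -> (m %| n - i)%N ->
    (m %| n - (b + i))%N && (m %| b)%N = (m %| n - i - b)%N.
  move=> bin mni; rewrite [(b + i)%N]addnC subnDA; case mnib: (m %| n - i - b)%N => //=.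
  by move: mni; rewrite -{1}(@subnK b (n - i)) ?dvdn_addr // leq_subRL // addnC.
rewrite andTb (@big_cat_nat _ _ _ i) //=; last by rewrite leqW.
rewrite [X in X + _]big_nat_cond [X in X + _]big1 ?add0r; last first.
  by move=> a /andP[/andP[_ ai] /and3P[_ ia _]]; rewrite ltnNge ia in ai.
rewrite -{1}[i]add0n big_addn subSn // big_ltn_cond // add0n leqnn subnn dvdn0 andbT.
have tailE : \sum_(1 <= b < (n - i).+1 | (m %| n - (b + i))%N
       && ((i <= b + i)%N && (m %| b + i - i)%N)) f (b + i)%N
    = if (m %| n - i)%N then
       \sum_(1 <= b < (n - i).+1 | (m %| n - i - b)%N) f (b + i)%N else 0.
  case mni: (m %| n - i)%N; rewrite big_nat_cond; last first.
    rewrite big1 // => b /andP[/andP[_ bn] /and3P[m1 _]].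
    rewrite addnK => m2; move: mni; rewrite -(subnK (_ : (b <= n - i)%N)) ?dvdn_add //.
    by rewrite -subnDA addnC.
  rewrite [RHS]big_nat_cond; apply: eq_bigl => b.
  case bn: (0 < b < (n - i).+1)%N => //=; case/andP: bn => _ bn.
  by rewrite leq_addl addnK arith // addnC -leq_subRL.
by rewrite tailE; case: (m %| n - i)%N.
Qed.

(** Both sides are derivations along the coproduct, so it is enough to compare them on
    the components, where it follows from the formula for the coproduct: the summand
    a = i supplies 1 (x) Z_(n-i), thanks to Z_0 = 1 / alpha. *)
Lemma Delta_lowering i a : Idx i -> a \in A -> Delta (lowering i a) = derl (lowering_tree i) (Delta a).
Proof.
move=> Ii; move: a.
apply: (@gen_pred_ind _ _ X (fun a => Delta (lowering i a) = derl (lowering_tree i) (Delta a))).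
- by rewrite lowering1 Delta0 Delta1 -ten11 derl_ten der1 ten0l.
- by move=> c u v eu ev; rewrite loweringP !DeltaP derlP eu ev.
- move=> u v eu ev.
  have E1 : Delta (lowering i (u * v)) = Delta (lowering i u) * Delta v + Delta u * Delta (lowering i v).
    rewrite loweringM DeltaD; exact: (congr2 +%R (DeltaM _ _) (DeltaM _ _)).
  have E2 : derl (lowering_tree i) (Delta (u * v))
      = derl (lowering_tree i) (Delta u) * Delta v + Delta u * derl (lowering_tree i) (Delta v).
    exact: etrans (congr1 _ (DeltaM u v)) (derlM _ _ _).
  apply: etrans E1 (etrans _ (esym E2)).
  exact: (congr2 (fun x y => x * Delta v + Delta u * y) eu ev).
move=> _ /XY[n ->]; have [In|/Y_Idx ->] := boolP (Idx n); last first.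
  by rewrite lowering0 Delta0 derl0.
have n0 := Idx_pos In; have i0 := Idx_pos Ii.
rewrite -Z_pos // lowering_Z // [in RHS]Delta_Z.
have derlD x y : derl (lowering_tree i) (x + y) = derl (lowering_tree i) x + derl (lowering_tree i) y.
  exact: linearD.
have derlZ c x : derl (lowering_tree i) (c *: x) = c *: derl (lowering_tree i) x.
  exact: linearZ_LR.
have derlS (r : seq nat) (P : pred nat) F :
  derl (lowering_tree i) (\sum_(a <- r | P a) F a) = \sum_(a <- r | P a) derl (lowering_tree i) (F a).
  exact: linear_sum.
rewrite derlD derl_ten der1 ten0l add0r derlZ derlS.
have -> : \sum_(1 <= a < n.+1 | (m %| n - a)%N) derl (lowering_tree i) (ten (Y a) (Z (n - a)%N))
  = \sum_(1 <= a < n.+1 | (m %| n - a)%N && ((i <= a)%N && (m %| a - i)%N))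
      ten (Z (a - i)%N) (Z (n - a)%N).
  rewrite [RHS]big_mkcondr [LHS]big_nat_cond [RHS]big_nat_cond.
  apply: eq_bigr => a /andP[/andP[a0 _] _].
  rewrite derl_ten -Z_pos // -/(lowering i (Z a)) lowering_Z //.
  by case: ifP => _; rewrite ?ten0l.
rewrite (sum_shift n (fun a => ten (Z (a - i)%N) (Z (n - a)%N)) i0).
case: ifP => [/andP[le mni]|_]; last by rewrite scaler0 Delta0.
have combine (V : lmodType K) (u u' w w' : V) : alpha *: u' = u -> w = w' ->
    u + alpha *: w = alpha *: (u' + w') by move=> <- ->; rewrite scalerDr.
rewrite Delta_Z; apply: combine.
  by rewrite subnn Z0 tenZl scalerA divff // scale1r.
rewrite [LHS]big_nat_cond [RHS]big_nat_cond.
apply: eq_bigr => b /andP[/andP[b0 _] _].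
by rewrite addnK (Z_pos b0) -subnDA [(i + b)%N]addnC.
Qed.

(** The letters of a word act one after the other, the first letter first: the algebra of
    words acts from the right. *)
Definition act (w : seq nat) (a : H) : H := foldl (fun b i => lowering i b) a w.

Lemma act_cons i w a : act (i :: w) a = act w (lowering i a). Proof. by []. Qed.

Lemma act_cat w w' a : act (w ++ w') a = act w' (act w a).
Proof. exact: foldl_cat. Qed.

Lemma actP w c a b : act w (c *: a + b) = c *: act w a + act w b.
Proof. by elim: w a b => //= i w IH a b; rewrite loweringP IH. Qed.
HB.instance Definition _ w := GRing.isLinear.Build K H H *:%R (act w) (actP w).

Lemma act0 w : act w 0 = 0. Proof. exact: linear0. Qed.

Lemma act_A w a : all Idx w -> a \in A -> act w a \in A.
Proof. by elim: w a => //= i w IH a /andP[Ii /IH h] aA; apply/h/lowering_A. Qed.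

Lemma act_lowered w n a : homog n a -> lowered wt (sumn w) n (act w a).
Proof.
elim: w n a => [|i w IH] n a ha; first by rewrite /lowered subn0; split.
have [dh d0] := lowering_homog i ha; rewrite act_cons /=.
have [le|lt] := leqP i n; last first.
  rewrite d0 // act0; split=> //; exact: homog0.
have [ah a0] := IH _ _ dh; split=> [|lt]; first by rewrite subnDA.
by apply: a0; rewrite -(ltn_add2l i) subnKC.
Qed.

Definition pairing (w : seq nat) (a : H) : K := counit (act w a).

Lemma pairingP w c a b : pairing w (c *: a + b) = c * pairing w a + pairing w b.
Proof. by rewrite /pairing actP counitP. Qed.

Lemma pairing_homog w n a : homog n a -> (sumn w < n)%N -> pairing w a = 0.
Proof.
move=> ha lt; have [ah _] := act_lowered w ha.
by apply: homog_counit ah _; rewrite subn_gt0.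
Qed.

(** The operator counit (x) id. *)
Definition counitl (x : HH) : H :=
  lext (fun p : forest D * forest D => counit (bas p.1 : H) *: bas p.2) x.

Lemma counitlP c x y : counitl (c *: x + y) = c *: counitl x + counitl y.
Proof. exact: lextP. Qed.

Lemma counitl0 : counitl 0 = 0.
Proof. exact: lext0. Qed.

Let scale_combine (V : lmodType K) k c (x y fx fy : V) :
  fx = k *: x -> fy = k *: y -> c *: fx + fy = k *: (c *: x + y).
Proof. by move=> -> ->; rewrite scalerDr !scalerA mulrC. Qed.

Let scale_combine' (V : lmodType K) k k' c (v fx fy : V) :
  fx = k *: v -> fy = k' *: v -> c *: fx + fy = (c * k + k') *: v.
Proof. by move=> -> ->; rewrite scalerDl scalerA. Qed.

Lemma counitl_ten a b : counitl (ten a b) = counit a *: b.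
Proof.
have EU (F G : forest D) : counitl (ten (bas F) (bas G)) = counit (bas F : H) *: bas G.
  by rewrite tenU /counitl lext1.
have Er (F : forest D) : counitl (ten (bas F) b) = counit (bas F : H) *: b.
  elim/malg_lin_ind: b => [|k G b IH]; first by rewrite ten0r counitl0 scaler0.
  rewrite tenPr counitlP; exact: scale_combine (EU _ _) IH.
elim/malg_lin_ind: a => [|k F a IH]; first by rewrite ten0l counitl0 counit0 scale0r.
rewrite tenPl counitlP counitP; exact: scale_combine' (Er _) IH.
Qed.

Lemma counitl_Delta a : counitl (Delta a) = a.
Proof.
have EU (F : forest D) : counitl (Delta (bas F)) = bas F.
  rewrite -(branchesK F); set s := branches F.
  rewrite Delta_forest_of /counitl lext_sum.
  rewrite -[RHS](sum_copF_counit s (fun r => bas (forest_of r) : H)).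
  apply: eq_bigr => q _; rewrite /fpair lext1 counitU /=.
  case: q => -[|t r] r'; first by rewrite forest_of_nil eqxx scale1r.
  by rewrite forest_of_cons cmM_eq1 cm1_eq1 scale0r.
elim/malg_lin_ind: a => [|c F a IH]; first by rewrite Delta0 counitl0.
by rewrite DeltaP counitlP IH EU.
Qed.

Lemma Delta_act w a s : all Idx w -> a \in A -> Delta a = sum_ten s ->
  Delta (act w a) = sum_ten [seq (act w p.1, p.2) | p <- s].
Proof.
elim: w a s => [|i w IH] a s /=.
  by move=> _ _ ->; apply: congr1; rewrite -[LHS]map_id; apply: eq_map => -[].
move=> /andP[Ii Iw] aA as_; rewrite (IH _ [seq (lowering i p.1, p.2) | p <- s]) ?lowering_A //.
  by rewrite -map_comp.
rewrite Delta_lowering // as_ /sum_ten big_map.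
rewrite (linear_sum (derl (lowering_tree i))); apply: eq_bigr => p _.
exact: derl_ten.
Qed.

(** Concatenation of words becomes convolution: w acts on the left factors of the coproduct,
    and by the counit axiom the action of w leaves the combination of the right factors
    weighted by the pairings of w with the left ones. *)
Lemma pairing_cat w w' a s : all Idx w -> a \in A -> Delta a = sum_ten s ->
  pairing (w ++ w') a = \sum_(p <- s) pairing w p.1 * pairing w' p.2.
Proof.
move=> Iw aA as_; rewrite /pairing act_cat -[act w a]counitl_Delta (Delta_act Iw aA as_).
have -> : counitl (sum_ten [seq (act w p.1, p.2) | p <- s]) = \sum_(p <- s) pairing w p.1 *: p.2.
  rewrite /sum_ten big_map; apply: etrans (lext_sum _ _ _ _) _.
  by apply: eq_bigr => p _; exact: counitl_ten.
have -> : act w' (\sum_(p <- s) pairing w p.1 *: p.2) = \sum_(p <- s) pairing w p.1 *: act w' p.2.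
  by rewrite (linear_sum (act w')); apply: eq_bigr => p _; exact: linearZ_LR.
rewrite /counit raddf_sum; apply: eq_bigr => p _; exact: mcoeffZ.
Qed.

(** The monomial Y_v of a word v, which depends only on the multiset of its letters. *)
Definition Yprod (v : seq nat) : H := \prod_(n <- v) Y n.

Lemma Yprod_cons n v : Yprod (n :: v) = Y n * Yprod v.
Proof. exact: big_cons. Qed.

Lemma Yprod_cat v v' : Yprod (v ++ v') = Yprod v * Yprod v'.
Proof. exact: big_cat. Qed.

Lemma Yprod_perm v v' : perm_eq v v' -> Yprod v = Yprod v'.
Proof. exact: perm_big. Qed.

Lemma Yprod_A v : Yprod v \in A.
Proof. by apply: rpred_prod => n _; apply: YA. Qed.

Lemma Yprod_homog v : homog (sumn v) (Yprod v).
Proof.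
elim: v => [|n v IH]; first by rewrite /Yprod big_nil; apply: homog1.
by rewrite Yprod_cons; apply: homogM => //; apply: Y_homog.
Qed.

Lemma counit_Yprod v : v != [::] -> counit (Yprod v) = 0.
Proof.
case: v => // n v _; rewrite Yprod_cons.
have -> : counit (Y n * Yprod v) = counit (Y n) * counit (Yprod v).
  exact: (rmorphM (@mcoeff (forest D) K mone)).
rewrite (counit_Y Y_trees); exact: mul0r.
Qed.

(** On a factor Y_n with n <> i, D_i gives Z_(n-i) = Y_(n-i) or 0, which does not change the
    number of factors; on a factor Y_i it gives Z_0 = 1 / alpha and thus removes the factor.
    The factors removed are counted by the multiplicity of i in v. *)
Lemma lowering_Yprod i v : Idx i -> all (leq 1) v ->
  exists2 s : seq (seq nat), all (fun u => (size u == size v) && all (leq 1) u) s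
    & lowering i (Yprod v) = alpha^-1 *: ((count_mem i v)%:R *: Yprod (rem i v)) + \sum_(u <- s) Yprod u.
Proof.
move=> Ii; elim: v => [_|j v IH /= /andP[j0 j0v]].
  by exists [::]; rewrite // big_nil addr0 scale0r scaler0 /Yprod big_nil lowering1.
have [s sv sE] := IH j0v; have {IH}loweringE : lowering i (Yprod (j :: v)) = lowering i (Y j) * Yprod v + alpha^-1 *: ((count_mem i v)%:R *:
     (Y j * Yprod (rem i v))) + \sum_(u <- [seq j :: u | u <- s]) Yprod u.
  have mulE (B : algType K) (k l : K) (x y z t u : B) : t = k *: (l *: x) + y ->
    u * x = z -> u * t = k *: (l *: z) + u * y.
    by move=> -> <-; rewrite mulrDr !scalerAr.
  rewrite Yprod_cons loweringM (mulE _ _ _ _ _ (Y j * Yprod (rem i v)) _ _ sE) // addrA.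
  apply: congr1; rewrite big_map mulr_sumr; apply: eq_bigr => u _.
  by rewrite Yprod_cons.
have sv' : all (fun u => (size u == (size v).+1) && all (leq 1) u) [seq j :: u | u <- s].
  by rewrite all_map; apply: sub_all sv => u /= /andP[/eqP-> ->]; rewrite eqxx j0.
have {}loweringE : lowering i (Yprod (j :: v)) = lowering i (Z j) * Yprod v + alpha^-1 *: ((count_mem i v)%:R *:
     (Y j * Yprod (rem i v))) + \sum_(u <- [seq j :: u | u <- s]) Yprod u.
  by rewrite Z_pos.
move: loweringE; rewrite lowering_Z //= [j == i]eq_sym; have [->|ij] := eqVneq i j.
  rewrite leqnn subnn dvdn0 /= Z0 => ->; exists [seq j :: u | u <- s] => //.
  apply: (congr1 (fun z => z + _)); rewrite add1n mulrSr.
  have combine (B : algType K) (k : K) (c : nat) (x y : B) : c%:R *: y = c%:R *: x ->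
      (k *: 1) * x + k *: (c%:R *: y) = k *: ((c%:R + 1) *: x).
    by move=> ->; rewrite -scalerAl mul1r scalerDl scale1r scalerDr addrC.
  (* The two monomials agree if the letter occurs in v; if not, its multiplicity is 0. *)
  apply: combine; have [jv|] := boolP (j \in v).
    by rewrite -Yprod_cons (@Yprod_perm _ v) // perm_sym perm_to_rem.
  by move/count_memPn=> ->; rewrite !scale0r.
rewrite add0n -Yprod_cons; case: ifP => [/andP[le _]|_] ->; last first.
  by exists [seq j :: u | u <- s]; rewrite // mul0r add0r.
have lt : (0 < j - i)%N by rewrite subn_gt0 ltn_neqAle ij.
exists (((j - i)%N :: v) :: [seq j :: u | u <- s]).
  by rewrite /= eqxx lt j0v sv'.
rewrite [in RHS]big_cons Z_pos // -Yprod_cons addrA; apply: (congr1 (fun z => z + _)).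
exact: addrC.
Qed.

Lemma pairing_Yprod_cons i w v : Idx i -> all (leq 1) v ->
  (forall u, size u = size v -> all (leq 1) u -> pairing w (Yprod u) = 0) ->
  pairing (i :: w) (Yprod v) = alpha^-1 * ((count_mem i v)%:R * pairing w (Yprod (rem i v))).
Proof.
move=> Ii v1 w0; have [s /allP sv sE] := lowering_Yprod Ii v1.
have -> : pairing (i :: w) (Yprod v) = pairing w (lowering i (Yprod v)) by [].
rewrite sE pairingP.
have -> : pairing w ((count_mem i v)%:R *: Yprod (rem i v)) = (count_mem i v)%:R * pairing w (Yprod (rem i v)).
  have pair0 : pairing w 0 = 0 by rewrite /pairing act0 counit0.
  by rewrite -[_ *: _]addr0 pairingP pair0 addr0.
have -> : pairing w (\sum_(u <- s) Yprod u) = \sum_(u <- s) pairing w (Yprod u).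
  by rewrite /pairing (linear_sum (act w)) /counit raddf_sum.
rewrite [X in _ + X]big_seq [X in _ + X]big1 ?addr0 // => u /sv /andP[/eqP].
exact: w0.
Qed.

(** Each letter removes at most one factor, and a nonempty product of components has counit
    zero. *)
Lemma pairing_Yprod_small w v : all Idx w -> all (leq 1) v -> (size w < size v)%N ->
  pairing w (Yprod v) = 0.
Proof.
elim: w v => [|i w IH] v /=.
  by move=> _ _; rewrite lt0n size_eq0 => /counit_Yprod.
move=> /andP[Ii Iw] v1 lt; rewrite pairing_Yprod_cons //; last first.
  by move=> u su u1; apply: IH => //; rewrite su ltnW.
have [iv|/count_memPn ->] := boolP (i \in v); last by rewrite mul0r mulr0.
rewrite IH ?mulr0 // ?size_rem //; last by move: lt; case: (size v).
by apply/allP => j /mem_rem; apply/allP.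
Qed.

(** Every letter of w has to remove one factor, equal to that letter; the pairing is then
    the product of the multiplicities met, divided by a power of alpha. *)
Lemma pairing_Yprod_eq w v : all Idx w -> all (leq 1) v -> size w = size v ->
  (pairing w (Yprod v) != 0) = perm_eq w v.
Proof.
elim: w v => [|i w IH] v /=.
  move=> _ _ /esym /eqP; rewrite size_eq0 => /eqP->.
  by rewrite /Yprod big_nil /pairing -[act _ _]bas1 counitU eqxx oner_eq0.
move=> /andP[Ii Iw] v1 sv; rewrite pairing_Yprod_cons //; last first.
  by move=> u su u1; apply: pairing_Yprod_small => //; rewrite su -sv.
rewrite !mulf_eq0 !negb_or invr_eq0 alpha_neq0 /=.
have [iv|iv] := boolP (i \in v); last first.
  rewrite (count_memPn iv) eqxx /=; apply/esym/negP => /perm_mem /(_ i).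
  by rewrite mem_head (negPf iv).
rewrite ((pcharf0P K).1 charK) -lt0n -has_count has_pred1 iv IH //.
- by rewrite -(perm_cons i) (permPr (perm_to_rem iv)).
- by apply/allP => j /mem_rem; apply/allP.
by rewrite size_rem // -sv.
Qed.

(** The index set as a type, needed to speak of words and of the free module on it. *)
Definition idx : Type := {n : nat | Idx n}.
HB.instance Definition _ := Choice.on idx.

Local Notation V := {malg K[idx]}.
Local Notation T := {malg K[{fmonom idx}]}.
Local Notation nats := (map (val : idx -> nat)).

Definition fidx (n : nat) : V := if insub n is Some i then bas (i : idx) else 0.

Lemma fidx_val (i : idx) : fidx (val i) = bas i.
Proof. by rewrite /fidx valK. Qed.

Definition mulb (i j : idx) : V :=
  if (m %| val j)%N then fidx (val i + val j)%N else 0.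

Lemma gmul_fidx i j : Idx i -> Idx j ->
  gmul mulb (fidx i) (fidx j) = if (m %| j)%N then fidx (i + j)%N else 0.
Proof.
move=> Ii Ij; rewrite -[i]/(val (exist _ i Ii : idx)) -[j]/(val (exist _ j Ij : idx)).
by rewrite !fidx_val gmulU.
Qed.

(** Both sides are f_(i+j+k) if m divides j and k, and 0 otherwise: if m divides k, it
    divides j + k iff it divides j. *)
Lemma mulbA i j k : gmul mulb (mulb i j) (bas k) = gmul mulb (bas i) (mulb j k).
Proof.
have g0l y : gmul mulb 0 y = 0.
  by have := gmul_linearl mulb y (-1) 0 0; rewrite scaler0 addr0 scaleN1r addNr.
have g0r x : gmul mulb x 0 = 0.
  by have := gmul_linearr mulb x (-1) 0 0; rewrite scaler0 addr0 scaleN1r addNr.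
rewrite /mulb; case mk: (m %| val k)%N; case mj: (m %| val j)%N; rewrite ?g0l ?g0r //.
- rewrite -!fidx_val !gmul_fidx ?mk ?dvdn_add ?addnA //; try exact: valP.
    exact: Idx_add (valP j) (valP k) mk.
  exact: Idx_add (valP i) (valP j) mj.
- rewrite -!fidx_val gmul_fidx ?dvdn_addl ?mj //; first exact: valP.
  exact: Idx_add (valP j) (valP k) mk.
rewrite -!fidx_val gmul_fidx ?mk //; first exact: Idx_add (valP i) (valP j) mj.
exact: valP.
Qed.

Local Notation g := (basis_prelie mulbA).

Lemma fidx_basis : @is_basis_on K g Idx fidx.
Proof.
split=> [x|s c us sI s0 n ns].
  exists [seq val i | i <- msupp (x : V)],
    (fun n => if insub n is Some i then (x : V)@_(i : idx) else 0); split.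
    by move=> _ /mapP[i _ ->]; apply: valP.
  rewrite big_map {1}[x](malg_sumZ (x : V)); apply: eq_bigr => i _.
  by rewrite valK fidx_val.
have : (\sum_(i <- s) c i *: fidx i : V)@_(exist _ n (sI n ns) : idx) = 0.
  by rewrite [X in X@_ _]s0 mcoeff0.
rewrite raddf_sum (bigD1_seq n) //= big1_seq ?addr0 => [|k /andP[kn ks]].
  rewrite mcoeffZ -[n in fidx n]/(val (exist _ n (sI n ns) : idx)) fidx_val.
  by rewrite -basE mcoeffUU mulr1.
rewrite mcoeffZ -[k in fidx k]/(val (exist _ k (sI k ks) : idx)) fidx_val.
by rewrite -basE mcoeffU -val_eqE /= (negPf kn) mulr0.
Qed.

Definition actT (t : T) (a : H) : H := lext (fun w : {fmonom idx} => act (nats w) a) t.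

Lemma actTP c t t' a : actT (c *: t + t') a = c *: actT t a + actT t' a.
Proof. exact: lextP. Qed.

Lemma actT0l a : actT 0 a = 0. Proof. exact: lext0. Qed.

Lemma actT_word w a : actT (word K w) a = act (nats w) a.
Proof. exact: lext1. Qed.

Lemma actTr t c a b : actT t (c *: a + b) = c *: actT t a + actT t b.
Proof.
have combine (W : lmodType K) k l (x y x' y' u v w : W) :
    u = k *: (l *: x + y) + (l *: x' + y') -> v = k *: x + x' -> w = k *: y + y' ->
    u = l *: v + w.
  by move=> -> -> ->; rewrite !scalerDr !scalerA [k * l]mulrC addrACA.
elim/word_lin_ind: t => [|k w t IH]; first by rewrite !actT0l scaler0 addr0.
apply: combine; first by rewrite actTP actT_word actP IH.
  by rewrite (actTP k (word K w) t a) (actT_word w a).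
rewrite (actTP k (word K w) t b) (actT_word w b); reflexivity.
Qed.

Lemma actT0r t : actT t 0 = 0.
Proof. by have := actTr t (-1) 0 0; rewrite scaler0 addr0 scaleN1r addNr. Qed.

Lemma actTM_word w t a : actT (word K w * t) a = actT t (act (nats w) a).
Proof.
elim/word_lin_ind: t => [|k v t IH]; first by rewrite mulr0 !actT0l.
have -> : word K w * (k *: word K v + t) = k *: word K (w ++ v) + word K w * t.
  by rewrite mulrDr -malg_scaleAr wordM.
rewrite [LHS]actTP [RHS]actTP IH actT_word actT_word map_cat act_cat; reflexivity.
Qed.

Lemma actTM t t' a : actT (t * t') a = actT t' (actT t a).
Proof.
elim/word_lin_ind: t => [|k w t IH]; first by rewrite mul0r !actT0l actT0r.
have -> : (k *: word K w + t) * t' = k *: (word K w * t') + t * t'.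
  by rewrite mulrDl scalerAl.
rewrite [LHS]actTP IH actTM_word actTP actTr actT_word; reflexivity.
Qed.

Lemma actT1 a : actT 1 a = a.
Proof. by rewrite -word_nil actT_word. Qed.

Lemma nats_Idx (w : seq idx) : all Idx (nats w).
Proof. by apply/allP => _ /mapP[i _ ->]; apply: valP. Qed.

Lemma nats_pos (w : seq idx) : all (leq 1) (nats w).
Proof. by apply: sub_all (nats_Idx w) => i; apply: Idx_pos. Qed.

Lemma actT_A t a : a \in A -> actT t a \in A.
Proof.
move=> aA; elim/word_lin_ind: t => [|k w t IH]; first by rewrite actT0l rpred0.
by rewrite actTP actT_word rpredD // rpredZ // act_A ?nats_Idx.
Qed.

Lemma actT_fidx n a : Idx n -> actT (lin_word (fidx n)) a = lowering n a.
Proof.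
move=> In; rewrite -[n]/(val (exist _ n In : idx)) fidx_val lin_wordU actT_word.
by [].
Qed.

Lemma actT_mulb i j a :
  actT (lin_word (mulb i j)) a = (m %| val j)%N%:R *: lowering (val i + val j)%N a.
Proof.
rewrite /mulb; case: ifP => mj; last by rewrite [lin_word 0]linear0 actT0l scale0r.
by rewrite actT_fidx ?scale1r //; exact: Idx_add (valP i) (valP j) mj.
Qed.

Lemma actTB t t' a : actT (t - t') a = actT t a - actT t' a.
Proof. by rewrite -scaleN1r addrC actTP scaleN1r addrC. Qed.

(** The commutation relations of the derivations D_i on A are those of the Lie algebra, so
    that the action passes to the enveloping algebra. *)
Lemma actT_ideal t a : t \in lie_ideal mulb -> a \in A -> actT t a = 0.
Proof.
move=> tI; move: a; apply: (lie_ideal_ind (P := fun t => forall a, a \in A -> actT t a = 0)) tI.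
- by move=> a _; apply: actT0l.
- by move=> x y x0 y0 a aA; rewrite actTB x0 // y0 // subrr.
- by move=> b x x0 a aA; rewrite actTM x0 // actT_A.
- by move=> b x x0 a aA; rewrite actTM x0 // actT0r.
move=> i j a aA; have comE := lowering_commE (valP i) (valP j) aA.
rewrite /relator [lin_word _](linearB (@lin_word K idx)) !actTB !actT_word !actT_mulb.
rewrite -[act _ _ - act _ _]/(lowering_comm (val i) (val j) a) comE /lowering_bracket /bracket_coef.
have cancel_all (W : lmodType K) (p q : K) (v : W) :
  (p - q) *: v - (p *: v - q *: v) = 0 by rewrite -scalerBl subrr.
rewrite [(val j + val i)%N]addnC; exact: cancel_all.
Qed.

(** The ideal acts by zero on A, whereas 1 acts as the identity. *)
Lemma lie_ideal_proper : 1 \notin lie_ideal mulb.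
Proof.
apply/negP => /actT_ideal /(_ (rpred1 _)); rewrite actT1.
by apply/eqP; apply: oner_neq0.
Qed.

Definition pairingT (t : T) (a : H) : K := counit (actT t a).

Lemma pairingTP c t t' a : pairingT (c *: t + t') a = c * pairingT t a + pairingT t' a.
Proof. by rewrite /pairingT actTP counitP. Qed.

Lemma pairingT0 a : pairingT 0 a = 0.
Proof. by rewrite /pairingT actT0l counit0. Qed.

Lemma pairingT_word w a : pairingT (word K w) a = pairing (nats w) a.
Proof. by rewrite /pairingT actT_word. Qed.

Lemma pairingTE t a : pairingT t a = \sum_(w <- msupp t) t@_w * pairing (nats w) a.
Proof.
rewrite {1}[t]malg_sumZ; elim/big_rec2: _ => [|w x y _ <-]; first exact: pairingT0.
by rewrite pairingTP; congr (_ * _ + _); case: w => w; rewrite -pairingT_word.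
Qed.

Definition leI : rel idx := fun i j => (val i <= val j)%N.

Lemma leI_total : total leI. Proof. by move=> i j; apply: leq_total. Qed.
Lemma leI_trans : transitive leI. Proof. by move=> i j k; apply: leq_trans. Qed.
Lemma leI_anti : antisymmetric leI. Proof. by move=> i j /anti_leq /val_inj. Qed.

(** Sorted words are equal as soon as they are permutations of each other: the pairing of
    sorted words with monomials is triangular. *)
Lemma pairing_sorted (w w' : seq idx) : (size w <= size w')%N ->
  sorted leI w -> sorted leI w' -> w != w' -> pairing (nats w) (Yprod (nats w')) = 0.
Proof.
move=> le sw sw' ne; have [lt|ge] := ltnP (size w) (size w').
  by apply: pairing_Yprod_small; rewrite ?nats_Idx ?nats_pos // !size_map.
have eqs : size (nats w) = size (nats w').
  by rewrite !size_map; apply/eqP; rewrite eqn_leq le ge.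
have := pairing_Yprod_eq (nats_Idx w) (nats_pos w') eqs.
have -> : perm_eq (nats w) (nats w') = false; last by move/negbFE/eqP.
apply: contraNF ne => /(perm_map_inj val_inj) pw; apply/eqP.
exact: (sorted_eq leI_trans leI_anti).
Qed.

Lemma pairing_diag (w : seq idx) : pairing (nats w) (Yprod (nats w)) != 0.
Proof. by rewrite pairing_Yprod_eq ?nats_Idx ?nats_pos. Qed.

(** Replace t by a combination t' of sorted words; if t' were nonzero, pairing it with the
    monomial of one of its words of maximal length would isolate the coefficient of this
    word. *)
Lemma pairingT_inj t : (forall w : seq idx, pairingT t (Yprod (nats w)) = 0) -> t \in lie_ideal mulb.
Proof.
have [t' tI t's] := ordered_all mulb leI_total t => t0.
have t'0 (w : seq idx) : pairingT t' (Yprod (nats w)) = 0.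
  have -> : t' = t - (t - t') by rewrite subKr.
  rewrite /pairingT actTB (actT_ideal tI (Yprod_A _)) subr0; exact: t0.
suff t'E : t' = 0 by move: tI; rewrite t'E subr0.
have maxw (s : seq {fmonom idx}) : s != [::] ->
    exists2 w, w \in s & forall w', w' \in s -> (size w' <= size w)%N.
  elim: s => // w s IH _; have [->|/IH[w' w's w'max]] := eqVneq s [::].
    by exists w; rewrite ?mem_head // => w' /[!inE] /eqP->.
  have [le|lt] := leqP (size w) (size w').
    exists w'; rewrite ?inE ?w's ?orbT // => v /[!inE] /predU1P[->//|]; exact: w'max.
  exists w; rewrite ?mem_head // => v /[!inE] /predU1P[->//|/w'max vle].
  exact: leq_trans vle (ltnW lt).
apply/eqP; rewrite -msupp_eq0; apply: contraT => ne.
have [w0 w0s] := fset0Pn _ ne.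
have [|w ws wmax] := maxw (enum_fset (msupp t')).
  have w0s' : w0 \in enum_fset (msupp t') by exact: w0s.
  by apply: contraTneq w0s' => ->.
have := t'0 w; rewrite pairingTE (big_fsetD1 w) //= big1_fset ?addr0 => [/eqP|v vs _].
  by rewrite mulf_eq0 (negPf (pairing_diag w)) orbF mcoeff_eq0 ws.
move: vs; rewrite in_fsetD1 => /andP[vw vs].
by rewrite pairing_sorted ?mulr0 ?wmax ?t's.
Qed.

Fixpoint words_over (s : seq idx) (n : nat) : seq (seq idx) :=
  if n is n'.+1 then [seq i :: w | i <- s, w <- words_over s n'] else [:: [::]].

Lemma mem_words_over s n w : (w \in words_over s n) = (size w == n) && all (mem s) w.
Proof.
elim: n w => [|n IH] [|i w] //=.
  by apply/allpairsP => -[[j v] []].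
apply/allpairsP/andP => [[[j v] /= [js]]|[/eqP[sw] /andP[is_ ws]]].
  by rewrite IH => /andP[/eqP<- vs] [-> ->]; rewrite eqxx js.
by exists (i, w); rewrite IH sw eqxx.
Qed.

(** All letters are positive, so the sum bounds the length and the letters of a word. The
    list is arranged by increasing length for the triangular system solved next. *)
Lemma finite_words N : exists s : seq (seq idx),
  [/\ uniq s, pairwise (fun v w => size v <= size w)%N s
    & forall w, (w \in s) = sorted leI w && (sumn (nats w) < N)%N].
Proof.
pose r : seq idx := pmap insub (iota 0 N).
pose s0 := [seq w <- flatten [seq words_over r n | n <- iota 0 N]
           | sorted leI w && (sumn (nats w) < N)%N].
pose leS : rel (seq idx) := fun v w => (size v <= size w)%N.
exists (sort leS (undup s0)); split.
- by rewrite sort_uniq undup_uniq.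
- rewrite -sorted_pairwise; last by move=> u v w; apply: leq_trans.
  by apply: sort_sorted => u v; apply: leq_total.
move=> w; rewrite mem_sort mem_undup mem_filter; apply: andb_idr => /andP[_ wN].
have sumE i : i \in w -> (val i <= sumn (nats w))%N.
  elim: (w) => //= j v IH /[!inE] /predU1P[->|/IH le]; first exact: leq_addr.
  exact: leq_trans le (leq_addl _ _).
have sizeE : (size w <= sumn (nats w))%N.
  elim: (w) => //= j v IH; rewrite -add1n; apply: leq_add IH; exact: Idx_pos (valP j).
apply/flatten_mapP; exists (size w); first by rewrite mem_iota /= add0n (leq_ltn_trans sizeE).
rewrite mem_words_over eqxx; apply/allP => i iw /=.
by rewrite mem_pmap_sub mem_iota /= add0n (leq_ltn_trans (sumE i iw)).
Qed.

(** A triangular system with nonzero diagonal: adjusting the coefficient of the shortest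
    word w does not affect the values already fixed at the other words, which are not
    shorter than w. *)
Lemma pairingT_solve (F : seq idx -> K) (s : seq (seq idx)) :
  uniq s -> pairwise (fun v w => size v <= size w)%N s -> all (sorted leI) s ->
  exists t : T, (forall w : {fmonom idx}, w \in msupp t -> (w : seq idx) \in s) /\
    forall w, w \in s -> pairingT t (Yprod (nats w)) = F w.
Proof.
elim: s => [|w s IH] /=; first by exists 0; split=> // w; rewrite msupp0.
move=> /andP[ws us] /andP[/allP les ps] /andP[wsort ssort].
have [t [ts tF]] := IH us ps ssort.
pose c := (F w - pairingT t (Yprod (nats w))) / pairing (nats w) (Yprod (nats w)).
exists (c *: word K w + t); split=> [v|v].
  move=> /(fsubsetP (msuppD_le _ _)); rewrite in_fsetU inE => /orP[|/ts->]; last by rewrite orbT.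
  move=> /(fsubsetP (msuppZ_le _ _)); rewrite /word -basE msuppU1 in_fset1 => /eqP->.
  by rewrite eqxx.
rewrite inE pairingTP pairingT_word => /predU1P[->|vs].
  by rewrite /c divfK ?pairing_diag // subrK.
rewrite pairing_sorted ?mulr0 ?add0r ?tF //.
- exact: les.
- by move/allP: ssort => /(_ v vs).
by apply: contraNneq ws => ->.
Qed.

Lemma Yprod_nats_word w w' : Yprod (nats (w ++ w')) = Yprod (nats w) * Yprod (nats w').
Proof. by rewrite map_cat Yprod_cat. Qed.

Definition prod_Y (t : T) : H := lext (fun w : {fmonom idx} => Yprod (nats w)) t.

Lemma prod_YM t t' : prod_Y (t * t') = prod_Y t * prod_Y t'.
Proof.
apply: lextM; split=> [w w'|]; last by rewrite /mone /= fmoneE /Yprod big_nil.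
by rewrite fmM; apply: Yprod_nats_word.
Qed.

(** The monomials in the components span A, and those in components with index outside the
    index set vanish. *)
Lemma A_span a : a \in A ->
  exists t : T, a = \sum_(w <- msupp t) t@_w *: Yprod (nats w).
Proof.
suff H0 : a \in A -> exists t, a = prod_Y t.
  by move=> /H0[t ->]; exists t; rewrite /prod_Y lextE.
move: a; apply: (@gen_pred_ind _ _ X (fun a => exists t, a = prod_Y t)).
- by exists (word K [::]); rewrite /prod_Y /word lext1 /Yprod big_nil.
- by move=> c u v [t ->] [t' ->]; exists (c *: t + t'); rewrite /prod_Y lextP.
- by move=> u v [t ->] [t' ->]; exists (t * t'); rewrite prod_YM.
move=> _ /XY[n ->]; have [In|/Y_Idx ->] := boolP (Idx n); last first.
  by exists 0; rewrite /prod_Y lext0.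
exists (word K [:: exist _ n In : idx]); rewrite /prod_Y /word lext1 /Yprod big_cons big_nil.
by rewrite mulr1.
Qed.

(** Bilinear extension of the rule for the concatenation of two words. *)
Lemma pairingTM t t' a s : a \in A -> Delta a = sum_ten s ->
  pairingT (t * t') a = \sum_(q <- s) pairingT t q.1 * pairingT t' q.2.
Proof.
move=> aA as_.
have combine (c : K) (S : seq (H * H)) (f f' h k : H * H -> K) (u u' v : K) :
    v = c * u + u' -> (forall q, k q = c * f q * h q + f' q * h q) ->
    u = \sum_(q <- S) f q * h q -> u' = \sum_(q <- S) f' q * h q ->
    v = \sum_(q <- S) k q.
  move=> -> kE -> ->; rewrite mulr_sumr -big_split; apply: eq_bigr => q _.
  by rewrite kE mulrA.
have word_r w : pairingT (word K w * t') a = \sum_(q <- s) pairingT (word K w) q.1 * pairingT t' q.2.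
  elim/word_lin_ind: t' => [|c v t' IH].
    rewrite mulr0 pairingT0 [RHS]big1 // => q _; by rewrite pairingT0 mulr0.
  have -> : word K w * (c *: word K v + t') = c *: word K (w ++ v) + word K w * t'.
    by rewrite mulrDr -malg_scaleAr wordM.
  apply: (combine c s (fun q => pairingT (word K v) q.2) (fun q => pairingT t' q.2)
    (fun q => pairingT (word K w) q.1)); first by rewrite pairingTP; reflexivity.
  - move=> q; rewrite (pairingTP c (word K v) t') mulrDr.
    by rewrite mulrC; congr (_ + _); rewrite mulrC.
  - rewrite pairingT_word map_cat (pairing_cat _ (nats_Idx w) aA as_).
    by apply: eq_bigr => q _; rewrite !pairingT_word mulrC.
  by rewrite IH; apply: eq_bigr => q _; rewrite mulrC.
elim/word_lin_ind: t => [|c w t IH].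
  rewrite mul0r pairingT0 [RHS]big1 // => q _; by rewrite pairingT0 mul0r.
have -> : (c *: word K w + t) * t' = c *: (word K w * t') + t * t'.
  by rewrite mulrDl scalerAl.
apply: (combine c s (fun q => pairingT (word K w) q.1) (fun q => pairingT t q.1)
    (fun q => pairingT t' q.2)).
- by rewrite pairingTP; reflexivity.
- move=> q; rewrite (pairingTP c (word K w) t) mulrDl; reflexivity.
- exact: word_r.
exact: IH.
Qed.

Lemma actT_lin_der x a b :
  actT (lin_word x) (a * b) = actT (lin_word x) a * b + a * actT (lin_word x) b.
Proof.
have linP c i y : lin_word (c *: bas i + y) = c *: word K [:: i] + lin_word y.
  by rewrite /lin_word lextP lext1.
have combine (B : algType K) c (u v u' v' w w' z z' y : B) :
   u = u' * w + w' * v' -> v = z * w + w' * z' -> y = c *: u + v ->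
   y = (c *: u' + z) * w + w' * (c *: v' + z').
  move=> -> -> ->; rewrite mulrDl mulrDr scalerDr -scalerAl -scalerAr; exact: addrACA.
elim/malg_lin_ind: x => [|c i x IH].
  by rewrite /lin_word lext0 !actT0l mul0r mulr0 addr0.
rewrite linP; rewrite [X in X * b + _]actTP [X in _ + a * X]actTP.
apply: combine; last exact: actTP; last exact: IH.
by rewrite !actT_word; exact: loweringM.
Qed.

Section GradedDual.

Variables (U : algType K) (iota : {linear g -> U}) (p : T -> U) (r : U -> T).
Hypothesis pP : forall c t t', p (c *: t + t') = c *: p t + p t'.
Hypothesis pM : forall t t', p (t * t') = p t * p t'.
Hypothesis p1 : p 1 = 1.
Hypothesis rK : cancel r p.
Hypothesis pI : forall t, p t = 0 <-> t \in lie_ideal mulb.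
Hypothesis iotaE : forall x, iota x = p (lin_word x).

(** The action of the enveloping algebra, through representatives in the algebra of words;
    on A it does not depend on them. *)
Definition actU (u : U) (a : H) : H := actT (r u) a.

Fact actU_linear u : linear (actU u).
Proof. by move=> c a b; apply: actTr. Qed.
HB.instance Definition _ u := GRing.isLinear.Build K H H *:%R (actU u) (actU_linear u).

Let pB t t' : p (t - t') = p t - p t'.
Proof. by rewrite -scaleN1r addrC pP scaleN1r addrC. Qed.

Lemma actUE t a : a \in A -> actU (p t) a = actT t a.
Proof.
move=> aA; apply/eqP; rewrite -subr_eq0 -actTB; apply/eqP; apply: actT_ideal aA.
by apply/pI; rewrite pB rK subrr.
Qed.

Lemma actUP c u v a : a \in A -> actU (c *: u + v) a = c *: actU u a + actU v a.
Proof. by move=> aA; rewrite -[u in LHS]rK -[v in LHS]rK -pP actUE // actTP. Qed.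

Lemma actUM u v a : a \in A -> actU (u * v) a = actU v (actU u a).
Proof. by move=> aA; rewrite -[u in LHS]rK -[v in LHS]rK -pM actUE // actTM. Qed.

Lemma actU1 a : a \in A -> actU 1 a = a.
Proof. by move=> aA; rewrite -p1 actUE // actT1. Qed.

Lemma actU_A u a : a \in A -> actU u a \in A.
Proof. exact: actT_A. Qed.

(** The elements of the Lie algebra act by derivations, and the general case follows by
    multiplicativity of the coproduct. *)
Lemma env_comul_act u s : env_comul iota u s -> forall a b, a \in A -> b \in A ->
  actU u (a * b) = \sum_(q <- s) actU q.1 a * actU q.2 b.
Proof.
have AM a b : a \in A -> b \in A -> a * b \in A by move=> aA bA; apply: rpredM.
have actUZ c u' a : a \in A -> actU (c *: u') a = c *: actU u' a.
  move=> aA; rewrite -[c *: u']addr0 actUP //.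
  have -> : actU 0 a = 0; last by rewrite addr0.
  by apply: actT_ideal aA; apply/pI; rewrite rK.
have actUD u' v a : a \in A -> actU (u' + v) a = actU u' a + actU v a.
  by move=> aA; rewrite -[u' in LHS]scale1r actUP // scale1r.
elim=> {u s} [|x|c u s _ IH|u v s s' _ IHs _ IHs'|u v s s' _ IHs _ IHs'] a b aA bA.
- by rewrite big_seq1 /= !actU1 // AM.
- rewrite big_cons big_seq1 /= !actU1 // !iotaE !actUE ?AM //; exact: actT_lin_der.
- rewrite actUZ ?AM // IH // scaler_sumr big_map; apply: eq_bigr => q _ /=.
  by rewrite actUZ // scalerAl.
- by rewrite actUD ?AM // IHs // IHs' // big_cat.
rewrite actUM ?AM // IHs // (linear_sum (actU v)) big_allpairs_dep.
apply: eq_bigr => q _; apply: etrans (IHs' _ _ (actU_A q.1 aA) (actU_A q.2 bA)) _.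
apply: eq_bigr => q' _ /=; rewrite (actUM q.1 q'.1 aA) (actUM q.2 q'.2 bA).
reflexivity.
Qed.

Fact dual_scalar u : scalar (fun a : gen_alg X => counit (actU u (val a))).
Proof.
move=> c a b; rewrite -counitP -[c *: actU _ _ + _]actU_linear.
apply: congr1; apply: congr1; exact: (linearP val).
Qed.

Definition dual (u : U) : {scalar gen_alg X} := scalar_of (dual_scalar u).

Lemma dualE u a : dual u a = counit (actU u (val a)). Proof. by []. Qed.

Lemma dual_p t (a : gen_alg X) : dual (p t) a = pairingT t (val a).
Proof. by rewrite dualE actUE // (valP a). Qed.

(** A word lowers degrees by the sum of its letters and the counit vanishes in positive
    degrees, hence a word pairs to zero with all degrees above this sum. *)
Lemma dual_graded u : in_graded_dual wt (dual u).
Proof.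
exists (\sum_(w <- msupp (r u)) sumn (nats (w : {fmonom idx}))).+1 => n a Nn ah.
rewrite dualE -[counit _]/(pairingT (r u) (val a)) pairingTE big_seq big1 // => w ws.
rewrite (pairing_homog ah) ?mulr0 //; apply: leq_trans Nn; rewrite ltnS.
by rewrite (big_fsetD1 w) //= leq_addr.
Qed.

Definition gen_word (w : seq idx) : gen_alg X := exist _ (Yprod (nats w)) (Yprod_A (nats w)).

Lemma dual_inj u v : (forall a, dual u a = dual v a) -> u = v.
Proof.
move=> uv; apply/eqP; rewrite -subr_eq0 -(rK u) -(rK v) -pB; apply/eqP/pI/pairingT_inj => w.
have := uv (gen_word w); rewrite !dualE -/(pairingT (r u) _) -/(pairingT (r v) _) /pairingT actTB => e.
by rewrite /counit mcoeffB; apply/eqP; rewrite subr_eq0; apply/eqP; exact: e.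
Qed.

Lemma scalar_gen_word (f h : {scalar gen_alg X}) :
  (forall w, f (gen_word w) = h (gen_word w)) -> forall a, f a = h a.
Proof.
move=> fh a; have [t aE] := A_span (valP a).
have -> : a = \sum_(w <- msupp t) t@_w *: gen_word w.
  by apply: val_inj; rewrite [LHS]aE (linear_sum val).
by rewrite !linear_sum; apply: eq_bigr => w _; rewrite !linearZ /= fh.
Qed.

(** Solve the system for the finitely many sorted words with sum below the bound N of f; on
    the other monomials both functionals vanish for degree reasons. *)
Lemma dual_surj f : in_graded_dual wt f -> exists u, forall a, dual u a = f a.
Proof.
move=> [N fN]; have [s [us ps sE]] := finite_words N.
have ssort : all (sorted leI) s by apply/allP => w; rewrite sE => /andP[].
have [t [ts tF]] := pairingT_solve (fun w => f (gen_word w)) us ps ssort.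
exists (p t); apply: scalar_gen_word => w; rewrite dual_p.
have pw : perm_eq w (sort leI w) by rewrite perm_sym perm_sort.
have -> : gen_word w = gen_word (sort leI w).
  by apply: val_inj; apply: Yprod_perm; apply: perm_map.
rewrite -[val _]/(Yprod _); set v := sort leI w.
have [vs|] := boolP (v \in s); first exact: tF.
rewrite sE sort_sorted ?andTb -?leqNgt => [Nv|]; last exact: leI_total.
rewrite (fN (sumn (nats v))) //; last exact: Yprod_homog.
rewrite pairingTE big_seq big1 // => u /ts; rewrite sE => /andP[_ uN].
by rewrite (pairing_homog (@Yprod_homog (nats v))) ?mulr0 // (leq_trans uN).
Qed.

Lemma dual_counit eps : is_env_counit iota eps -> forall u, dual u 1 = eps u.
Proof.
move=> eps0 u; have val1 : val (1 : gen_alg X) = 1 by exact: (rmorph1 val).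
rewrite -[u]rK dual_p val1; elim/word_lin_ind: (r u) => [|c w t IH].
  have -> : p 0 = 0 by apply/pI; apply: rpred0.
  by rewrite pairingT0 linear0.
have linE k x y : eps (k *: x + y) = k * eps x + eps y by exact: linearP.
rewrite pairingTP IH pP linE; congr (_ * _ + _); rewrite pairingT_word /pairing.
case: w => [|i w].
  by rewrite word_nil p1 rmorph1 -bas1 counitU eqxx.
have eps_word : eps (p (word K (i :: w))) = 0.
  by rewrite word_cons pM rmorphM /= -lin_wordU -iotaE eps0 mul0r.
have act_word : act (nats (i :: w)) 1 = 0 by rewrite map_cons act_cons lowering1 act0.
exact: etrans (etrans (congr1 _ act_word) (counit0 _ _)) (esym eps_word).
Qed.

Lemma dual_hopf_iso : is_hopf_iso_to_graded_dual wt iota dual.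
Proof.
split.
- by move=> c u v a; rewrite !dualE actUP ?(valP a) // counitP.
- by split; [exact: dual_graded | exact: dual_inj | exact: dual_surj].
- split=> [a|u v a s as_]; first by rewrite dualE actU1 ?(valP a).
  have as' : Delta (val a) = sum_ten [seq (val q.1, val q.2) | q <- s].
    by rewrite -comulE as_ -sum_tens big_map.
  rewrite -[u]rK -[v]rK -pM dual_p (pairingTM _ _ (valP a) as') big_map.
  by apply: eq_bigr => q _; rewrite !dual_p.
split; first exact: dual_counit.
move=> u s us a b; rewrite dualE.
have -> : actU u (val (a * b)) = \sum_(q <- s) actU q.1 (val a) * actU q.2 (val b).
  exact: (env_comul_act us (valP a) (valP b)).
rewrite /counit raddf_sum; apply: eq_bigr => q _.
exact: (rmorphM (@mcoeff (forest D) K mone)).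
Qed.

End GradedDual.

Lemma exists_dual_iso : exists (U : algType K) (iota : {linear g -> U})
    (Phi : U -> {scalar gen_alg X}),
  is_enveloping iota /\ is_hopf_iso_to_graded_dual wt iota Phi.
Proof.
have [U [iota [p [r [[pP pM p1] rK pI iotaE env]]]]] :=
  exists_enveloping mulbA lie_ideal_proper.
by exists U, iota, (dual r); split=> //; apply: dual_hopf_iso.
Qed.

End Pairing.

(** * Hopf subalgebra and graded dual for the equation *)

Theorem proposition21 (K : fieldType) (charK : [pchar K] =i pred0)
    (J : {pred nat}) (J_pos : forall j, j \in J -> (0 < j)%N)
    (J_ne : exists j, j \in J) (m : nat) (alpha : K) (alpha_neq0 : alpha != 0)
    (x : series K (deco J)) (x_sol : dyson_schwinger m alpha x) :
  hopf_subalgebra (gen_pred (components_of x)) /\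
  exists (g : preLieAlgebra K) (f : nat -> g),
    [/\ is_basis_on (index_set J m) f,
        forall i j, index_set J m i -> index_set J m j ->
          pl_mul (f i) (f j) = if (m %| j)%N then f (i + j)%N else 0,
        exists (U : algType K) (iota : {linear g -> U})
               (Phi : U -> {scalar gen_alg (components_of x)}),
          is_enveloping iota /\
          is_hopf_iso_to_graded_dual (@deco_val J) iota Phi
      & associative (@pl_mul K g)].
Proof.
have XY a : components_of x a <-> exists n, a = Y J m alpha n.
  split=> -[n ->]; exists n; first exact: (hom_componentE J_pos alpha_neq0 x_sol).
  exact: esym (hom_componentE J_pos alpha_neq0 x_sol _).
pose Idx : pred nat := fun n => `[< index_set J m n >].
have IdxP n : reflect (index_set J m n) (Idx n) := asboolP _.
have Idx_add i j : Idx i -> Idx j -> (m %| j)%N -> Idx (i + j)%N.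
  by move=> /IdxP Ii /IdxP Ij mj; apply/IdxP; apply: index_set_add.
(* Choose in each nonzero component one of the trees occurring in it. *)
have [ell ell_coef] : exists ell : nat -> tree (deco J),
    forall n, Idx n -> (Y J m alpha n)@_(ucm (ell n)) != 0.
  have tree_ex n : exists T, Idx n -> (Y J m alpha n)@_(ucm T) != 0.
    have [/IdxP /(Y_tree J_pos alpha_neq0 x_sol)[T TY]|_] := boolP (Idx n).
      by exists T.
    have [j jJ] := J_ne; by exists (graft (exist _ j jJ : deco J) mone).
  by have [ell ellP] := boolp.choice tree_ex; exists ell.
split.
  apply: (gen_pred_hopf_subalgebra alpha_neq0 _ _ _ XY).
  - exact: (Y_support J_pos alpha_neq0 x_sol).
  - move=> n n0; rewrite -(Zpos J m alpha n0).
    exact: (Delta_Z J_pos alpha_neq0 x_sol n).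
  - exact: Y0.
exists (basis_prelie (mulbA K Idx_add)), (fidx K Idx); split.
- have [span free] := fidx_basis K Idx_add; split=> [y|s c us sI].
    have [s [c [sI yE]]] := span y; exists s, c; split=> // i /sI; exact/IdxP.
  by apply: free => // i /sI /IdxP.
- by move=> i j /IdxP Ii /IdxP Ij; apply: gmul_fidx.
- apply: (exists_dual_iso charK alpha_neq0 (Y := Y J m alpha) (Z := Z J m alpha)
    (ell := ell) _ _ _ _ _ _ ell_coef _ XY).
  + by [].
  + by move=> n /IdxP[].
  + by move=> n /IdxP; apply: (Y_eq0 J_pos alpha_neq0 x_sol).
  + exact: (Y_support J_pos alpha_neq0 x_sol).
  + exact: (Y_homog J_pos alpha_neq0 x_sol).
  exact: (Delta_Z J_pos alpha_neq0 x_sol).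
- exact: gmulA (mulbA K Idx_add).
Qed.
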